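(* Let $\Gamma$ be a finite, simple, connected, undirected $2$-distance-transitive graph of valency $k\le 8$, and suppose that $\Gamma$ is locally-primitive. Then $\Gamma$ is either $2$-arc-transitive or isomorphic to the icosahedron.
   Context: $\Gamma$ is $2$-distance-transitive if its diameter is at least $2$, $\mathrm{Aut}(\Gamma)$ is vertex-transitive, and for each vertex $u$ the stabilizer $\mathrm{Aut}(\Gamma)_u$ is transitive on $\Gamma(u)$ and on the set $\Gamma_2(u)$ of vertices at distance $2$ from $u$. $\Gamma$ is locally-primitive if for each vertex $u$, $\mathrm{Aut}(\Gamma)_u$ acts primitively on $\Gamma(u)$. $\Gamma$ is $2$-arc-transitive if $\mathrm{Aut}(\Gamma)$ is transitive on vertices and on $2$-arcs (sequences $(u_0,u_1,u_2)$ with $u_0\sim u_1\sim u_2$, $u_0\ne u_2$). *)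

(* Defs.v *)
From mathcomp Require Import all_boot all_fingroup.
From mathcomp Require Import primitive_action.
Set Implicit Arguments.
Unset Strict Implicit.
Unset Printing Implicit Defensive.
Local Open Scope group_scope.

Definition simple_graph (T : finType) (e : rel T) :=
  symmetric e /\ irreflexive e.

Definition connected_graph (T : finType) (e : rel T) :=
  forall x y : T, connect e x y.

Definition nbhd (T : finType) (e : rel T) (u : T) : {set T} := [set v | e u v].

Definition regular_of_valency (T : finType) (e : rel T) (k : nat) :=
  forall u : T, #|nbhd e u| = k.

Definition nbhd2 (T : finType) (e : rel T) (u : T) : {set T} :=
  [set v | [&& v != u, ~~ e u v & [exists w, e u w && e w v]]].

Definition diam_ge2 (T : finType) (e : rel T) :=
  exists u v : T, u != v /\ ~~ e u v.

Definition Aut_set (T : finType) (e : rel T) : {set {perm T}} :=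
  [set g : {perm T} | [forall x, forall y, e (g x) (g y) == e x y]].

Lemma Aut_group_set (T : finType) (e : rel T) : group_set (Aut_set e).
Proof.
apply/group_setP; split.
  by rewrite inE; apply/forallP => x; apply/forallP => y; rewrite !perm1.
move=> g h; rewrite !inE => /forallP Hg /forallP Hh.
apply/forallP => x; apply/forallP => y; rewrite !permM.
by rewrite (eqP (forallP (Hh _) _)) (eqP (forallP (Hg _) _)).
Qed.

Canonical Aut (T : finType) (e : rel T) : {group {perm T}} :=
  group (Aut_group_set e).

Definition vertex_transitive (T : finType) (e : rel T) :=
  [transitive Aut e, on [set: T] | 'P].

Definition two_distance_transitive (T : finType) (e : rel T) :=
  [/\ diam_ge2 e, vertex_transitive e &
      forall u : T,
        [transitive 'C_(Aut e)[u | 'P], on nbhd e u | 'P] /\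
        [transitive 'C_(Aut e)[u | 'P], on nbhd2 e u | 'P]].

Definition locally_primitive (T : finType) (e : rel T) :=
  forall u : T, [primitive 'C_(Aut e)[u | 'P], on nbhd e u | 'P].

Definition two_arc (T : finType) (e : rel T) (a b c : T) :=
  [&& e a b, e b c & a != c].

Definition two_arc_transitive (T : finType) (e : rel T) :=
  vertex_transitive e /\
  forall a b c a' b' c' : T, two_arc e a b c -> two_arc e a' b' c' ->
    exists2 g, g \in Aut e & [/\ g a = a', g b = b' & g c = c'].

(* The icosahedron on vertices 0..11: 0 top, 1..5 upper pentagon,
   6..10 lower pentagon (antiprism), 11 bottom. 30 edges. *)
Definition ico_edges : seq (nat * nat) :=
  [:: (0,1); (0,2); (0,3); (0,4); (0,5);
      (1,2); (2,3); (3,4); (4,5); (1,5);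
      (1,6); (1,7); (2,7); (2,8); (3,8); (3,9); (4,9); (4,10); (5,10); (5,6);
      (6,7); (7,8); (8,9); (9,10); (6,10);
      (11,6); (11,7); (11,8); (11,9); (11,10)]%N.

Definition icosahedron : rel 'I_12 :=
  fun x y => ((nat_of_ord x, nat_of_ord y) \in ico_edges)
          || ((nat_of_ord y, nat_of_ord x) \in ico_edges).

Definition graph_iso (T T' : finType) (e : rel T) (e' : rel T') :=
  exists f : T -> T', bijective f /\ forall x y : T, e' (f x) (f y) = e x y.

(* Main.v *)
(* A 2-transitive action on each neighbourhood gives 2-arc-transitivity. A
   primitive group of degree 4, 6 or 8 is 2-transitive by counting suborbit
   lengths, which leaves the valencies k = 3, 5, 7. There an element of order k
   in a vertex stabiliser labels the neighbourhood by Z/k.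

   If there are triangles, the graph is locally circulant. For k = 3 it would be
   complete; for k = 5 it is locally a pentagon, hence the icosahedron; for k = 7
   edge counts leave nothing.

   If there are none, k (k - 1) = mu |Gamma_2(u)|, where mu is the number of common
   neighbours of two vertices at distance 2. The cases mu = 1, k - 1, k are
   2-arc-transitive. So is k = 5, mu = 2: |Gamma_2(u)| = 10 is even, so a 2-element
   of the stabiliser of u moves a vertex of Gamma_2(u), and a power of it swaps two
   neighbours of u. For k = 7, mu = 3 the suborbits of length 2 yield a block of
   size 3. For k = 7, mu = 2, assume that no automorphism fixing a
   vertex swaps two of its neighbours. Vertex stabilisers are then 7:3, and
   transporting labels along an edge is governed by one permutation of Z/7, which
   a finite check shows to be one of two kinds. Either every claw closes up to a
   cube, and the graph is a quotient of the 7-cube by a code invariant under all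
   permutations of coordinates; or the permutation is x -> c / x, and a coset
   enumeration shows that the graph has 48 vertices and that x -> -x extends to an
   automorphism. In both cases two neighbours can be swapped after all. *)
Require Import Defs.
From mathcomp Require Import all_boot all_fingroup.
From mathcomp Require Import cyclic pgroup sylow gseries primitive_action.
From mathcomp Require Import zify.

Set Implicit Arguments.
Unset Strict Implicit.
Unset Printing Implicit Defensive.
Import GroupScope.
(* The library has an [Aut] of its own, which would hide the one of [Defs]. *)
Import Defs.

(** * Suborbits of primitive groups of small degree *)

(** The critical case is valency 7 with mu = 2. There Gamma_2(u) has 21 vertices, an odd number, so
    the parity argument that works for the 10 vertices in valency 5 says nothing; and 7:3 permutes
    the unordered pairs of neighbours transitively, so the action around a single vertex meets the
    hypotheses and labels have to be followed from vertex to vertex. The device is the frame, a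
    vertex with an ordering of its neighbours. As two neighbours of a vertex have exactly one
    further common neighbour, a frame is carried across an edge by sending each neighbour to the far
    corner of a quadrangle. From a base frame every vertex is then reached by an index: a 0-1 vector
    of length 7, or one of 48 words. Once it is known which indices give the same vertex, and that
    this does not depend on the base frame, any admissible frame is mapped to any other by an
    automorphism. Taking for the second frame a relabelling of the first that exchanges two labels
    gives the contradiction. *)

Section Suborbits.
Variable T : finType.
Implicit Types (H : {group {perm T}}) (S : {set T}) (x y z : T).

Lemma astab_permP H x g : reflect (g \in H /\ g x = x) (g \in 'C_H[x | 'P]).
Proof.
apply: (iffP setIP) => -[Hg]; first by move/astab1P.
by move=> gx; split=> //; apply/astab1P.
Qed.

Lemma orbit_permP H x y :
  reflect (exists2 g, g \in H & g x = y) (y \in orbit 'P H x).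
Proof. by apply: (iffP orbitP) => -[g Hg <-]; exists g. Qed.

(** Apart from the maximality of point stabilisers in [prim_even_sublen_neq1], primitivity is always
    used in this form: the classes of an invariant equivalence are blocks, so there is a single
    class or all classes are singletons. *)
Lemma prim_equiv H S (R : rel T) :
    [primitive H, on S | 'P] ->
    {in S & &, equivalence_rel R} ->
    (forall h, h \in H -> {in S &, forall x y, R (h x) (h y) = R x y}) ->
  {in S &, forall x y, R x y} \/ {in S &, forall x y, R x y -> x = y}.
Proof.
case/andP=> trH /existsPn primH eqR invR.
pose Q := equivalence_partition R S.
have partQ : partition Q S by apply: equivalence_partitionP.
have HS h x : h \in H -> (h x \in S) = (x \in S).
  by move=> Hh; have := actsP (atrans_acts trH) h Hh x.
have actQ : [acts H, on Q | 'P^*].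
  apply/actsP=> h Hh B; apply/imsetP/imsetP=> -[x Sx defB].
    exists (h^-1 x); first by rewrite HS ?groupV.
    apply/setP=> y; have /setP/(_ (h y)) := defB.
    rewrite -/('P^* B h)%act in defB *.
    rewrite !inE /= (mem_imset (f := fun z => h z)) ?HS //; last exact: perm_inj.
    move=> ->; case: (boolP (y \in S)) => //= Sy.
    by rewrite -{1}(permKV h x) invR ?HS ?groupV.
  exists (h x); first by rewrite HS.
  apply/setP=> y; rewrite !inE /= -{1}(permKV h y).
  rewrite (mem_imset (f := fun z => h z)); last exact: perm_inj.
  rewrite defB !inE HS ?groupV //; case: (boolP (y \in S)) => //= Sy.
  by rewrite -{2}(permKV h y) invR ?HS ?groupV.
have := primH Q; rewrite /imprimitivity_system partQ actQ /= negb_and -!leqNgt.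
case/orP=> [le1|geS]; [left | right] => x y Sx Sy.
  have inQ z (Sz : z \in S) : [set t in S | R z t] \in Q by apply/imsetP; exists z.
  have /card_le1P/(_ _ (inQ x Sx)) eqQ := le1.
  have := eqQ [set t in S | R y t]; rewrite inQ // inE => /esym/eqP/setP/(_ y).
  rewrite !inE Sy /= => <-; have [-> //] := eqR y y y Sy Sy Sy.
have injQ : {in S &, injective (fun x => [set t in S | R x t])}.
  by apply/imset_injP; rewrite eqn_leq leq_imset_card.
move=> Rxy; apply: injQ => //; apply/setP=> t; rewrite !inE.
case: (boolP (t \in S)) => //= St.
by have [_ /(_ Rxy) ->] := eqR x y t Sx Sy St.
Qed.

Definition sublen H x y := #|orbit 'P 'C_H[x | 'P] y|.

Lemma card_astab_trans H S x y : [transitive H, on S | 'P] ->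
  x \in S -> y \in S -> #|'C_H[x | 'P]| = #|'C_H[y | 'P]|.
Proof.
move=> trH Sx Sy; have := card_orbit_stab 'P H x; have := card_orbit_stab 'P H y.
rewrite !(atransP trH) // => <- /eqP; rewrite eqn_pmul2l ?card_gt0; last first.
  by apply/set0Pn; exists x.
by move/eqP.
Qed.

Lemma sublen_stab H x y :
  (sublen H x y * #|'C_H[x | 'P] :&: 'C_H[y | 'P]|)%N = #|'C_H[x | 'P]|.
Proof.
rewrite -(card_orbit_stab 'P 'C_H[x | 'P]%G y); congr (_ * #|pred_of_set _|)%N.
by rewrite setIACA setIid setIA.
Qed.

(** Both lengths are the index of the same two-point stabiliser, in point stabilisers of equal
    order. *)
Lemma sublenC H S x y : [transitive H, on S | 'P] ->
  x \in S -> y \in S -> sublen H x y = sublen H y x.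
Proof.
move=> trH Sx Sy; have := sublen_stab H x y; have := sublen_stab H y x.
rewrite setIC (card_astab_trans trH Sx Sy) => <- /eqP.
by rewrite eqn_pmul2r ?cardG_gt0 // => /eqP.
Qed.

Lemma sublen_act H g x y : g \in H -> sublen H (g x) (g y) = sublen H x y.
Proof.
move=> Hg; rewrite /sublen -(card_imset (mem (orbit 'P 'C_H[x | 'P] y)) (@perm_inj _ g)).
apply: eq_card => z; apply/orbit_permP/imsetP.
  case=> h /astab_permP[Hh hgx] <-; exists (g^-1 (h (g y))); last by rewrite permKV.
  apply/orbit_permP; exists (g * h * g^-1); last by rewrite !permM.
  by apply/astab_permP; rewrite !groupM ?groupV // !permM hgx permK.
case=> t /orbit_permP[h /astab_permP[Hh hx] <-] ->.
exists (g^-1 * h * g); last by rewrite !permM permK.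
by apply/astab_permP; rewrite !groupM ?groupV // !permM permK hx.
Qed.

Lemma sublen_gt0 H x y : 0 < sublen H x y.
Proof. by apply/card_gt0P; exists y; apply: orbit_refl. Qed.

Lemma sublen_orbit H x y z :
  z \in orbit 'P 'C_H[x | 'P] y -> sublen H x z = sublen H x y.
Proof. by move=> yz; rewrite /sublen (orbit_eqP yz). Qed.

Lemma transitive_act H S : [transitive H, on S | 'P] ->
  forall h x, h \in H -> (h x \in S) = (x \in S).
Proof. by move=> trH h x Hh; have := actsP (atrans_acts trH) h Hh x. Qed.

Definition sublen_eq H S d x := [set y in S | (y != x) && (sublen H x y == d)].

(** The set is a union of orbits of the stabiliser of [x], all of size [d]. *)
Lemma card_sublen_eq H S d x : [transitive H, on S | 'P] -> x \in S ->
  d %| #|sublen_eq H S d x|.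
Proof.
move=> trH Sx; pose C := 'C_H[x | 'P]%G.
have actC : [acts C, on sublen_eq H S d x | 'P].
  apply/actsP=> h /astab_permP[Hh hx] y; rewrite !inE /=.
  rewrite (transitive_act trH) // -{1 2}hx (inj_eq perm_inj).
  by rewrite /aperm sublen_act.
rewrite (card_uniform_partition (n := d) _ (orbit_partition actC)) ?dvdn_mull //.
by move=> _ /imsetP[y + ->]; rewrite !inE => /and3P[_ _ /eqP].
Qed.

Lemma sublen1_stab_eq H S x y : [transitive H, on S | 'P] ->
  x \in S -> y \in S -> sublen H x y = 1%N -> 'C_H[x | 'P] = 'C_H[y | 'P].
Proof.
move=> trH Sx Sy len1; apply/eqP; rewrite eqEcard (card_astab_trans trH Sx Sy) leqnn andbT.
have := sublen_stab H x y; rewrite len1 mul1n => /eqP eqC.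
by apply/setIidPl/eqP; rewrite eqEcard subsetIl (eqP eqC) leqnn.
Qed.

(** Having the same point stabiliser is an invariant equivalence, so a single coincidence spreads to
    all of [S]. *)
Lemma prim_stab_eq H S x y : [primitive H, on S | 'P] ->
    x \in S -> y \in S -> x != y -> 'C_H[x | 'P] = 'C_H[y | 'P] ->
  {in S &, forall z t, 'C_H[z | 'P] = 'C_H[t | 'P]}.
Proof.
move=> primH Sx Sy xy Cxy; have trH := proj1 (andP primH).
have CJ g z : g \in H -> 'C_H[g z | 'P] = 'C_H[z | 'P] :^ g.
  move=> Hg; apply/setP=> h; rewrite mem_conjg.
  apply/astab_permP/astab_permP=> -[Hh hz].
    by rewrite groupJ ?groupV // conjgE invgK !permM hz permK.
  move: Hh hz; rewrite groupJr ?groupV // => ->; rewrite conjgE invgK !permM => hz.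
  by split=> //; rewrite -{2}hz permKV.
have [] // := prim_equiv (R := fun z t => 'C_H[z | 'P] == 'C_H[t | 'P]) primH.
- by move=> a b c _ _ _; split=> // /eqP->.
- move=> h Hh a b Sa Sb; rewrite !CJ //; apply/eqP/eqP=> [|-> //].
  by move/conjsg_inj.
- by move=> all z t Sz St; apply/eqP/all.
by move=> /(_ x y Sx Sy); rewrite Cxy eqxx => /(_ isT) eqxy; rewrite eqxy eqxx in xy.
Qed.

(** A suborbit of length 1 makes all point stabilisers equal to one normal subgroup C, with H / C of
    even order |S|. Cauchy gives a subgroup of order 2 in H / C, and as |S| > 2 its preimage lies
    strictly between C and H, against the maximality of C. *)
Lemma prim_even_sublen_neq1 H S x y : [primitive H, on S | 'P] ->
  ~~ odd #|S| -> 2 < #|S| -> x \in S -> y \in S -> x != y -> sublen H x y != 1%N.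
Proof.
move=> primH evS gt2 Sx Sy xy; apply/eqP=> len1; have trH := proj1 (andP primH).
have allC := prim_stab_eq primH Sx Sy xy (sublen1_stab_eq trH Sx Sy len1).
set C := 'C_H[x | 'P] in allC; pose CG := 'C_H[x | 'P]%G.
have sCH : CG \subset H by apply: subsetIl.
have nCH : H \subset 'N(CG).
  apply/subsetP=> g Hg; rewrite inE; apply/subsetP=> h; rewrite mem_conjg.
  move=> /astab_permP[]; rewrite groupJr ?groupV // conjgE invgK !permM => Hh hx.
  have Sgx : g x \in S by rewrite (transitive_act trH).
  rewrite /= (allC x (g x)) //; apply/astab_permP; split=> //.
  by rewrite -{2}hx permKV.
have idx : #|H / CG| = #|S|.
  by rewrite card_quotient // -(atransP trH _ Sx) card_orbit.
have [|X HX oX] := @Cauchy _ 2 (H / CG)%G isT; first by rewrite idx dvdn2.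
pose L := (coset CG @*^-1 <[X]>)%G.
have sLH : L \subset H.
  rewrite sub_cosetpre_quo ?cycle_subG //; by apply/andP.
have sCL : CG \subset L by apply: sub_cosetpre.
have oL : #|L| = (#|CG| * 2)%N by rewrite card_cosetpre -oX.
have := primH; rewrite (trans_prim_astab Sx trH) => /maximal_eqP[_ /(_ L sCL sLH)].
case=> eqL; first by move: oL; rewrite eqL -{1}[#|_|]muln1 => /eqP; rewrite eqn_pmul2l ?cardG_gt0.
move: idx; rewrite card_quotient // -(Lagrange_index sLH sCL).
rewrite -!divgS // {1}eqL divnn cardG_gt0 mul1n oL mulKn ?cardG_gt0 // => eq2.
by rewrite -eq2 in gt2.
Qed.

(** Stabilisers of coprime index satisfy H = H_x H_y, and the factor H_x does not move [x]. *)
Lemma coprime_orbit_stab H x y :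
    coprime #|orbit 'P H x| #|orbit 'P H y| ->
  orbit 'P 'C_H[y | 'P] x = orbit 'P H x.
Proof.
rewrite !card_orbit => co.
have HE : ('C_H[x | 'P] * 'C_H[y | 'P])%g = H.
  by apply: coprime_index_mulG; rewrite ?subsetIl.
apply/setP=> z; apply/orbit_permP/orbit_permP=> -[g].
  by move=> /astab_permP[Hg _] <-; exists g.
rewrite -{1}HE => /mulsgP[h k /astab_permP[_ hx] Ck ->].
by rewrite permM hx => <-; exists k.
Qed.

(** The cardinality hypothesis says that there is exactly one suborbit of length [d]. Joined with
    equality, its orbital turns out to be an equivalence relation, and primitivity makes it
    total. *)
Lemma prim_coprime_sublen H S d x : [primitive H, on S | 'P] -> x \in S -> 0 < d ->
    #|sublen_eq H S d x| = d ->
    {in S, forall y, y != x -> sublen H x y != d -> coprime (sublen H x y) d} ->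
  d = #|S|.-1.
Proof.
move=> primH Sx d_gt0 cardD coD; have trH := proj1 (andP primH).
pose D := sublen_eq H S d.
have DJ g a b : g \in H -> (g b \in D (g a)) = (b \in D a).
  move=> Hg; rewrite !inE (transitive_act trH) // (inj_eq perm_inj).
  by rewrite sublen_act.
have cardDa a : a \in S -> #|D a| = d.
  move=> Sa; have [g Hg ->] := atransP2 trH Sx Sa.
  rewrite -cardD -(card_imset (mem (D x)) (@perm_inj _ g)).
  apply: eq_card => b; rewrite -{1}(permKV g b) DJ //.
  by rewrite -{2}(permKV g b) (mem_imset _ _ (@perm_inj _ g)).
have DC a b : a \in S -> b \in S -> (b \in D a) = (a \in D b).
  by move=> Sa Sb; rewrite !inE Sa Sb eq_sym (sublenC trH Sa Sb).
have coDa a b : a \in S -> b \in S -> b != a -> b \notin D a -> coprime (sublen H a b) d.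
  move=> Sa; have [g Hg defa] := atransP2 trH Sx Sa; rewrite /= /aperm in defa.
  rewrite defa -(permKV g b); move: (g^-1 b) => c.
  rewrite (transitive_act trH) // (inj_eq perm_inj) DJ // sublen_act //.
  by rewrite inE => Sc cx; rewrite Sc cx; apply: coD.
have orbD a b : a \in S -> b \in D a -> orbit 'P 'C_H[a | 'P] b = D a.
  move=> Sa Dab; apply/eqP; rewrite eqEcard cardDa //.
  move: (Dab); rewrite inE => /and3P[Sb ba /eqP lenab].
  rewrite -/(sublen H a b) lenab leqnn andbT.
  apply/subsetP=> c /orbit_permP[h /astab_permP[Hh ha] <-].
  by rewrite -{1}ha DJ.
(* Equality of the sets [D a] is an invariant equivalence. It is not total, since [b \in D x] while
   [b \notin D b]. *)
have twin : {in S &, forall a b, D a = D b -> a = b}.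
  have [] // := prim_equiv (R := fun a b => D a == D b) primH.
  - by move=> a b c _ _ _; split=> // /eqP->.
  - move=> h Hh a b Sa Sb; apply/eqP/eqP=> eqD; apply/setP=> c.
      by rewrite -(DJ h a) // -(DJ h b) // eqD.
    by rewrite -(permKV h c) !DJ // eqD.
  - have /set0Pn[b Db] : D x != set0 by rewrite -card_gt0 cardDa.
    have Sb : b \in S by move: Db; rewrite inE => /andP[].
    move=> /(_ x b Sx Sb) /eqP/setP/(_ b); rewrite Db.
    by rewrite inE eqxx andbF.
  by move=> tw a b Sa Sb eqD; apply: tw => //; apply/eqP.
(* If [c] were outside [D a], coprimality would make the stabiliser of both [a] and [c] transitive
   on [D a]. Since [b] lies in [D a] and in [D c], this puts [D a] inside [D c], and [twin] gives
   [a = c]. *)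
have trD a b c : a \in S -> b \in S -> c \in S -> b \in D a -> c \in D b -> c != a -> c \in D a.
  move=> Sa Sb Sc Dab Dbc ca; apply/contraT => Dac.
  have co := coDa a c Sa Sc ca Dac.
  have := @coprime_orbit_stab 'C_H[a | 'P]%G b c.
  rewrite -/(sublen H a c) /= orbD // cardDa // coprime_sym => /(_ co) eqorb.
  case/negP: ca; apply/eqP/twin => //; apply/eqP.
  rewrite eq_sym eqEcard !cardDa // leqnn andbT -eqorb.
  apply/subsetP=> t /orbit_permP[h /setIP[/astab_permP[Hh ha] /astab1P hc] <-].
  by rewrite -[X in D X]hc DJ // DC.
have [] // := prim_equiv (R := fun a b => (a == b) || (b \in D a)) primH.
- move=> a b c Sa Sb Sc; rewrite eqxx; split=> // /orP[/eqP-> //|Dab].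
  case: (eqVneq a c) => [<-|ac]; first by rewrite -DC // Dab orbT.
  rewrite /=; case: (eqVneq b c) => [<-//|bc] /=.
  apply/idP/idP=> [Dac|Dbc].
    by apply: (trD b a c) => //; [rewrite DC | rewrite eq_sym].
  by apply: (trD a b c) => //; rewrite eq_sym.
- by move=> h Hh a b Sa Sb; rewrite (inj_eq perm_inj) DJ.
- move=> full; have eqS : S :\ x = D x.
    apply/setP=> y; case: (eqVneq y x) => [->|yx]; first by rewrite !inE eqxx andbF.
    case: (boolP (y \in S)) => Sy; last by rewrite !inE (negPf Sy) andbF.
    have := full x y Sx Sy; rewrite eq_sym (negPf yx) /= => ->.
    by rewrite !inE yx Sy.
  by rewrite (cardsD1 x S) Sx eqS cardDa.
have /set0Pn[b Db] : D x != set0 by rewrite -card_gt0 cardDa.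
have Sb : b \in S by move: Db; rewrite inE => /andP[].
move=> /(_ x b Sx Sb); rewrite Db orbT => /(_ isT) eqxb.
by move: Db; rewrite eqxb inE eqxx andbF.
Qed.

Lemma sum_sublen_eq H S n x : x \in S -> #|S| = n.+1 ->
    [transitive H, on S | 'P] ->
  (\sum_(1 <= d < n.+1) #|sublen_eq H S d x|)%N = n.
Proof.
move=> Sx cardS trH.
transitivity #|S :\ x|; last by move: cardS; rewrite (cardsD1 x) Sx => -[].
have bound y : y \in S :\ x -> sublen H x y < n.+1.
  rewrite -cardS; move=> /setD1P[yx Sy].
  have -> : #|S| = #|S :\ x|.+1 by rewrite (cardsD1 x S) Sx.
  rewrite ltnS; apply/subset_leq_card/subsetP=> z /orbit_permP[h /astab_permP[Hh hx] <-].
  by rewrite !inE (transitive_act trH) // Sy -{1}hx (inj_eq perm_inj) yx.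
rewrite -sum1_card (partition_big (fun y => inord (sublen H x y) : 'I_n.+1) predT) //=.
rewrite (big_ord_recl n) [X in _ = (X + _)%N]big1 ?add0n; last first.
  move=> y /andP[Sy /eqP/(congr1 val)]; rewrite /= inordK ?bound // => eq0.
  by have := sublen_gt0 H x y; rewrite eq0.
rewrite big_add1 big_mkord; apply: eq_bigr => i _ /=.
rewrite -sum1_card; apply: eq_bigl => y; rewrite !inE.
case: (boolP (y \in S)) => [Sy|]; last by rewrite andbF.
case: eqVneq => [//|yx] /=; rewrite -val_eqE /= inordK //.
by rewrite bound // !inE yx.
Qed.

End Suborbits.

(** * Primitive groups of degree 4, 6, 8, and elements of prime power order *)

Section SmallPrimitive.
Variable T : finType.
Implicit Types (H : {group {perm T}}) (S : {set T}) (x y z : T).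

Lemma sublen_full H S x : [transitive H, on S | 'P] -> x \in S ->
    {in S, forall y, y != x -> sublen H x y = #|S|.-1} ->
  {in S &, forall y z, y != x -> z != x -> exists2 g, g \in H & g x = x /\ g y = z}.
Proof.
move=> trH Sx lenS y z Sy Sz yx zx.
have /setP/(_ z) : orbit 'P 'C_H[x | 'P] y = S :\ x.
  apply/eqP; rewrite eqEcard -/(sublen H x y) lenS //.
  rewrite (cardsD1 x S) Sx leqnn andbT.
  apply/subsetP=> t /orbit_permP[h /astab_permP[Hh hx] <-].
  by rewrite !inE (transitive_act trH) // Sy -{1}hx (inj_eq perm_inj) yx.
rewrite !inE zx Sz => /orbit_permP[g /astab_permP[Hg gx] gy].
by exists g.
Qed.

Lemma prim_deg468 H S x : [primitive H, on S | 'P] ->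
    #|S| \in [:: 4; 6; 8] -> x \in S ->
  {in S, forall y, y != x -> sublen H x y = #|S|.-1}.
Proof.
move=> primH Sn Sx; have trH := proj1 (andP primH).
pose c (d : nat) := #|sublen_eq H S d x|.
have c_dvd d : d %| c d by apply: card_sublen_eq.
have c1 : c 1%N = 0%N.
  apply/eqP; rewrite cards_eq0; apply/set0Pn=> -[y]; rewrite inE => /and3P[Sy yx].
  apply/negP/(prim_even_sublen_neq1 primH) => //; last by rewrite eq_sym.
    by move: Sn; rewrite !inE => /or3P[] /eqP->.
  by move: Sn; rewrite !inE => /or3P[] /eqP->.
have c_gt0 y : y \in S -> y != x -> 0 < c (sublen H x y).
  by move=> Sy yx; apply/card_gt0P; exists y; rewrite inE Sy yx /=.
have c_le d : c d <= #|S|.-1.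
  rewrite (cardsD1 x S) Sx; apply/subset_leq_card/subsetP=> y.
  by rewrite !inE => /and3P[-> ->].
have c0 : c 0%N = 0%N by have := c_dvd 0%N; rewrite dvd0n => /eqP.
have big d : #|S|.-1 < d -> c d = 0%N.
  have := c_le d; have /dvdnP[q ->] := c_dvd d; case: q => // q.
  by rewrite mulSn => le1 le2; move: (leq_trans le2 (leq_trans (leq_addr _ _) le1)); rewrite ltnn.
suff [d d0 [cd cod]] : exists2 d, 0 < d & c d = d /\
    forall l, l != d -> 0 < c l -> coprime l d.
  have dS : d = #|S|.-1.
    apply: (prim_coprime_sublen primH Sx d0 cd) => y Sy yx ld.
    by apply: cod => //; apply: c_gt0.
  have : sublen_eq H S d x == S :\ x.
    rewrite eqEcard -/(c d) cd dS (cardsD1 x S) Sx leqnn andbT.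
    by apply/subsetP=> y; rewrite !inE => /and3P[-> ->].
  move=> /eqP/setP eqS y Sy yx; have := eqS y; rewrite !inE Sy yx -dS /=.
  by move/eqP.
(* Without parts equal to 1, the number 3 is only 3; 5 is 5 or 3 + 2; 7 is 7, 5 + 2, 3 + 4 or 3 + 2
   + 2. In each case there is one odd part, and it is coprime to the others: this is the [d] to be
   supplied. *)
move: Sn big; rewrite !inE => /or3P[]/eqP cS; rewrite cS => big.
- have := sum_sublen_eq Sx cS trH; rewrite unlock /= -!/(c _) c1 addn0.
  have /dvdnP[a2 e2] := c_dvd 2%N; have /dvdnP[a3 e3] := c_dvd 3%N.
  move=> sumc; exists 3%N => //; split; first by lia.
  move=> l ld; case: (ltnP 3%N l) => [/big->//|]; case: l ld => [|[|[|[|l]]]] //;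
    rewrite ?c0 ?c1 //=; lia.
- have := sum_sublen_eq Sx cS trH; rewrite unlock /= -!/(c _) c1 addn0.
  have /dvdnP[a2 e2] := c_dvd 2%N; have /dvdnP[a3 e3] := c_dvd 3%N.
  have /dvdnP[a4 e4] := c_dvd 4%N; have /dvdnP[a5 e5] := c_dvd 5%N.
  move=> sumc; have [e|e] : (c 5 = 5 \/ (c 5 = 0 /\ c 3 = 3 /\ c 4 = 0))%N by lia.
    exists 5%N => //; split => //.
    move=> l ld; case: (ltnP 5%N l) => [/big->//|]; case: l ld => [|[|[|[|[|[|l]]]]]] //;
    rewrite ?c0 ?c1 //=; lia.
  exists 3%N => //; split; first by lia.
  move=> l ld; case: (ltnP 5%N l) => [/big->//|]; case: l ld => [|[|[|[|[|[|l]]]]]] //;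
    rewrite ?c0 ?c1 //=; lia.
have := sum_sublen_eq Sx cS trH; rewrite unlock /= -!/(c _) c1 addn0.
have /dvdnP[a2 e2] := c_dvd 2%N; have /dvdnP[a3 e3] := c_dvd 3%N.
have /dvdnP[a4 e4] := c_dvd 4%N; have /dvdnP[a5 e5] := c_dvd 5%N.
have /dvdnP[a6 e6] := c_dvd 6%N; have /dvdnP[a7 e7] := c_dvd 7%N.
move=> sumc; have [e|[e|e]] : (c 7 = 7 \/ (c 5 = 5 /\ c 3 = 0 /\ c 6 = 0 /\ c 7 = 0) \/
  (c 3 = 3 /\ c 5 = 0 /\ c 6 = 0 /\ c 7 = 0))%N by lia.
- exists 7%N => //; split => //.
  move=> l ld; case: (ltnP 7%N l) => [/big->//|]; case: l ld => [|[|[|[|[|[|[|[|l]]]]]]]] //;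
    rewrite ?c0 ?c1 //=; lia.
- exists 5%N => //; split; first by lia.
  move=> l ld; case: (ltnP 7%N l) => [/big->//|]; case: l ld => [|[|[|[|[|[|[|[|l]]]]]]]] //;
    rewrite ?c0 ?c1 //=; lia.
- exists 3%N => //; split; first by lia.
  move=> l ld; case: (ltnP 7%N l) => [/big->//|]; case: l ld => [|[|[|[|[|[|[|[|l]]]]]]]] //;
    rewrite ?c0 ?c1 //=; lia.
Qed.

(** The index of the stabiliser of [x] is divisible by [p], so the stabiliser contains no Sylow
    p-subgroup of [H]. *)
Lemma pelt_moves p H x : prime p -> p %| #|orbit 'P H x| ->
  exists2 g, g \in H & p.-elt g /\ g x != x.
Proof.
move=> p_pr p_orb; have [P sylP] := Sylow_exists p H.
have sPH := pHall_sub sylP.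
case: (boolP (P \subset 'C_H[x | 'P])) => [sPC | /subsetPn[g Pg nCg]].
  move: p_orb; rewrite card_orbit => p_idx.
  have sylC : p.-Sylow('C_H[x | 'P]) P by apply: pHall_subl sylP; rewrite ?subsetIl.
  have := card_orbit_stab 'P H x; rewrite card_orbit => oH.
  have : #|P| = (#|'C_H[x | 'P]| `_p)%N := card_Hall sylC.
  rewrite (card_Hall sylP) -oH partnM ?cardG_gt0 ?indexg_gt0 // => /eqP.
  rewrite -[X in _ == X]mul1n eqn_pmul2r ?part_gt0 // p_part.
  rewrite -[X in _ == X](expn0 p) eqn_exp2l ?prime_gt1 // eqn0Ngt.
  by rewrite logn_gt0 mem_primes p_pr indexg_gt0 p_idx.
have Hg := subsetP sPH g Pg; exists g => //; split.
  by apply: mem_p_elt (pHall_pgroup sylP) Pg.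
by apply: contra nCg => /eqP gx; apply/astab_permP.
Qed.

Lemma card_porbit_pelt p (g : {perm T}) x : p.-elt g -> p.-nat #|porbit g x|.
Proof.
move=> pg; apply: pnat_dvd (pg : p.-nat _); rewrite porbit.unlock.
have := card_orbit_stab 'P <[g]>%G x; rewrite /= -/(order g) => <-.
exact: dvdn_mulr.
Qed.

(** The action on [S] need not be faithful, so an element of order [p] could fix all of [S]. A
    p-element moving [x] cannot: its cycle through [x] has length a power of [p], above 1 and at
    most [p]. *)
Lemma pelt_labels p H S x : prime p -> [transitive H, on S | 'P] -> #|S| = p ->
    x \in S ->
  exists2 g, g \in H & [/\ uniq (traject g x p), traject g x p =i S & iter p g x = x].
Proof.
move=> p_pr trH cS Sx; have [|g Hg [pg gx]] := @pelt_moves p H x p_pr.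
  by rewrite (atransP trH) // cS.
have sub : porbit g x \subset S.
  apply/subsetP=> y /porbitP[i ->].
  by rewrite (transitive_act trH) // groupX.
have gt1 : 1 < #|porbit g x|.
  apply/card_gt1P; exists x, (g x); split=> //; first exact: porbit_id.
    exact: (mem_porbit g 1).
  by rewrite eq_sym.
have := card_porbit_pelt x pg; have := subset_leq_card sub; rewrite cS => le /p_natP[[|i] oi].
  by rewrite oi in gt1.
have op : #|porbit g x| = p.
  apply/eqP; rewrite eqn_leq le oi -{1}(expn1 p) leq_exp2l ?prime_gt1 //.
exists g => //; split; first by rewrite -{1}op uniq_traject_porbit.
  move=> y; rewrite -{1}op -porbit_traject.
  by apply/(subset_cardP _ sub); rewrite op cS.
by rewrite -{1}op iter_porbit.
Qed.

(** The cycle through [x] has length 2 ^ (i + 1); the power [g ^+ (2 ^ i)] exchanges [x] with the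
    opposite point of that cycle. *)
Lemma two_elt_swap (g : {perm T}) x : 2.-elt g -> g x != x ->
  exists2 h, h \in <[g]> & exists2 y, y \in porbit g x & [/\ y != x, h x = y & h y = x].
Proof.
move=> pg gx; have := card_porbit_pelt x pg => /p_natP[[|i] oi].
  have gt1 : 1 < #|porbit g x|.
    apply/card_gt1P; exists x, (g x); split=> //; first exact: porbit_id.
      exact: (mem_porbit g 1).
    by rewrite eq_sym.
  by rewrite oi in gt1.
exists (g ^+ (2 ^ i)); first by rewrite mem_cycle.
exists ((g ^+ (2 ^ i)) x); first exact: mem_porbit.
split=> //; last first.
  rewrite -permM -expgD addnn -mul2n -expnS -oi.
  by have := iter_porbit g x; rewrite permX.
have := uniq_traject_porbit g x; rewrite oi.
have lt_i : 2 ^ i < 2 ^ i.+1 by rewrite ltn_exp2l.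
have gt0 : 0 < 2 ^ i.+1 by rewrite expn_gt0.
move=> uniq_t; apply/eqP=> /esym eqx.
have := nth_uniq x (s := traject g x (2 ^ i.+1)) (i := 0) (j := 2 ^ i).
rewrite !size_traject !nth_traject // => /(_ gt0 lt_i uniq_t).
rewrite /= -permX -eqx eqxx => /esym/eqP e0.
have : 0 < 2 ^ i by rewrite expn_gt0.
by rewrite -e0.
Qed.

End SmallPrimitive.

(** * Local 2-transitivity *)

Section LocalTransitivity.
Variables (T : finType) (e : rel T).
Implicit Types (u v w x y z a b c d : T) (g h : {perm T}).

Notation N := (nbhd e).
Notation N2 := (nbhd2 e).
Notation Stab u := ('C_(Aut e)[u | 'P])%G.

Definition loc2 u := forall a b c d, a \in N u -> b \in N u -> c \in N u ->
  d \in N u -> a != b -> c != d -> exists2 g, g \in Aut e & [/\ g u = u, g a = c & g b = d].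

Lemma inN u v : (v \in N u) = e u v. Proof. by rewrite inE. Qed.

Lemma aut_edgeP g : reflect (forall x y, e (g x) (g y) = e x y) (g \in Aut e).
Proof.
rewrite inE; apply: (iffP forallP) => gP x.
  by move=> y; apply/eqP/(forallP (gP x)).
by apply/forallP => y; rewrite gP.
Qed.

Lemma aut_edge g x y : g \in Aut e -> e (g x) (g y) = e x y.
Proof. by move/aut_edgeP. Qed.

(** An injection of the finite edge set into itself is onto, so preserving edges is enough. *)
Lemma aut_of_homo g : (forall x y, e x y -> e (g x) (g y)) -> g \in Aut e.
Proof.
move=> homo_g; apply/aut_edgeP => x y; apply/idP/idP; last exact: homo_g.
pose E := [set p : T * T | e p.1 p.2]; pose f (p : T * T) := (g p.1, g p.2).
have inj_f : injective f by move=> [a b] [c d] [/perm_inj-> /perm_inj->].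
have defE : f @: E = E.
  apply/eqP; rewrite eqEcard card_imset // leqnn andbT.
  by apply/subsetP=> _ /imsetP[p + ->]; rewrite !inE; apply: homo_g.
move=> exy; have : f (x, y) \in f @: E by rewrite defE inE.
by rewrite mem_imset // inE.
Qed.

Lemma aut_nbhd g u v : g \in Aut e -> (g v \in N (g u)) = (v \in N u).
Proof. by move=> Gg; rewrite !inN aut_edge. Qed.

Lemma inN2 u w : reflect [/\ w != u, ~~ e u w & exists v, e u v && e v w] (w \in N2 u).
Proof. by rewrite inE; apply: (iffP and3P) => -[? ? /existsP]. Qed.

Lemma aut_nbhd2 g u w : g \in Aut e -> (g w \in N2 (g u)) = (w \in N2 u).
Proof.
move=> Gg; apply/inN2/inN2; rewrite (inj_eq perm_inj) aut_edge // => -[? ? [v]].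
  by move=> ev; split=> //; exists (g^-1 v); rewrite -(aut_edge u _ Gg) -(aut_edge _ w Gg) permKV.
by move=> ev; split=> //; exists (g v); rewrite !aut_edge.
Qed.

Lemma stabP g u : reflect (g \in Aut e /\ g u = u) (g \in Stab u).
Proof. exact: astab_permP. Qed.

Hypotheses (sym_e : symmetric e) (conn_e : connected_graph e).

Lemma conn_ind (P : T -> Prop) x :
  P x -> (forall y z, P y -> e y z -> P z) -> forall y, P y.
Proof.
move=> Px IH y; have /connectP[p] := conn_e x y.
elim: p x Px => [|z p IHp] x Px /=; first by move=> _ ->.
by case/andP=> exz; apply: IHp; apply: IH exz.
Qed.

Variable k : nat.
Hypothesis reg_e : regular_of_valency e k.
Hypothesis tdt_e : two_distance_transitive e.

Lemma aut_vt x y : exists2 g, g \in Aut e & g x = y.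
Proof.
have [_ vt _] := tdt_e.
by have [||g Gg ->] := atransP2 vt (x := x) (y := y); rewrite ?inE //; exists g.
Qed.

Lemma aut_nbr_trans u : [transitive Stab u, on N u | 'P].
Proof. by have [_ _ /(_ u)[]] := tdt_e. Qed.

Lemma aut_nbr u a b : a \in N u -> b \in N u ->
  exists2 g, g \in Aut e & g u = u /\ g a = b.
Proof.
move=> Na Nb; have [g /stabP[Gg gu] ->] := atransP2 (aut_nbr_trans u) Na Nb.
by exists g.
Qed.

Lemma aut_N2 u w w' : w \in N2 u -> w' \in N2 u ->
  exists2 g, g \in Aut e & g u = u /\ g w = w'.
Proof.
have [_ _ /(_ u)[_ trN2]] := tdt_e.
by move=> Nw Nw'; have [g /stabP[Gg gu] ->] := atransP2 trN2 Nw Nw'; exists g.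
Qed.

Lemma not_complete : ~ (forall x y, x != y -> e x y).
Proof. by have [[x [y [/[swap] /negP nxy xy]]] _ _ all] := tdt_e; apply: nxy (all x y xy). Qed.

Lemma aut_arc u v x y : e u v -> e x y ->
  exists2 g, g \in Aut e & g u = x /\ g v = y.
Proof.
move=> uv xy; have [g Gg gu] := aut_vt u x.
have gv : g v \in N x by rewrite -gu aut_nbhd // inN.
have [|h Gh [hx hgv]] := aut_nbr gv (b := y); first by rewrite inN.
by exists (g * h); rewrite ?groupM // !permM gu hx hgv.
Qed.

Lemma loc2_two_arc u : loc2 u -> two_arc_transitive e.
Proof.
move=> l2; split; first by have [] := tdt_e.
move=> a b c a' b' c' /and3P[ab bc ac] /and3P[ab' bc' ac'].
have [g Gg gb] := aut_vt b u; have [h Gh hu] := aut_vt u b'.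
have Nu x : e b x -> g x \in N u by rewrite -gb aut_nbhd // inN.
have Nu' x : e b' x -> h^-1 x \in N u.
  by move=> bx; rewrite -(permK h u) hu aut_nbhd ?groupV // inN.
rewrite sym_e in ab; rewrite sym_e in ab'.
have [||f Gf [fu fa fc]] := l2 _ _ _ _ (Nu _ ab) (Nu _ bc) (Nu' _ ab') (Nu' _ bc').
- by rewrite (inj_eq perm_inj).
- by rewrite (inj_eq perm_inj).
exists (g * f * h); first by rewrite !groupM.
by rewrite !permM gb fu fa fc !permKV.
Qed.

Lemma loc2_aut g u : g \in Aut e -> loc2 u -> loc2 (g u).
Proof.
move=> Gg l2 a b c d; rewrite -(permKV g a) -(permKV g b) -(permKV g c) -(permKV g d).
rewrite !aut_nbhd // !(inj_eq (@perm_inj _ g)) => Na Nb Nc Nd ab cd.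
have [h Gh [hu ha hb]] := l2 _ _ _ _ Na Nb Nc Nd ab cd.
exists (g^-1 * h * g); first by rewrite !groupM ?groupV.
by rewrite !permM !permK hu ha hb.
Qed.

Lemma sublen_loc2 u a : a \in N u ->
    {in N u, forall b, b != a -> sublen (Stab u) a b = #|N u|.-1} -> loc2 u.
Proof.
move=> Na lens b c b' c' Nb Nc Nb' Nc' bc bc'.
have [g Gg [gu gb]] := aut_nbr Nb Na; have [h Gh [hu hb']] := aut_nbr Na Nb'.
have full := sublen_full (aut_nbr_trans u) Na lens.
have [||||f] := full (g c) (h^-1 c').
- by rewrite -gu aut_nbhd.
- by rewrite -(permK h u) hu aut_nbhd ?groupV.
- by rewrite -gb (inj_eq perm_inj) eq_sym.
- by rewrite -(permK h a) hb' (inj_eq perm_inj) eq_sym.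
move=> /stabP[Gf fu] [fa fc]; exists (g * f * h); first by rewrite !groupM.
by rewrite !permM gu fu hu gb fa fc permKV.
Qed.

Lemma loc2_small u : k <= 2 -> loc2 u.
Proof.
move=> k2 a b c d Na Nb Nc Nd ab cd.
have [g Gg [gu ga]] := aut_nbr Na Nc; exists g => //; split=> //.
apply/eqP/contraT => gbd; have : 2 < #|N u|.
  apply/card_gt2P; exists c, d, (g b); split.
    by split=> //; rewrite -gu aut_nbhd.
  by rewrite cd eq_sym gbd -ga (inj_eq perm_inj) eq_sym.
by rewrite reg_e ltnNge k2.
Qed.

(** Transitivity on unordered pairs leaves only the order of a pair to be corrected, and conjugates
    of the one swap [g] do that at every pair. *)
Lemma swap_loc2 u a b g :
    (forall a b c d, a \in N u -> b \in N u -> c \in N u -> d \in N u -> a != b -> c != d ->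
      exists2 g, g \in Aut e & g u = u /\ (g a = c /\ g b = d \/ g a = d /\ g b = c)) ->
    g \in Aut e -> g u = u -> a \in N u -> a != b -> g a = b -> g b = a ->
  loc2 u.
Proof.
move=> homog Gg gu Na ab ga gb x y z t Nx Ny Nz Nt xy zt.
have Nb : b \in N u by rewrite -ga -gu aut_nbhd.
have [f Gf [fu [[fx fy]|[fx fy]]]] := homog x y z t Nx Ny Nz Nt xy zt.
  by exists f.
have [h Gh [hu hab]] := homog z t a b Nz Nt Na Nb zt ab.
exists (f * (h * g * h^-1)); first by rewrite !groupM ?groupV.
rewrite !permM fu fx fy hu gu.
by case: hab => -[hz ht]; rewrite hz ht ga gb -?hz -?ht !permK -{1}hu permK.
Qed.

Hypothesis lp_e : locally_primitive e.

Lemma loc2_468 u : k \in [:: 4; 6; 8] -> loc2 u.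
Proof.
move=> k468; have /set0Pn[a Na] : N u != set0.
  by rewrite -card_gt0 reg_e; move: k468; rewrite !inE => /or3P[]/eqP->.
apply: (sublen_loc2 Na); apply: (prim_deg468 (lp_e u)) => //.
by rewrite reg_e.
Qed.

End LocalTransitivity.

(** * Graphs with triangles *)

Lemma double_count (T T' : finType) (A : {set T}) (B : {set T'}) (r : T -> T' -> bool) m n :
    (forall x, x \in A -> #|[set y in B | r x y]| = m) ->
    (forall y, y \in B -> #|[set x in A | r x y]| = n) ->
  (#|A| * m = #|B| * n)%N.
Proof.
move=> rA rB; rewrite -!sum_nat_const -(eq_bigr _ rA) -(eq_bigr _ rB).
under eq_bigr do rewrite -sum1dep_card big_mkcondr.
under [RHS]eq_bigr do rewrite -sum1dep_card big_mkcondr.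
by rewrite exchange_big.
Qed.

Lemma handshake (T : finType) (e : rel T) (A : {set T}) d :
    symmetric e -> irreflexive e ->
    (forall x, x \in A -> #|[set y in A | e x y]| = d) -> ~~ odd (#|A| * d).
Proof.
move=> sym_e irr_e deg.
pose E := [set p : T * T | [&& p.1 \in A, p.2 \in A & e p.1 p.2]].
pose L := [set p in E | enum_rank p.1 < enum_rank p.2].
pose sw (p : T * T) := (p.2, p.1).
have swK : involutive sw by case.
have -> : (#|A| * d = #|E|)%N.
  rewrite -sum_nat_const -(eq_bigr _ deg) -sum1dep_card.
  rewrite (eq_bigl (fun p : T * T => (p.1 \in A) && ((p.2 \in A) && e p.1 p.2))) //.
  rewrite -(pair_big_dep (mem A) (fun x y => (y \in A) && e x y) (fun _ _ => 1%N)) /=.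
  by apply: eq_bigr => x _; rewrite -sum1dep_card.
rewrite -(cardsID L E); have -> : E :&: L = L by apply/setIidPr/subsetP=> p; rewrite inE => /andP[].
have -> : E :\: L = sw @: L.
  apply/setP=> -[x y]; rewrite -[(x, y)]swK mem_imset /sw /=; last exact: can_inj swK.
  rewrite !inE /= [e y x]sym_e; case: (boolP (x \in A)) => //= Ax; last by rewrite !andbF.
  case: (boolP (y \in A)) => //= Ay; case: (boolP (e x y)) => exy; rewrite ?andbF //= andbT.
  rewrite -leqNgt leq_eqVlt; case: eqVneq => // /val_inj/enum_rank_inj eq_yx.
  by rewrite eq_yx irr_e in exy.
by rewrite card_imset ?addnn ?odd_double //; apply: can_inj swK.
Qed.

(** * Labelling a neighbourhood of prime size by Z/k *)

Section Circulants.
Variables (T : finType) (e : rel T).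
Implicit Types (u v w x y z a b c d : T) (g h : {perm T}).
Notation N := (nbhd e).
Notation N2 := (nbhd2 e).
Hypotheses (sym_e : symmetric e) (irr_e : irreflexive e).
Variable k : nat.
Hypothesis reg_e : regular_of_valency e k.
Hypothesis tdt_e : two_distance_transitive e.

Lemma aut_cap g u v : g \in Aut e -> #|N (g u) :&: N (g v)| = #|N u :&: N v|.
Proof.
move=> Gg; rewrite -(card_imset (mem (N u :&: N v)) (@perm_inj _ g)).
apply: eq_card => x; apply/idP/imsetP=> [|[y + ->]]; last by rewrite !inE !aut_edge.
move=> /= Nx; exists (g^-1 x); last by rewrite permKV.
by move: Nx; rewrite -{1}(permKV g x) !inE !aut_edge.
Qed.

Lemma card_common_nbr u v x y : e u v -> e x y -> #|N u :&: N v| = #|N x :&: N y|.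
Proof. by move=> uv xy; have [g Gg [<- <-]] := aut_arc tdt_e uv xy; rewrite aut_cap. Qed.

Lemma aut_dist2 u w x y : w \in N2 u -> y \in N2 x ->
  exists2 g, g \in Aut e & g u = x /\ g w = y.
Proof.
move=> uw xy; have [g Gg gu] := aut_vt tdt_e u x.
have [|h Gh [hx hw]] := aut_N2 tdt_e (u := x) (w := g w) _ xy; first by rewrite -gu aut_nbhd2.
by exists (g * h); rewrite ?groupM // !permM gu hx hw.
Qed.

Lemma card_common_dist2 u w x y : w \in N2 u -> y \in N2 x ->
  #|N u :&: N w| = #|N x :&: N y|.
Proof. by move=> uw xy; have [g Gg [<- <-]] := aut_dist2 uw xy; rewrite aut_cap. Qed.

Lemma N2C u w : (w \in N2 u) = (u \in N2 w).
Proof.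
suff N2C' x y : x \in N2 y -> y \in N2 x by apply/idP/idP; apply: N2C'.
move=> /inN2[xy nyx [v /andP[yv vx]]]; apply/inN2; rewrite eq_sym sym_e.
by split=> //; exists v; rewrite sym_e vx sym_e.
Qed.

Lemma labels u : prime k -> exists2 g, g \in Aut e & exists s,
  [/\ g u = u, size s = k, uniq s, s =i N u &
      forall i, i < k -> g (nth u s i) = nth u s (i.+1 %% k)].
Proof.
move=> k_pr; have /set0Pn[x Nx] : N u != set0 by rewrite -card_gt0 reg_e prime_gt0.
have [g /stabP[Gg gu] [Us sN gk]] := pelt_labels k_pr (aut_nbr_trans tdt_e u) (reg_e u) Nx.
exists g => //; exists (traject g x k); split=> //; first exact: size_traject.
move=> i ltik; rewrite (set_nth_default x) ?size_traject // nth_traject //.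
have [lt|] := ltnP i.+1 k.
  by rewrite modn_small // (set_nth_default x) ?size_traject // nth_traject.
move=> lek; have -> : i.+1 = k by apply/eqP; rewrite eqn_leq ltik.
have k0 := prime_gt0 k_pr.
rewrite modnn (set_nth_default x) ?size_traject // nth_traject //= -iterS.
by have -> : i.+1 = k by apply/eqP; rewrite eqn_leq ltik.
Qed.

(** A relation invariant under the shift depends only on the difference of labels;
    [(j + (k - i)) %% k] is j - i in Z/k, with the truncated subtraction kept harmless by i < k. *)
Lemma label_shift (R : rel T) g u s : 0 < k ->
    (forall i, i < k -> g (nth u s i) = nth u s (i.+1 %% k)) ->
    (forall x y, R (g x) (g y) = R x y) ->
  forall i j, i < k -> j < k ->
    R (nth u s i) (nth u s j) = R (nth u s 0) (nth u s ((j + (k - i)) %% k)).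
Proof.
move=> k0 gs Rg; elim=> [|i IH] j lti ltj; first by rewrite subn0 modnDr modn_small.
have -> : nth u s i.+1 = g (nth u s i) by rewrite gs ?modn_small // ltnW.
have -> : nth u s j = g (nth u s ((j + k.-1) %% k)).
  rewrite gs ?ltn_mod // -addn1 modnDml -addnA addn1 prednK // modnDr.
  by rewrite modn_small.
rewrite Rg IH ?ltn_mod ?(ltnW lti) // modnDml; congr (R _ (nth u s _)).
have -> : (j + k.-1 + (k - i) = j + (k - i.+1) + k)%N by lia.
by rewrite modnDr.
Qed.

Definition circulant u s (Q : pred nat) :=
  [/\ size s = k, uniq s, s =i N u &
      forall i j, i < k -> j < k -> e (nth u s i) (nth u s j) = Q ((j + (k - i)) %% k)].

Lemma circulant_label u : prime k -> exists s Q,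
  [/\ circulant u s Q, Q 0 = false & forall i, i < k -> Q i = Q ((k - i) %% k)].
Proof.
move=> k_pr; have [g Gg [s [gu size_s Us sN gs]]] := labels u k_pr.
have k0 := prime_gt0 k_pr.
pose Q i := e (nth u s 0) (nth u s i); exists s, Q.
have sh := label_shift k0 gs (fun x y => aut_edge x y Gg).
split=> //; first by rewrite /Q irr_e.
by move=> i lti; rewrite {1}/Q sym_e sh.
Qed.

End Circulants.

Lemma card_setI_count (T : finType) (s : seq T) (A : {set T}) (P : pred T) :
  uniq s -> s =i A -> #|[set x in A | P x]| = count P s.
Proof.
move=> Us sA; rewrite -size_filter -(card_uniqP (filter_uniq _ Us)).
by apply: eq_card => x; rewrite !inE mem_filter sA andbC.
Qed.

(** * Connection sets in valencies 3, 5 and 7 *)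

Section Triangles.
Variables (T : finType) (e : rel T).
Implicit Types (u v w x y z a b c d : T) (g h : {perm T}).
Notation N := (nbhd e).
Hypotheses (sym_e : symmetric e) (irr_e : irreflexive e) (conn_e : connected_graph e).
Variable k : nat.
Hypothesis reg_e : regular_of_valency e k.
Hypothesis tdt_e : two_distance_transitive e.

Lemma circulant_count u s Q x y : prime k -> circulant e k u s Q -> e x y ->
  #|N x :&: N y| = count Q (iota 0 k).
Proof.
move=> /prime_gt0 k0 [size_s Us sN sQ] xy.
have us0 : e u (nth u s 0) by rewrite -inN -sN mem_nth // size_s.
rewrite (card_common_nbr tdt_e xy us0).
have -> : N u :&: N (nth u s 0) = [set z in N u | e (nth u s 0) z].
  by apply/setP=> z; rewrite !inE.
rewrite (card_setI_count _ Us sN) -[X in count _ X](mkseq_nth u s) size_s count_map.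
apply: eq_in_count => i; rewrite mem_iota /= => lti.
by rewrite sQ // subn0 modnDr modn_small.
Qed.

Lemma common_nbr_sub u v : N u :&: N v \subset N u :\ v.
Proof.
apply/subsetP=> x; rewrite !inE => /andP[-> vx]; rewrite andbT.
by apply: contraL vx => /eqP->; rewrite irr_e.
Qed.

(** With k - 1 common neighbours on each edge every neighbourhood is a clique, adjacency or equality
    is transitive, and a connected graph is complete, against diameter at least 2. *)
Lemma not_full u v : e u v -> #|N u :&: N v| <> k.-1.
Proof.
move=> uv eqk; apply: (not_complete tdt_e) => x.
have full t y z : e t y -> e t z -> y != z -> e y z.
  move=> ty tz yz; have /setP/(_ z) : N t :&: N y = N t :\ y.
    apply/eqP; rewrite eqEcard common_nbr_sub (card_common_nbr tdt_e ty uv) eqk.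
    by rewrite -(reg_e t) (cardsD1 y (N t)) inN ty add1n leqnn.
  by rewrite !inE tz eq_sym yz /= => ->.
suff all y : (x == y) || e x y by move=> y /negPf xy; have := all y; rewrite xy.
move: y; apply: (conn_ind conn_e (x := x)) => [|y z]; first by rewrite eqxx.
case/orP=> [/eqP->->|xy yz]; first by rewrite orbT.
by case: eqVneq => //= xz; apply: (full y); rewrite // sym_e.
Qed.

(** The connection set is closed under negation, so it is empty or {1, 2}, and the latter is
    excluded by [not_full]. *)
Lemma no_triangle3 u v : k = 3%N -> e u v -> #|N u :&: N v| = 0%N.
Proof.
move=> k3 uv; have k_pr : prime k by rewrite k3.
have [s [Q [circ Q0 QN]]] := circulant_label sym_e irr_e reg_e tdt_e u k_pr.
have := not_full uv; have := circulant_count k_pr circ uv.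
rewrite k3 in QN *; rewrite /= Q0 (QN 1%N) //=.
by case: (Q 2) => //= ->.
Qed.

Lemma circulant5 u v x : k = 5%N -> e u v -> 0 < #|N u :&: N v| ->
  exists s, exists2 D, D \in [:: [:: 1; 4]; [:: 2; 3]]%N &
    circulant e k x s (mem D).
Proof.
move=> k5 uv lam; have k_pr : prime k by rewrite k5.
have [s [Q [circ Q0 QN]]] := circulant_label sym_e irr_e reg_e tdt_e x k_pr.
have := not_full uv; move: lam; rewrite (circulant_count k_pr circ uv).
have [size_s Us sN sQ] := circ.
rewrite k5 in QN *; rewrite /= Q0 (QN 1%N) // (QN 2%N) //=.
case Q3: (Q 3); case Q4: (Q 4) => //= _ _.
  exists s, [:: 2; 3]%N => //; split; rewrite // -?k5 // => i j lti ltj; rewrite sQ //.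
  have : (j + (k - i)) %% k < 5 by rewrite k5 ltn_mod.
  by rewrite k5; case: (_ %% _) => [|[|[|[|[|m]]]]] //= _; rewrite ?Q0 ?(QN 1%N) ?(QN 2%N) ?Q3 ?Q4.
exists s, [:: 1; 4]%N => //; split; rewrite // -?k5 // => i j lti ltj; rewrite sQ //.
have : (j + (k - i)) %% k < 5 by rewrite k5 ltn_mod.
by rewrite k5; case: (_ %% _) => [|[|[|[|[|m]]]]] //= _; rewrite ?Q0 ?(QN 1%N) ?(QN 2%N) ?Q3 ?Q4.
Qed.

(** The connection sets of the three 7-cycles on Z/7. A symmetric connection set of size 2 is one of
    these, and one of size 4 is the complement of one in the nonzero residues. *)
Definition D7 := [:: [:: 1; 6]; [:: 2; 5]; [:: 3; 4]]%N.

Lemma circulant7 u v x : k = 7%N -> e u v -> 0 < #|N u :&: N v| ->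
  exists s, exists2 D, D \in D7 &
    #|N u :&: N v| = 2 /\ circulant e k x s (mem D) \/
    #|N u :&: N v| = 4 /\ circulant e k x s (fun i => (i != 0) && (i \notin D)).
Proof.
move=> k7 uv lam; have k_pr : prime k by rewrite k7.
have [s [Q [circ Q0 QN]]] := circulant_label sym_e irr_e reg_e tdt_e x k_pr.
have := not_full uv; move: lam; rewrite (circulant_count k_pr circ uv).
have [size_s Us sN sQ] := circ.
rewrite k7 in QN *; rewrite /= Q0 (QN 1%N) // (QN 2%N) // (QN 3%N) //=.
have fin (Q' : pred nat) : all (fun i => Q i == Q' i) (iota 0 7) -> circulant e 7 x s Q'.
  move=> /allP QQ'; split; rewrite // -?k7 // => i j lti ltj; rewrite sQ //.
  by apply/eqP/QQ'; rewrite mem_iota k7 ltn_mod.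
case Q4: (Q 4); case Q5: (Q 5); case Q6: (Q 6) => //= _ _.
- by exists s, [:: 1; 6]%N => //; right; split=> //;
  apply: fin; rewrite /= Q0 (QN 1%N) // (QN 2%N) // (QN 3%N) //= Q4 Q5 Q6.
- by exists s, [:: 2; 5]%N => //; right; split=> //;
  apply: fin; rewrite /= Q0 (QN 1%N) // (QN 2%N) // (QN 3%N) //= Q4 Q5 Q6.
- by exists s, [:: 3; 4]%N => //; left; split=> //;
  apply: fin; rewrite /= Q0 (QN 1%N) // (QN 2%N) // (QN 3%N) //= Q4 Q5 Q6.
- by exists s, [:: 3; 4]%N => //; right; split=> //;
  apply: fin; rewrite /= Q0 (QN 1%N) // (QN 2%N) // (QN 3%N) //= Q4 Q5 Q6.
- by exists s, [:: 2; 5]%N => //; left; split=> //;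
  apply: fin; rewrite /= Q0 (QN 1%N) // (QN 2%N) // (QN 3%N) //= Q4 Q5 Q6.
- by exists s, [:: 1; 6]%N => //; left; split=> //;
  apply: fin; rewrite /= Q0 (QN 1%N) // (QN 2%N) // (QN 3%N) //= Q4 Q5 Q6.
Qed.

End Triangles.

Definition adj7 (D : seq nat) i j := (j + (7 - i)) %% 7 \in D.

Lemma heptagon_compl_common : all (fun D => all (fun i => all (fun j =>
    (i != j) && adj7 D i j ==>
    (3 <= count (fun l => ((l + (7 - i)) %% 7 != 0) && ((l + (7 - i)) %% 7 \notin D) &&
         (((l + (7 - j)) %% 7 != 0) && ((l + (7 - j)) %% 7 \notin D))) (iota 0 7)))
  (iota 0 7)) (iota 0 7)) D7.
Proof. by vm_compute. Qed.

Lemma heptagon_no_triangle : all (fun D => all (fun i => all (fun j => all (fun l =>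
    ~~ [&& adj7 D i j, adj7 D i l & adj7 D j l]) (iota 0 7)) (iota 0 7)) (iota 0 7)) D7.
Proof. by vm_compute. Qed.

(** * Valency 7 with four common neighbours on each edge *)

Section Lambda7.
Variables (T : finType) (e : rel T).
Implicit Types (u v w x y z a b c d : T) (g h : {perm T}).
Notation N := (nbhd e).
Notation N2 := (nbhd2 e).
Hypotheses (sym_e : symmetric e) (irr_e : irreflexive e) (conn_e : connected_graph e).
Variable k : nat.
Hypothesis reg_e : regular_of_valency e k.
Hypothesis tdt_e : two_distance_transitive e.

Lemma card_N2_nbr u v : e u v -> #|[set w in N2 u | e v w]| = (k - #|N u :&: N v|).-1.
Proof.
move=> uv; have -> : [set w in N2 u | e v w] = (N v :\: N u) :\ u.
  apply/setP=> w; rewrite [LHS]inE [RHS]inE in_set1 in_setD !inN.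
  case: (boolP (e v w)) => vw; rewrite ?andbF ?andbT //.
  apply/inN2/andP=> [[]|[wu nuw]] //; split=> //.
  by exists v; rewrite uv.
have vu : u \in N v :\: N u by rewrite !inE irr_e sym_e.
by have := cardsD1 u (N v :\: N u); rewrite vu cardsD reg_e setIC => ->.
Qed.

Lemma circulant_adj x s Q y z : circulant e k x s Q -> e x y -> e x z ->
  exists i j, [/\ i < k, j < k, y = nth x s i, z = nth x s j &
    e y z = Q ((j + (k - i)) %% k) /\ e z y = Q ((i + (k - j)) %% k)].
Proof.
case=> size_s Us sN sQ; rewrite -(inN e x y) -(inN e x z) -!sN => sy sz.
have iy : index y s < k by rewrite -size_s index_mem.
have iz : index z s < k by rewrite -size_s index_mem.
exists (index y s), (index z s); rewrite !nth_index //; split=> //.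
by have := sQ _ _ iy iz; have := sQ _ _ iz iy; rewrite !nth_index.
Qed.

Lemma circulant_card x s Q (P : pred T) (p : pred nat) : circulant e k x s Q ->
  (forall i, i < k -> P (nth x s i) = p i) -> #|[set y in N x | P y]| = count p (iota 0 k).
Proof.
case=> size_s Us sN sQ Pp; rewrite (card_setI_count _ Us sN).
rewrite -[X in count _ X](mkseq_nth x s) size_s count_map.
by apply: eq_in_count => i; rewrite mem_iota; apply: Pp.
Qed.

(** Each neighbourhood is the complement of a heptagon. Two vertices at distance 2 have a common
    neighbour v0 and three more inside the neighbourhood of v0, so mu >= 4. Counting edges from
    [N u] to [N2 u] gives 7 * 2 = |N2 u| * mu, whence mu = 7 and every vertex of [N2 u] has the same
    neighbours as [u]. Then [u] and the two neighbours of [v] in [N2 u] are pairwise nonadjacent: a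
    triangle in the heptagon. *)
Lemma lambda7_neq4 u v : k = 7%N -> e u v -> #|N u :&: N v| <> 4%N.
Proof.
move=> k7 uv lam.
have circ x : exists s, exists2 D, D \in D7 &
    circulant e k x s (fun i => (i != 0) && (i \notin D)).
  have [|s [D DD [[]|[_]]]] := circulant7 sym_e irr_e conn_e reg_e tdt_e x k7 uv; rewrite ?lam //.
  by exists s, D.
have nonadj v0 x y : e v0 x -> e v0 y -> x != y -> ~~ e x y ->
    forall s D, circulant e k v0 s (fun i => (i != 0) && (i \notin D)) ->
    exists i j, [/\ i < 7, j < 7, i != j, x = nth v0 s i & y = nth v0 s j /\ adj7 D i j].
  move=> vx vy xy nxy s D ci; have [i [j [lti ltj dx dy [Qxy _]]]] := circulant_adj ci vx vy.
  exists i, j; rewrite -k7; split=> //; first by apply: contraNneq xy => ij; rewrite dx dy ij.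
  split=> //; move: nxy; rewrite Qxy k7 negb_and !negbK => /orP[] //.
  move=> /eqP eq0; case/negP: xy; rewrite dx dy.
  have -> // : i = j; move: eq0; rewrite k7 in lti ltj.
  by move: i j lti ltj {dx dy Qxy} => [|[|[|[|[|[|[|i]]]]]]] [|[|[|[|[|[|[|j]]]]]]].
have mu4 w x : w \in N2 x -> 4 <= #|N x :&: N w|.
  move=> /inN2[wx nxw [v0 /andP[xv vw]]]; rewrite sym_e in xv.
  have [s [D DD ci]] := circ v0.
  have [|i [j [lti ltj ij dx [dw Dij]]]] := nonadj _ _ _ xv vw _ nxw _ _ ci; first by rewrite eq_sym.
  rewrite (cardsD1 v0) !inE sym_e xv sym_e vw ltnS.
  have sub : [set y in N v0 | e x y && e w y] \subset (N x :&: N w) :\ v0.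
    apply/subsetP=> y; rewrite !inE => /andP[vy ->]; rewrite andbT.
    by apply: contraL vy => /eqP->; rewrite irr_e.
  apply: leq_trans (subset_leq_card sub).
  have [_ _ _ sQ] := ci.
  rewrite (circulant_card (p := fun l => ((l + (7 - i)) %% 7 != 0) && ((l + (7 - i)) %% 7 \notin D) &&
         (((l + (7 - j)) %% 7 != 0) && ((l + (7 - j)) %% 7 \notin D))) ci); last first.
    by move=> l ltl; rewrite dx dw !sQ ?k7 // -k7.
  have /allP/(_ _ DD)/allP/(_ i) := heptagon_compl_common; rewrite mem_iota => /(_ lti).
  by move=> /allP/(_ j); rewrite mem_iota => /(_ ltj); rewrite ij Dij k7.
have N2v w : e u w -> #|[set x in N2 u | e w x]| = 2.
  by move=> uw; rewrite card_N2_nbr // (card_common_nbr tdt_e uw uv) lam k7.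
have /card_gt1P[w [w' [Nw Nw' ww']]] : 1 < #|[set x in N2 u | e v x]| by rewrite N2v.
case/setIdP: Nw => Nw vw; case/setIdP: Nw' => Nw' vw'.
have cnt : (#|N u| * 2 = #|N2 u| * #|N u :&: N w|)%N.
  apply: (double_count (r := e)) => [x|y Ny]; first by rewrite inN; apply: N2v.
  rewrite (card_common_dist2 tdt_e Nw Ny); apply: eq_card => x.
  by rewrite !inE (sym_e y).
rewrite reg_e k7 in cnt.
have le7 : #|N u :&: N w| <= 7 by rewrite -k7 -(reg_e u) subset_leq_card ?subsetIl.
have ge4 := mu4 _ _ Nw.
have eq7 : #|N u :&: N w| = 7%N.
  move: cnt le7 ge4; move: #|_ :&: _| => m cnt.
  by case: m cnt => [|[|[|[|[|[|[|[|m]]]]]]]] // cnt _ _; lia.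
have twin x : x \in N2 u -> N x = N u.
  move=> Nx; have := card_common_dist2 tdt_e Nw Nx; rewrite eq7 => c7.
  have /setIidPl : N u \subset N x.
    by apply/setIidPl/eqP; rewrite eqEcard subsetIl -c7 reg_e k7.
  move/eqP; rewrite eqEsubset => /andP[_ /subsetIP[_ sub]].
  by apply/eqP; rewrite eq_sym eqEcard sub !reg_e leqnn.
have nww' : ~~ e w w'.
  by rewrite -inN (twin w) // inN; case/inN2: Nw'.
have [s [D DD ci]] := circ v.
have vu : e v u by rewrite sym_e.
have uw : u != w by rewrite eq_sym; case/inN2: Nw.
have uw' : u != w' by rewrite eq_sym; case/inN2: Nw'.
have nuw : ~~ e u w by case/inN2: Nw.
have nuw' : ~~ e u w' by case/inN2: Nw'.
have [size_s Us sN _] := ci.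
have idx x : e v x -> exists2 i, i < 7 & x = nth v s i.
  rewrite -inN -sN => sx; exists (index x s); last by rewrite nth_index.
  by rewrite -k7 -size_s index_mem.
have inj i j : i < 7 -> j < 7 -> nth v s i = nth v s j -> i = j.
  by move=> lti ltj /eqP; rewrite nth_uniq ?size_s ?k7 // => /eqP.
have [i [j [lti ltj _ du [dw Dij]]]] := nonadj _ _ _ vu vw uw nuw _ _ ci.
have [i1 [l [lti1 ltl _ du1 [dw' Dil]]]] := nonadj _ _ _ vu vw' uw' nuw' _ _ ci.
have [j1 [l1 [ltj1 ltl1 _ dw1 [dw1' Djl]]]] := nonadj _ _ _ vw vw' ww' nww' _ _ ci.
move: (inj _ _ lti lti1) (inj _ _ ltj ltj1) (inj _ _ ltl ltl1).
rewrite -du -dw -dw' => /(_ du1) ? /(_ dw1) ? /(_ dw1') ?; subst i1 j1 l1.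
have /allP/(_ _ DD)/allP/(_ i) := heptagon_no_triangle; rewrite mem_iota => /(_ lti).
move=> /allP/(_ j); rewrite mem_iota => /(_ ltj) /allP/(_ l); rewrite mem_iota => /(_ ltl).
by rewrite Dij Dil Djl.
Qed.

End Lambda7.

Lemma heptagon_common_le1 : all (fun D => all (fun i => all (fun j =>
    (i != j) && ~~ adj7 D i j ==>
    (count (fun l => adj7 D i l && adj7 D j l) (iota 0 7) <= 1))
  (iota 0 7)) (iota 0 7)) D7.
Proof. by vm_compute. Qed.

Lemma heptagon_dist2 : all (fun D => all (fun i =>
    count (fun j => [&& j != i, ~~ adj7 D i j &
      0 < count (fun l => adj7 D i l && adj7 D j l) (iota 0 7)]) (iota 0 7) == 2%N)
  (iota 0 7)) D7.
Proof. by vm_compute. Qed.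

(** * Valency 7 with two common neighbours on each edge *)

Section Lambda7Two.
Variables (T : finType) (e : rel T).
Implicit Types (u v w x y z a b c d : T) (g h : {perm T}).
Notation N := (nbhd e).
Notation N2 := (nbhd2 e).
Hypotheses (sym_e : symmetric e) (irr_e : irreflexive e) (conn_e : connected_graph e).
Variable k : nat.
Hypothesis reg_e : regular_of_valency e k.
Hypothesis tdt_e : two_distance_transitive e.

Let common u v w := [set t in N v | e u t && e w t].

(** Each neighbourhood is a heptagon. Two edge counts between [N u] and [N2 u], one over all edges
    and one over the pairs in [r], force |N2 u| = 7 and four common neighbours at distance 2. The
    other three neighbours of a vertex of [N2 u] then lie in [N2 u], which would be a cubic graph on
    7 vertices. *)
Lemma lambda7_neq2 u v : k = 7%N -> e u v -> #|N u :&: N v| <> 2%N.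
Proof.
move=> k7 uv lam.
have circ x : exists s, exists2 D, D \in D7 & circulant e k x s (mem D).
  have [|s [D DD [[_]|[]]]] := circulant7 sym_e irr_e conn_e reg_e tdt_e x k7 uv; rewrite ?lam //.
  by exists s, D.
have lamE x y : e x y -> #|N x :&: N y| = 2%N.
  by move=> xy; rewrite (card_common_nbr tdt_e xy uv).
have common_le1 x t w : e x t -> w \in N2 x -> e t w -> #|common x t w| <= 1.
  move=> xt /inN2[wx nxw _] tw; rewrite sym_e in xt.
  have [s [D DD ci]] := circ t; have [_ _ _ sQ] := ci.
  have [i [j [lti ltj dx dw [Qxw _]]]] := circulant_adj ci xt tw.
  rewrite /common (circulant_card (p := fun l => adj7 D i l && adj7 D j l) ci); last first.
    by move=> l ltl; rewrite dx dw !sQ // k7.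
  rewrite k7 in lti ltj *.
  have /allP/(_ _ DD)/allP/(_ i) := heptagon_common_le1; rewrite mem_iota => /(_ lti).
  move=> /allP/(_ j); rewrite mem_iota => /(_ ltj).
  have -> : i != j by apply: contraNneq wx => ij; rewrite dx dw ij.
  by move: nxw; rewrite Qxw k7 => ->.
(* For [w] at distance 2 from [x], this says that [x] and [w] are at distance 2 inside the heptagon
   around [t]; each [t] in [N x] has two such [w]. *)
pose r x t w := e t w && (0 < #|common x t w|).
have cardr x t : e x t -> #|[set w in N2 x | r x t w]| = 2%N.
  move=> xt; have tx : e t x by rewrite sym_e.
  have -> : [set w in N2 x | r x t w] =
            [set w in N t | [&& w != x, ~~ e x w & 0 < #|common x t w|]].
    apply/setP=> w; rewrite [LHS]inE [RHS]inE inN /r.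
    case: (boolP (e t w)) => tw; rewrite ?andbF //= andbA; congr andb.
    by apply/inN2/andP=> [[]|[wx nxw]] //; split=> //; exists t; rewrite xt.
  have [s [D DD ci]] := circ t; have [size_s Us sN sQ] := ci.
  have [i [_ [lti _ dx _ _]]] := circulant_adj ci tx tx.
  rewrite (circulant_card (p := fun j => [&& j != i, ~~ adj7 D i j &
      0 < count (fun l => adj7 D i l && adj7 D j l) (iota 0 7)]) ci); last first.
    move=> j ltj; rewrite {1}dx nth_uniq ?size_s //; congr [&& _, ~~ _ & 0 < _].
      by rewrite dx sQ // k7.
    rewrite /common (circulant_card (p := fun l => adj7 D i l && adj7 D j l) ci) ?k7 //.
    by move=> l ltl; rewrite dx !sQ // k7.
  rewrite k7 in lti *; apply/eqP.
  by have /allP/(_ _ DD)/allP/(_ i) := heptagon_dist2; rewrite mem_iota => /(_ lti).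
have commonJ g x t w : g \in Aut e -> #|common (g x) (g t) (g w)| = #|common x t w|.
  move=> Gg; rewrite -(card_imset (mem (common x t w)) (@perm_inj _ g)).
  apply: eq_card => y; rewrite -(permKV g y) (mem_imset _ _ (@perm_inj _ g)).
  by rewrite !inE !aut_edge.
have [w Nw] : exists w, w \in N2 u.
  have /card_gt1P[w [_ [/setIdP[Nw _] _ _]]] : 1 < #|[set w in N2 u | r u v w]| by rewrite cardr.
  by exists w.
pose P := [set t in N u | r u t w]; pose B := N u :&: N w.
have cntP : (7 * 2 = #|N2 u| * #|P|)%N.
  rewrite -k7 -(reg_e u); apply: (double_count (r := r u)) => [t|w' Nw'].
    by rewrite inN; apply: cardr.
  have [g Gg [gu <-]] := aut_N2 tdt_e Nw Nw'.
  rewrite -(card_imset (mem P) (@perm_inj _ g)).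
  apply: eq_card => y; rewrite -(permKV g y) (mem_imset _ _ (@perm_inj _ g)).
  by rewrite 2!inE [RHS]inE -{1 2}gu /r !aut_edge // commonJ // inN.
have cntB : (7 * 4 = #|N2 u| * #|B|)%N.
  rewrite -k7 -(reg_e u); apply: (double_count (r := e)) => [t|w' Nw'].
    by rewrite inN => ut; rewrite (card_N2_nbr sym_e irr_e reg_e ut) lamE // k7.
  rewrite /B (card_common_dist2 tdt_e Nw Nw'); apply: eq_card => t.
  by rewrite !inE (sym_e w').
have commonB t : t \in B -> common u t w = [set y in B | e t y].
  move=> Bt; apply/setP=> y; rewrite !inE.
  by case: (e t y); rewrite ?andbT ?andbF.
(* For [t] in [P] the unique common neighbour of [u], [t], [w] is again in [P], so [P] induces a
   perfect matching. *)
have evP : ~~ odd #|P|.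
  rewrite -[#|P|]muln1; apply: (handshake sym_e irr_e) => t.
  move=> /setIdP[ut /andP[tw ge1]]; rewrite inN in ut.
  have -> : [set y in P | e t y] = common u t w.
    apply/setP=> y; rewrite !inE; case: (boolP (e t y)) => ty; rewrite ?andbF //= andbT.
    case: (boolP (e u y)) => //= uy; rewrite /r sym_e; case: (boolP (e w y)) => //= wy.
    by apply/card_gt0P; exists t; rewrite !inE ut (sym_e w) tw (sym_e y) ty.
  by apply/eqP; rewrite eqn_leq ge1 common_le1.
have le7 : #|B| <= 7 by rewrite -k7 -(reg_e u) subset_leq_card ?subsetIl.
have [cP cB cN2] : [/\ #|P| = 2, #|B| = 4 & #|N2 u| = 7]%N.
  have eqB : #|B| = (2 * #|P|)%N.
    have : (#|N2 u| * #|B| == #|N2 u| * (2 * #|P|))%N by rewrite -cntB mulnCA -cntP.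
    by rewrite eqn_pmul2l => [/eqP|] //; apply/card_gt0P; exists w.
  move: evP le7 cntP; rewrite eqB; case: #|P| => [|[|[|[|m]]]] //; try lia.
  by split=> //; lia.
have sB b : b \in B -> #|[set x in N w :\: N u | e b x]| + #|[set y in B | e b y]| = 2.
  move=> Bb; have wb : e w b by case/setIP: Bb => _; rewrite inN.
  rewrite -(lamE w b) // -(cardsID (N u) (N w :&: N b)) addnC; congr (_ + _)%N.
    by apply: eq_card => y; rewrite !inE [RHS]andbC andbA.
  by apply: eq_card => y; rewrite !inE; case: (e u y).
(* Each of the four [b] in [B] has two common neighbours with [w], in total 8. Those inside [B]
   contribute 2, by the matching on [P]. If [x] had no neighbour in [B], the two other vertices of
   [N w :\: N u] would contribute at most 2 each, and 4 + 2 < 8. *)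
have sub x : x \in N w :\: N u -> x \in N2 u.
  move=> Cx; have /setDP[wx nux] := Cx; rewrite !inN in wx nux.
  have [b Bb bx] : exists2 b, b \in B & e b x.
    apply/exists_inP; apply: contraT; rewrite negb_exists_in => /forall_inP nB.
    have tot : (\sum_(b in B) #|[set x in N w :\: N u | e b x]| +
            \sum_(b in B) #|[set y in B | e b y]| = 8)%N.
      by rewrite -big_split /= (eq_bigr _ sB) sum_nat_const cB.
    have e2 : (\sum_(b in B) #|[set y in B | e b y]| = 2)%N.
      rewrite -cP -sum1_card [RHS](eq_bigl (fun b => (b \in B) && r u b w)); last first.
        by move=> b; rewrite !inE /r (sym_e w); case: (e u b); case: (e b w).
      rewrite [RHS]big_mkcondr /=; apply: eq_bigr => b Bb; rewrite -commonB // /r.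
      have [ub wb] := setIP Bb; rewrite inN in ub; rewrite inN sym_e in wb.
      rewrite wb /=; have := common_le1 u b w ub Nw wb.
      by case: #|_| => [|[|]].
    have e1 : (\sum_(b in B) #|[set x in N w :\: N u | e b x]| <= 4)%N.
      under eq_bigr do rewrite -sum1dep_card big_mkcondr.
      rewrite exchange_big (bigD1 x) //= big1 ?add0n; last first.
        by move=> b Bb; rewrite (negPf (nB b Bb)).
      have c2 : #|(N w :\: N u) :\ x| = 2.
        have := cardsD1 x (N w :\: N u); rewrite Cx cardsD setIC.
        by rewrite -/B cB reg_e k7 => -[].
      rewrite (_ : 4 = \sum_(y in (N w :\: N u) :\ x) 2)%N; last by rewrite sum_nat_const c2.
      rewrite (eq_bigl (fun y => y \in (N w :\: N u) :\ x)); last by move=> y; rewrite !inE andbC.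
      apply: leq_sum => y; rewrite !inE => /and3P[_ _ wy].
      rewrite -big_mkcondr sum1dep_card -(lamE w y wy); apply: subset_leq_card.
      by apply/subsetP=> b; rewrite !inE (sym_e y) => /andP[/andP[_ ->]].
    by move: e1 tot; rewrite e2; case: (\sum_(b in B) _) => [|[|[|[|[|m]]]]].
  have [ub _] := setIP Bb; rewrite inN in ub.
  apply/inN2; split=> //; last by exists b; rewrite ub.
  by apply: contraTneq wx => ->; rewrite sym_e; case/inN2: Nw.
have /negP[] : ~~ odd (#|N2 u| * 3); last by rewrite cN2.
apply: (handshake sym_e irr_e) => w' Nw'.
have [g Gg [gu <-]] := aut_N2 tdt_e Nw Nw'.
have -> : [set x in N2 u | e (g w) x] = g @: (N w :\: N u).
  apply/setP=> y; rewrite -(permKV g y) (mem_imset _ _ (@perm_inj _ g)).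
  rewrite [LHS]inE -{1}gu aut_nbhd2 // aut_edge //; move: (g^-1 y) => x.
  apply/andP/idP=> [[/inN2[_ nux _] wx]|Cx]; first by rewrite !inE nux.
  by rewrite sub //; case/setDP: Cx; rewrite inN.
rewrite card_imset; last exact: perm_inj.
by rewrite cardsD setIC -/B cB reg_e k7.
Qed.

End Lambda7Two.

(** * Triangle-free graphs *)

Section SublengthTwo.
Variable T : finType.
Implicit Types (H : {group {perm T}}) (S : {set T}) (x y z : T).

(* A suborbit of length 2 makes the group dihedral on a cycle, so that all
   suborbits have length at most 2. *)
Lemma prim_sublen2 H S x y : [primitive H, on S | 'P] -> x \in S -> y \in S ->
  #|sublen_eq H S 2 x| = 2 -> sublen H x y <= 2.
Proof.
move=> primH Sx Sy cardDx; have trH := proj1 (andP primH).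
pose D := sublen_eq H S 2.
have DJ g a b : g \in H -> (g b \in D (g a)) = (b \in D a).
  move=> Hg; rewrite !inE (transitive_act trH) // (inj_eq perm_inj).
  by rewrite sublen_act.
have DC a b : a \in S -> b \in D a -> a \in D b.
  move=> Sa; rewrite !inE Sa => /and3P[Sb ba].
  by rewrite (sublenC trH Sa Sb) [a == b]eq_sym ba.
have DS a b : b \in D a -> b \in S by rewrite inE => /and3P[].
have cardD a : a \in S -> #|D a| = 2.
  move=> Sa; have [g Hg ->] := atransP2 trH Sx Sa; rewrite -cardDx.
  rewrite -(card_imset (mem (D x)) (@perm_inj _ g)); apply: eq_card => b.
  by rewrite -(permKV g b) DJ // (mem_imset _ _ (@perm_inj _ g)).
(* By [other], fixing [a] and one of the two points of [D a] means fixing both. Hence [K] is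
   constant along the orbital, and by primitivity on all of [S]; so an element fixing [x] and [b]
   fixes [y] too. *)
pose K a := [set g in H | (g a == a) && [forall b in D a, g b == b]].
have inK g a : reflect [/\ g \in H, g a = a & forall b, b \in D a -> g b = b] (g \in K a).
  rewrite inE; apply: (iffP and3P) => -[Hg /eqP ga gD]; split=> //; try exact/eqP.
    by move=> b Db; apply/eqP/(forall_inP gD).
  by apply/forall_inP => b Db; rewrite gD.
have other g a b : g \in H -> a \in S -> g a = a -> b \in D a -> g b = b -> g \in K a.
  move=> Hg Sa ga Db gb; apply/inK; split=> // c Dc.
  case: (eqVneq c b) => [-> //|cb].
  have : g c \in D a :\ b by rewrite in_setD1 -{1}gb (inj_eq perm_inj) cb /= -ga DJ.
  have /cards1P[d Dd] : #|D a :\ b| == 1%N by have := cardsD1 b (D a); rewrite Db cardD // add1n => -[<-].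
  have : c \in D a :\ b by rewrite in_setD1 cb.
  by rewrite Dd !in_set1 => /eqP-> /eqP.
have sK a b : a \in S -> b \in D a -> K a \subset K b.
  move=> Sa Db; apply/subsetP=> g /inK[Hg ga gD].
  by apply: (other g b a) => //; [apply: DS Db | rewrite gD | apply: DC].
have KJ h a : h \in H -> K (h a) = K a :^ h.
  move=> Hh; apply/setP=> g; rewrite mem_conjg; apply/inK/inK.
    move=> [Hg ga gD]; rewrite groupJ ?groupV // conjgE invgK !permM ga permK.
    by split=> // b Db; rewrite !permM gD ?permK // DJ.
  rewrite groupJr ?groupV // conjgE invgK !permM => -[Hg ga gD]; split=> //.
    by rewrite -{2}ga permKV.
  move=> b; rewrite -{1 3}(permKV h b) DJ // => Db.
  by have := gD _ Db; rewrite !permM permKV => /perm_inj.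
have /set0Pn[b Db] : D x != set0 by rewrite -card_gt0 cardD.
have Sb := DS _ _ Db.
have [] // := prim_equiv (R := fun a b => K a == K b) primH.
- by move=> ? ? ? _ _ _; split=> // /eqP->.
- by move=> h Hh ? ? _ _; rewrite !KJ //; apply/eqP/eqP=> [/conjsg_inj|->].
- move=> /(_ x y Sx Sy)/eqP eqK.
  have sub : 'C_H[x | 'P] :&: 'C_H[b | 'P] \subset 'C_H[x | 'P] :&: 'C_H[y | 'P].
    apply/subsetP=> g /setIP[Cx /astab_permP[Hg gb]]; rewrite inE Cx /=.
    have [_ gx] := astab_permP _ _ _ Cx.
    by have := other g x b Hg Sx gx Db gb; rewrite eqK => /inK[_ gy _]; apply/astab_permP.
  have := sublen_stab H x y; rewrite -(sublen_stab H x b).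
  have -> : sublen H x b = 2 by move: Db; rewrite inE => /and3P[_ _ /eqP].
  have := subset_leq_card sub; set m := #|_ :&: _|; set n := #|_ :&: _| => le eqmn.
  have m0 : 0 < m by apply: cardG_gt0.
  rewrite -(leq_pmul2r (leq_trans m0 le)) eqmn leq_pmul2l //.
move=> /(_ x b Sx Sb); rewrite eqEsubset sK // sK // ?(DC x) // => /(_ isT) eqxb.
by move: Db; rewrite eqxb inE eqxx andbF.
Qed.

End SublengthTwo.

(** * The values 1, k - 1 and k of mu *)

Section TriangleFree.
Variables (T : finType) (e : rel T).
Implicit Types (u v w x y z a b c d : T) (g h : {perm T}).
Notation N := (nbhd e).
Notation N2 := (nbhd2 e).
Hypotheses (sym_e : symmetric e) (irr_e : irreflexive e).
Variable k : nat.
Hypothesis reg_e : regular_of_valency e k.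
Hypothesis tdt_e : two_distance_transitive e.

Lemma transp_loc2 u :
    (forall b c d, b \in N u -> c \in N u -> d \in N u -> b != d -> b != c -> d != c ->
       exists2 g, g \in Aut e & [/\ g u = u, g c = c & g b = d]) ->
  loc2 e u.
Proof.
move=> transp a b c d Na Nb Nc Nd ab cd.
have [g Gg [gu ga]] := aut_nbr tdt_e Na Nc.
have [gb|gbd] := eqVneq (g b) d; first by exists g.
have Ngb : g b \in N u by rewrite -gu aut_nbhd.
have [||h Gh [hu hc hb]] := transp _ _ _ Ngb Nc Nd gbd.
- by rewrite -ga (inj_eq perm_inj) eq_sym.
- by rewrite eq_sym.
by exists (g * h); rewrite ?groupM // !permM gu ga hu hc hb.
Qed.

Lemma nbr_neq u v : e u v -> u != v.
Proof. by apply: contraTneq => ->; rewrite irr_e. Qed.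

Hypothesis triangle_free : forall u v x, e u v -> e v x -> ~~ e u x.

Lemma nbr_N2 u v x : e u v -> e v x -> u != x -> x \in N2 u.
Proof.
by move=> uv vx ux; apply/inN2; rewrite eq_sym (triangle_free uv vx); split=> //; exists v; rewrite uv.
Qed.

Lemma nbr2_N2 u a b : a \in N u -> b \in N u -> a != b -> b \in N2 a.
Proof. by rewrite !inN => ua ub; apply: nbr_N2 ub; rewrite sym_e. Qed.

Lemma card_N2_mu u w : w \in N2 u -> (#|N2 u| * #|N u :&: N w| = k * k.-1)%N.
Proof.
move=> Nw; rewrite -{1}(reg_e u); apply/esym/(double_count (r := e)) => [v|w' Nw'].
  rewrite inN => uv; rewrite (card_N2_nbr sym_e irr_e reg_e uv).
  have -> : #|N u :&: N v| = 0%N; last by rewrite subn0.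
  apply/eqP; rewrite cards_eq0; apply/eqP/setP=> x; rewrite !inE.
  by apply/negP=> /andP[ux vx]; have := triangle_free uv vx; rewrite ux.
rewrite (card_common_dist2 tdt_e Nw Nw'); apply: eq_card => v.
by rewrite !inE (sym_e w').
Qed.

(** The ends of a 2-arc are at distance 2 and determine its middle vertex, so transitivity on such
    pairs of ends suffices. *)
Lemma mu1_two_arc u w : w \in N2 u -> #|N u :&: N w| = 1%N -> two_arc_transitive e.
Proof.
move=> Nw mu1; split; first by have [] := tdt_e.
move=> a b c a' b' c' /and3P[ab bc ac] /and3P[ab' bc' ac'].
have Nc := nbr_N2 ab bc ac; have Nc' := nbr_N2 ab' bc' ac'.
have [g Gg [ga gc]] := aut_dist2 tdt_e Nc Nc'; exists g => //; split=> //.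
have /eqP/cards1P[x eqx] : #|N a' :&: N c'| = 1%N by rewrite (card_common_dist2 tdt_e Nc' Nw).
have : b' \in N a' :&: N c' by rewrite !inE ab' sym_e.
have : g b \in N a' :&: N c' by rewrite -ga -gc !inE !aut_edge // ab sym_e.
by rewrite eqx !inE => /eqP-> /eqP->.
Qed.

(** Vertices at distance 2 are twins, and transposing two twins is an automorphism. *)
Lemma muk_loc2 u w : w \in N2 u -> #|N u :&: N w| = k -> loc2 e u.
Proof.
move=> Nw muk; have twin x y : y \in N2 x -> N x = N y.
  move=> Ny; have := card_common_dist2 tdt_e Ny Nw; rewrite muk => c.
  apply: (@etrans _ _ (N x :&: N y)); [apply/esym|].
    by apply/eqP; rewrite eqEcard subsetIl c reg_e leqnn.
  by apply/eqP; rewrite eqEcard subsetIr c reg_e leqnn.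
apply: transp_loc2 => b c d Nb Nc Nd bd bc dc.
have eqN := twin _ _ (nbr2_N2 Nb Nd bd).
have eN x : e x b = e x d by rewrite ![e x _]sym_e -!inN eqN.
exists (tperm b d); last first.
  rewrite tpermL !tpermD // ?(eq_sym b) ?(eq_sym d) ?nbr_neq // -inN //.
apply: aut_of_homo => x y.
have eN' z : e b z = e d z by rewrite ![e _ z]sym_e eN.
by case: tpermP => [->|->|_ _]; case: tpermP => [->|->|_ _]; rewrite ?eN ?eN' ?irr_e.
Qed.


(** The neighbourhoods of [b] and [d] differ by one vertex each: d' is adjacent to [b] only and b'
    to [d] only. The double transposition (b d)(b' d') is an automorphism fixing [u] and [c]. *)
Lemma muk1_loc2 u w : 2 < k -> w \in N2 u -> #|N u :&: N w| = k.-1 -> loc2 e u.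
Proof.
move=> k2 Nw muk; have k0 : 0 < k by apply: leq_trans k2.
have extra x y : y \in N2 x ->
    exists2 t, e x t & ~~ e y t /\ forall z, e x z -> z != t -> e y z.
  move=> Ny; have := card_common_dist2 tdt_e Ny Nw; rewrite muk => c.
  have : #|N x :\: N y| = 1%N by rewrite cardsD c reg_e -{1}(prednK k0) subSnn.
  move/eqP/cards1P=> [t eqt]; have : t \in N x :\: N y by rewrite eqt set11.
  case/setDP; rewrite !inN => xt nyt; exists t => //; split=> // z xz zt.
  have /setP/(_ z) := eqt; rewrite !inE xz (negPf zt) andbT.
  by move/negbFE.
apply: transp_loc2 => b c d; rewrite !inN => ub uc ud bd bc dc.
have Nbd : d \in N2 b by rewrite (@nbr2_N2 u) ?inN.
have [d' bd' [ndd' bdz]] := extra _ _ Nbd; rewrite N2C // in Nbd.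
have [b' db' [nbb' dbz]] := extra _ _ Nbd.
have Nd' : d' \in N2 u.
  by apply: nbr_N2 ub bd' _; apply: contraNneq ndd' => <-; rewrite sym_e.
have Nb' : b' \in N2 u.
  by apply: nbr_N2 ud db' _; apply: contraNneq nbb' => <-; rewrite sym_e.
have bd'' : b' != d' by apply: contraTneq db' => ->.
have [nub' nud'] : ~~ e u b' /\ ~~ e u d' by case/inN2: Nb'; case/inN2: Nd'.
(* b' and d' each have k - 1 neighbours in [N u], and 2 (k - 1) > k. So they are at distance 2, and
   their neighbourhoods differ exactly by [d] and [b]. *)
have [x [ux b'x d'x]] : exists x, [/\ e u x, e x b' & e x d'].
  have : 0 < #|(N u :&: N b') :&: (N u :&: N d')|.
    have arith m n q : 2 < q -> m <= q -> m + n = q.-1 + q.-1 -> 0 < n by clear; lia.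
    have := cardsUI (N u :&: N b') (N u :&: N d').
    rewrite (card_common_dist2 tdt_e Nb' Nw) (card_common_dist2 tdt_e Nd' Nw) muk.
    have : #|(N u :&: N b') :|: (N u :&: N d')| <= k.
      by rewrite -(reg_e u) subset_leq_card // subUset !subsetIl.
    exact: arith.
  case/card_gt0P=> x; rewrite !inE => /andP[/andP[ux b'x] /andP[_ d'x]].
  by exists x; rewrite ux [e x b']sym_e [e x d']sym_e.
have Nbd' : d' \in N2 b' by apply: (nbr_N2 (v := x)); rewrite // sym_e.
have nbd' : ~~ e b' d' by case/inN2: Nbd'.
have nbd : ~~ e b d by apply: (triangle_free (v := u)); rewrite // sym_e.
have b'dz z : e b' z -> z != d -> e d' z.
  have [t b't [nd't all]] := extra _ _ Nbd'; move=> b'z zd; apply: (all) => //.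
  suff <- : d = t by [].
  apply/eqP; apply: contraNT ndd' => dt; rewrite sym_e; apply: (all) dt.
  by rewrite sym_e.
have d'bz z : e d' z -> z != b -> e b' z.
  rewrite N2C // in Nbd'; have [t d't [nb't all]] := extra _ _ Nbd'; move=> d'z zb; apply: (all) => //.
  suff <- : b = t by [].
  apply/eqP; apply: contraNT nbb' => bt; rewrite sym_e; apply: (all) bt.
  by rewrite sym_e.
have [bb' bd1 db1 dd1] : [/\ b != b', b != d', d != b' & d != d'].
  by split; [apply: contraNneq nub' | apply: contraNneq nud' | apply: contraNneq nub' | apply: contraNneq nud'] => <-.
pose f := tperm b d * tperm b' d'.
have fb : f b = d by rewrite permM tpermL tpermD 1?eq_sym.
have fd : f d = b by rewrite permM tpermR tpermD 1?eq_sym.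
have fb' : f b' = d' by rewrite permM [tperm b d b']tpermD // tpermL.
have fd' : f d' = b' by rewrite permM [tperm b d d']tpermD // tpermR.
have fx y : y != b -> y != d -> y != b' -> y != d' -> f y = y.
  by move=> *; rewrite permM !tpermD // eq_sym.
exists f; last split=> //.
- have half y z : y \in [:: b; d; b'; d'] -> e y z -> e (f y) (f z).
    rewrite !inE => /or4P[] /eqP->{y} yz; rewrite ?fb ?fd ?fb' ?fd'.
    - have zb : z != b by rewrite eq_sym nbr_neq.
      case: (eqVneq z d) yz => [->|zd] yz; first by rewrite yz in nbd.
      case: (eqVneq z b') yz => [->|zb'] yz; first by rewrite yz in nbb'.
      by case: (eqVneq z d') yz => [->|zd'] yz; rewrite ?fd' // fx // bdz.
    - have zd : z != d by rewrite eq_sym nbr_neq.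
      case: (eqVneq z b) yz => [->|zb] yz; first by rewrite sym_e yz in nbd.
      case: (eqVneq z d') yz => [->|zd'] yz; first by rewrite yz in ndd'.
      by case: (eqVneq z b') yz => [->|zb'] yz; rewrite ?fb' // fx // dbz.
    - have zb' : z != b' by rewrite eq_sym nbr_neq.
      case: (eqVneq z d') yz => [->|zd'] yz; first by rewrite yz in nbd'.
      case: (eqVneq z b) yz => [->|zb] yz; first by rewrite sym_e yz in nbb'.
      by case: (eqVneq z d) yz => [->|zd] yz; rewrite ?fd 1?sym_e // fx // sym_e b'dz.
    - have zd' : z != d' by rewrite eq_sym nbr_neq.
      case: (eqVneq z b') yz => [->|zb'] yz; first by rewrite sym_e yz in nbd'.
      case: (eqVneq z d) yz => [->|zd] yz; first by rewrite sym_e yz in ndd'.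
      by case: (eqVneq z b) yz => [->|zb] yz; rewrite ?fb 1?sym_e // fx // sym_e d'bz.
  apply: aut_of_homo => y z yz.
  case: (boolP (y \in [:: b; d; b'; d'])) => [/half->//|ny].
  case: (boolP (z \in [:: b; d; b'; d'])) => [hz|nz].
    by rewrite sym_e half // sym_e.
  move: ny nz; rewrite !inE !negb_or => /and4P[? ? ? ?] /and4P[? ? ? ?].
  by rewrite !fx.
- by rewrite fx ?(nbr_neq ub) ?(nbr_neq ud) // eq_sym; [case/inN2: Nb' | case/inN2: Nd'].
- by rewrite fx // 1?eq_sym //; [apply: contraNneq nub' | apply: contraNneq nud'] => ->.
Qed.

End TriangleFree.

(** * The values 2 and 3 of mu *)

Section SmallMu.
Variables (T : finType) (e : rel T).
Implicit Types (u v w x y z a b c d : T) (g h : {perm T}).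
Notation N := (nbhd e).
Notation N2 := (nbhd2 e).
Notation Stab u := ('C_(Aut e)[u | 'P])%G.
Hypotheses (sym_e : symmetric e) (irr_e : irreflexive e).
Variable k : nat.
Hypothesis reg_e : regular_of_valency e k.
Hypothesis tdt_e : two_distance_transitive e.
Hypothesis triangle_free : forall u v x, e u v -> e v x -> ~~ e u x.

Let nbr2_N2 := nbr2_N2 sym_e triangle_free.
Let nbr_N2 := nbr_N2 triangle_free.

Section Mu2.
Hypothesis mu2 : forall u w, w \in N2 u -> #|N u :&: N w| = 2%N.

(** Quadrangles match the unordered pairs of neighbours of [u] with the vertices of [N2 u]. This
    turns transitivity on [N2 u] into 2-homogeneity on [N u]. *)
Lemma mu2_opp u a b : a \in N u -> b \in N u -> a != b ->
  exists2 w, w \in N2 u & N a :&: N b = [set u; w] /\ N u :&: N w = [set a; b].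
Proof.
move=> Na Nb ab; have /mu2 := nbr2_N2 Na Nb ab; rewrite !inN in Na Nb.
have Iu : u \in N a :&: N b by rewrite !inE sym_e Na sym_e.
rewrite (cardsD1 u) Iu add1n => -[] /eqP/cards1P[w eqw].
have : w \in (N a :&: N b) :\ u by rewrite eqw set11.
rewrite !inE => /and3P[wu aw bw]; have Nw : w \in N2 u by apply: nbr_N2 Na aw _; rewrite eq_sym.
exists w => //; split; first by rewrite -eqw setD1K.
apply/esym/eqP; rewrite eqEcard cards2 ab mu2 // leqnn andbT.
by apply/subsetP=> x; rewrite !inE => /orP[]/eqP->; rewrite ?Na ?Nb sym_e.
Qed.

Lemma mu2_homog u a b c d : a \in N u -> b \in N u -> c \in N u -> d \in N u ->
    a != b -> c != d ->
  exists2 g, g \in Aut e & g u = u /\ (g a = c /\ g b = d \/ g a = d /\ g b = c).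
Proof.
move=> Na Nb Nc Nd ab cd.
have [w Nw [_ eab]] := mu2_opp Na Nb ab; have [w' Nw' [_ ecd]] := mu2_opp Nc Nd cd.
have [g Gg [gu gw]] := aut_N2 tdt_e Nw Nw'; exists g => //; split=> //.
have im x : x \in [set a; b] -> g x \in [set c; d].
  by rewrite -eab -ecd !inE -!(inN e) -gw -[in N u]gu !aut_nbhd // gu.
have := im b; have := im a; rewrite !inE !eqxx orbT => /(_ isT) ga /(_ isT) gb.
have : g a != g b by rewrite (inj_eq perm_inj).
by case/orP: ga => /eqP->; case/orP: gb => /eqP->; rewrite ?eqxx //; [left|right].
Qed.

Lemma mu2_k5_loc2 u w : w \in N2 u -> 2 %| #|N2 u| -> loc2 e u.
Proof.
move=> Nw evN2; have [_ _ /(_ u)[_ trN2]] := tdt_e.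
have [|g /stabP[Gg gu] [g2 gw]] := @pelt_moves _ 2 (Stab u) w isT.
  by rewrite (atransP trN2).
(* An element fixing [N u] pointwise would fix each far corner of a quadrangle at [u], in particular
   [w]. *)
have [a Na ga] : exists2 a, a \in N u & g a != a.
  apply/exists_inP; apply: contraT; rewrite negb_exists_in => /forall_inP fixN.
  have [_ _ [a /andP[ua aw]]] := inN2 _ _ _ Nw.
  have : 1 < #|N u :&: N w| by rewrite mu2.
  case/card_gt1P=> x [y [Ix Iy xy]].
  have [Nx Ny] : x \in N u /\ y \in N u by case/setIP: Ix; case/setIP: Iy.
  have [w' Nw' [exy _]] := mu2_opp Nx Ny xy.
  have [gx gy] : g x = x /\ g y = y.
    by split; apply/eqP; rewrite -[_ == _]negbK; apply: fixN.
  have : w \in N x :&: N y.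
    by move: Ix Iy; rewrite !inE ![e w _]sym_e => /andP[_ ->] /andP[_ ->].
  rewrite exy !inE eq_sym; have -> : (u == w) = false by apply/negbTE; case/inN2: Nw; rewrite eq_sym.
  move=> /= /eqP eqw; case/negP: gw.
  have : g w \in N x :&: N y by rewrite -gx -gy !inE !aut_edge // -!(inN e) -in_setI exy eqw !inE eqxx orbT.
  rewrite exy eqw !inE -{1}gu (inj_eq perm_inj) => /orP[/eqP wu|//].
  by move: Nw'; rewrite wu => /inN2[]; rewrite eqxx.
have [h gh [b gb [ba ha hb]]] := two_elt_swap g2 ga.
have /stabP[Gh hu] : h \in Stab u.
  by apply: subsetP gh; rewrite cycle_subG; apply/stabP.
by apply: (swap_loc2 (@mu2_homog u) Gh hu Na _ ha hb); rewrite eq_sym.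
Qed.

End Mu2.

Section Mu3.
Hypothesis lp_e : locally_primitive e.
Hypothesis k7 : k = 7%N.
Hypothesis mu3 : forall u w, w \in N2 u -> #|N u :&: N w| = 3%N.

(** Here |N2 u| = 14 while |N u| = 7, so the stabiliser of [u] and [a] has twice the order of that
    of [u] and [w]. Both contain the stabiliser of all three, whose indices in them are the two
    orbit lengths. *)
Lemma mu3_sublen a u w : e a u -> e a w -> u != w ->
  sublen (Stab a) u w = (2 * #|orbit 'P 'C_(Stab u)[w | 'P] a|)%N.
Proof.
move=> au aw uw; have ua : e u a by rewrite sym_e.
have Nw := nbr_N2 ua aw uw.
have [_ _ /(_ u)[_ trN2]] := tdt_e.
have cN2 : #|N2 u| = 14%N.
  have := card_N2_mu sym_e irr_e reg_e tdt_e triangle_free Nw; rewrite mu3 // k7.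
  by move: #|N2 u| => m; lia.
have o1 := card_orbit_stab 'P (Stab u) a.
have o2 := card_orbit_stab 'P (Stab u) w.
have o3 := card_orbit_stab 'P 'C_(Stab u)[w | 'P] a.
have o4 := card_orbit_stab 'P 'C_(Stab u)[a | 'P] w.
rewrite (atransP (aut_nbr_trans tdt_e u)) ?inN // reg_e k7 in o1.
rewrite (atransP trN2) // cN2 in o2.
have eqs : 'C_('C_(Stab u)[a | 'P])[w | 'P] = 'C_('C_(Stab u)[w | 'P])[a | 'P] by rewrite setIAC.
have eqa : 'C_(Stab a)[u | 'P] = 'C_(Stab u)[a | 'P] by rewrite /= setIAC.
rewrite /sublen eqa; rewrite eqs in o4.
have X0 : 0 < #|'C_('C_(Stab u)[w | 'P])[a | 'P]| by apply: cardG_gt0.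
move: X0 o1 o2 o3 o4; set X := #|'C_('C_(Stab u)[w | 'P])[a | 'P]|.
set l := #|orbit _ _ w|; set j := #|orbit _ _ a| => X0 /= o1 o2 o3 o4.
apply/eqP; rewrite -(eqn_pmul2r X0) o4 -mulnA o3.
by rewrite -(eqn_pmul2l (isT : 0 < 7)) o1 mulnA o2.
Qed.

Hypothesis not_loc2 : forall u, ~ loc2 e u.

(** The orbit of [a] lies among three common neighbours, so suborbits have length 2, 4 or 6. Length
    6 is 2-transitivity. If 4 occurs, the six points split as 4 + 2, and a single suborbit of length
    2 bounds all lengths by 2. *)
Lemma mu3_sublen2 a u w : e a u -> e a w -> u != w -> sublen (Stab a) u w = 2%N.
Proof.
move=> au aw uw; pose S := N a; pose H := Stab a.
have primH := lp_e a; have trH := aut_nbr_trans tdt_e a.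
have Su : u \in S by rewrite inN.
have even y : y \in S -> y != u -> sublen H u y \in [:: 2; 4]%N.
  rewrite inN => ay yu; have ua : e u a by rewrite sym_e.
  have Ny : y \in N2 u by apply: nbr_N2 ua ay _; rewrite eq_sym.
  have eqy : sublen H u y = _ := mu3_sublen au ay _; rewrite eq_sym in yu.
  have le3 : #|orbit 'P 'C_(Stab u)[y | 'P] a| <= 3.
    rewrite -(mu3 Ny); apply/subset_leq_card/subsetP=> z /orbit_permP[g].
    move=> /astab_permP[/stabP[Gg gu] gy] <-.
    by rewrite inE -{1}gu -{1}gy !aut_nbhd // !inN ua sym_e.
  have neq6 : sublen H u y != 6.
    apply/eqP=> len6; apply: (not_loc2 (u := a)).
    apply: (sublen_loc2 tdt_e Su) => z Sz zu; rewrite reg_e k7 /= -len6.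
    apply: sublen_orbit; suff /setP/(_ z) : orbit 'P 'C_H[u | 'P] y = S :\ u by rewrite !inE zu -(inN e) Sz.
    apply/eqP; rewrite eqEcard -/(sublen H u y) len6.
    have := cardsD1 u S; rewrite Su reg_e k7 add1n => -[<-]; rewrite andbT.
    apply/subsetP=> t /orbit_permP[h /astab_permP[Hh hu] <-].
    by rewrite in_setD1 (transitive_act trH) // inN ay -{1}hu (inj_eq perm_inj) eq_sym yu.
  move: (sublen_gt0 H u y) neq6; rewrite eqy // !inE.
  by move: le3; case: #|_| => [|[|[|[|]]]].
have wu : w != u by rewrite eq_sym.
have Sw : w \in S by rewrite inN.
have sum : #|sublen_eq H S 2 u| + #|sublen_eq H S 4 u| = 6%N.
  have := cardsD1 u S; rewrite Su reg_e k7 add1n => -[->].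
  rewrite -(cardsID (sublen_eq H S 2 u) (S :\ u)); congr (_ + _)%N.
    by apply: eq_card => y; rewrite !inE; case: (e a y); case: (y != u); rewrite ?andbF.
  apply: eq_card => y; rewrite [in RHS]in_setD in_setD1.
  case: (eqVneq y u) => [->|yu]; first by rewrite !inE eqxx !andbF.
  case: (boolP (y \in S)) => Sy; last by rewrite !inE -(inN e) (negPf Sy) !andbF.
  have := even y Sy yu; rewrite ![_ \in sublen_eq _ _ _ _]inE Sy yu /= !inE.
  by case/orP=> /eqP->.
have := card_sublen_eq 4 trH Su; move: sum.
case: (posnP #|sublen_eq H S 4 u|) => [c4 _ _|c4 sum dvd4].
  have := even w Sw wu; rewrite !inE => /orP[/eqP->//|len4].
  have : w \in sublen_eq H S 4 u by rewrite inE Sw wu.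
  by move: c4 => /eqP; rewrite cards_eq0 => /eqP->; rewrite inE.
have c2 : #|sublen_eq H S 2 u| = 2%N.
  have arith m n : m + n = 6 -> 4 %| n -> 0 < n -> m = 2 by clear; lia.
  exact: arith sum dvd4 c4.
have := prim_sublen2 primH Su Sw c2; have := even w Sw wu.
by rewrite !inE => /orP[/eqP->|/eqP->].
Qed.

(** With suborbits of length 2, [mu3_sublen] leaves an orbit of size 1 for each common neighbour. *)
Lemma mu3_stab_common u w a g : g \in Aut e -> g u = u -> g w = w -> u != w ->
  e u a -> e a w -> g a = a.
Proof.
move=> Gg gu gw uw ua aw; have au : e a u by rewrite sym_e.
have := mu3_sublen au aw uw; rewrite mu3_sublen2 // => /eqP.
rewrite -[X in X == _]muln1 eqn_pmul2l // eq_sym => /cards1P[x eqx].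
have : a \in orbit 'P 'C_(Stab u)[w | 'P] a by apply: orbit_refl.
have : g a \in orbit 'P 'C_(Stab u)[w | 'P] a.
  by apply/orbit_permP; exists g => //; apply/astab_permP; split=> //; apply/stabP.
by rewrite eqx !inE => /eqP-> /eqP->.
Qed.

Let Sw a u w := [exists g in Aut e, [&& g a == a, g u == w & g w == u]].

Let SwP a u w : reflect (exists2 g, g \in Aut e & [/\ g a = a, g u = w & g w = u]) (Sw a u w).
Proof.
apply: (iffP exists_inP) => -[g Gg].
  by move=> /and3P[/eqP ? /eqP ? /eqP ?]; exists g.
by move=> [ga gu gw]; exists g => //; rewrite ga gu gw !eqxx.
Qed.

(** Let t swap [u] and [w] about [a], and s about [b]. The product fixes [u] and [w], hence also
    [b], so t fixes [b]; fixing [a] and [b], it fixes their common neighbour [u], which it was to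
    move. *)
Lemma mu3_swap_uniq a b u w : u != w -> e u a -> e a w -> e u b -> e b w ->
  Sw a u w -> Sw b u w -> a = b.
Proof.
move=> uw ua aw ub bw /SwP[t Gt [ta tu tw]] /SwP[s Gs [sb su sw]].
apply/eqP; apply: contraT => ab.
have tsb : (t * s) b = b.
  by apply: (mu3_stab_common (u := u) (w := w)); rewrite ?groupM // permM ?tu ?tw ?su ?sw.
have tb : t b = b by apply: (@perm_inj _ s); rewrite -permM tsb sb.
case/negP: uw; rewrite -tu eq_sym; apply/eqP.
by apply: (mu3_stab_common (u := a) (w := b)); rewrite // sym_e.
Qed.

Lemma mu3_false : False.
Proof.
have [[x0 [_ _]] _ _] := tdt_e.
have /set0Pn[a Nx0a] : N x0 != set0 by rewrite -card_gt0 reg_e k7.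
pose x := x0; have xa : e x a by rewrite -inN.
have ax : e a x by rewrite sym_e.
(* An automorphism fixing [u] and taking [w1] to [w2] carries the swap about [a] to a swap about the
   image of [a]; by uniqueness that image is [a]. *)
have sw_orb u w1 w2 : e a u -> e a w1 -> e a w2 -> u != w1 -> u != w2 ->
    Sw a u w1 -> Sw a u w2 -> w2 \in orbit 'P 'C_(Stab a)[u | 'P] w1.
  move=> au aw1 aw2 uw1 uw2 s1 s2; have ua : e u a by rewrite sym_e.
  have [g Gg [gu gw]] := aut_N2 tdt_e (nbr_N2 ua aw1 uw1) (nbr_N2 ua aw2 uw2).
  apply/orbit_permP; exists g => //; apply/astab_permP; split=> //; apply/stabP; split=> //.
  apply: (mu3_swap_uniq (u := u) (w := w2)) => //.
  - by rewrite -gu aut_edge.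
  - by rewrite -gw aut_edge.
  case/SwP: s1 => t Gt [ta tu tw]; apply/SwP.
  exists (g^-1 * t * g); first by rewrite !groupM ?groupV.
  by rewrite !permM permK ta -{1}gu -{2}gw !permK tu tw.
(* [y] and [t] fill a suborbit of length 2 about [z], so an element taking [y] to [t] takes [t] back
   to [y]. The classes of the relation therefore have at most 3 points. *)
have sw_trans y z t : e a y -> e a z -> e a t -> y != z -> z != t -> y != t ->
    Sw a z y -> Sw a z t -> Sw a y t.
  move=> ay az at' yz zt yt s1 s2; rewrite eq_sym in yz.
  have orb := sw_orb z y t az ay at' yz zt s1 s2.
  have c2 := mu3_sublen2 az ay yz; rewrite /sublen in c2.
  have eqO : orbit 'P 'C_(Stab a)[z | 'P] y = [set y; t].
    apply/esym/eqP; rewrite eqEcard cards2 yt c2 leqnn andbT.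
    by apply/subsetP=> r; rewrite !inE => /orP[]/eqP->; rewrite ?orbit_refl.
  case/orbit_permP: (orb) => g Cg gy; have [/stabP[Gg ga] gz] := astab_permP _ _ _ Cg.
  apply/SwP; exists g => //; split=> //.
  have : g t \in [set y; t].
    rewrite -eqO -gy -permM; apply/orbit_permP; exists (g * g) => //.
    by rewrite groupM.
  rewrite !inE => /orP[/eqP//|/eqP gt]; case/negP: yt.
  by rewrite -(inj_eq (@perm_inj _ g)) gy gt.
have SwC y z : Sw a y z = Sw a z y.
  by apply/SwP/SwP => -[g Gg [? ? ?]]; exists g.
have [] // := prim_equiv (R := fun y z => (y == z) || Sw a y z) (lp_e a).
- move=> y z t; rewrite !inN => ay az at'; rewrite eqxx; split=> //.
  have [<- _ //|yz] := eqVneq y z => /= syz.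
  have [<-|yt] := eqVneq y t; first by rewrite SwC syz orbT.
  have [<-|zt] := eqVneq z t; first by rewrite syz.
  apply/idP/idP=> /=.
    by apply: (sw_trans z y t) => //; rewrite eq_sym.
  by apply: (sw_trans y z t) => //; rewrite SwC.
- move=> h /stabP[Gh ha] y z _ _; rewrite (inj_eq perm_inj); congr orb.
  apply/SwP/SwP => -[g Gg [ga gy gz]].
    exists (h * g * h^-1); first by rewrite !groupM ?groupV.
    by rewrite !permM ha ga gy gz !permK -{1}ha permK.
  exists (h^-1 * g * h); first by rewrite !groupM ?groupV.
  by rewrite !permM !permK -{1}ha permK ga gy gz ha.
- move=> full; have Nx : x \in N a by rewrite inN.
  have sw y : y \in N a :\ x -> Sw a x y.
    by case/setD1P=> yx Ny; have := full x y Nx Ny; rewrite eq_sym (negPf yx).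
  have c6 : #|N a :\ x| = 6%N by have := cardsD1 x (N a); rewrite Nx reg_e k7 add1n => -[].
  have /set0Pn[y Dy] : N a :\ x != set0 by rewrite -card_gt0 c6.
  have /setD1P[yx Ny] := Dy; rewrite inN in Ny.
  have : N a :\ x \subset orbit 'P 'C_(Stab a)[x | 'P] y.
    apply/subsetP=> z Dz; have /setD1P[zx Nz] := Dz; rewrite inN in Nz.
    by apply: sw_orb => //; rewrite 1?eq_sym ?sw.
  move/subset_leq_card; rewrite c6 -/(sublen _ x y) mu3_sublen2 //.
  by rewrite eq_sym.
(* The relation is not equality either: the two points [p], [q] of a suborbit of length 2 are
   exchanged by an element fixing [a]. *)
have /card_gt1P[y [z [Ny Nz yz]]] : 1 < #|N a :\ x|.
  by have := cardsD1 x (N a); rewrite inN ax reg_e k7 add1n => -[<-].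
case/setD1P: Ny => yx Ny; rewrite inN in Ny.
have : 1 < sublen (Stab a) x y by rewrite mu3_sublen2 // eq_sym.
case/card_gt1P=> p [q [Op Oq pq]].
have Np t : t \in orbit 'P 'C_(Stab a)[x | 'P] y -> e a t.
  by case/orbit_permP=> g /astab_permP[/stabP[Gg ga] _] <-; rewrite -{1}ga aut_edge.
move=> /(_ p q); rewrite !inN !Np // => /(_ isT isT) eqpq.
case/negP: (pq); apply/eqP/eqpq; apply/orP; right.
have eqO : orbit 'P 'C_(Stab a)[x | 'P] y = [set p; q].
  apply/esym/eqP; rewrite eqEcard cards2 pq -/(sublen _ x y) mu3_sublen2 1?eq_sym // andbT.
  by apply/subsetP=> r; rewrite !inE => /orP[]/eqP->.
have /orbit_permP[g Cg gp] : q \in orbit 'P 'C_(Stab a)[x | 'P] p by rewrite (orbit_eqP Op).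
have [/stabP[Gg ga] gx] := astab_permP _ _ _ Cg.
apply/SwP; exists g => //; split=> //.
have : g q \in [set p; q].
  rewrite -eqO -(orbit_eqP Op); apply/orbit_permP; exists (g * g); first by rewrite groupM.
  by rewrite permM gp.
rewrite !inE => /orP[/eqP//|/eqP gq]; case/negP: pq.
by rewrite -(inj_eq (@perm_inj _ g)) gp gq.
Qed.

End Mu3.
End SmallMu.

(** * The icosahedron *)

Definition circ5 (D : seq nat) i j := (j + (5 - i)) %% 5 \in D.
Definition adj5 := circ5 [:: 1; 4]%N.

Lemma pentagon_extend : all (fun D => all (fun i => all (fun j => all (fun l =>
    [&& circ5 D i j, circ5 D j l & i != l] ==>
    has (fun m => has (fun n =>
        perm_eq [:: i; j; l; m; n] (iota 0 5) &&
        all (fun p => all (fun q =>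
          circ5 D (nth 0%N [:: i; j; l; m; n] p) (nth 0%N [:: i; j; l; m; n] q) == adj5 p q)
        (iota 0 5)) (iota 0 5))
    (iota 0 5)) (iota 0 5))
  (iota 0 5)) (iota 0 5)) (iota 0 5)) [:: [:: 1; 4]; [:: 2; 3]]%N.
Proof. by vm_compute. Qed.

(** Each row is in the order in which the construction produces the pentagon around that vertex, so
    that it can be compared entry by entry. *)
Definition ico_nbrs : seq (seq nat) :=
  [:: [:: 1; 2; 3; 4; 5]; [:: 5; 0; 2; 7; 6]; [:: 1; 0; 3; 8; 7]; [:: 2; 0; 4; 9; 8];
      [:: 3; 0; 5; 10; 9]; [:: 4; 0; 1; 6; 10]; [:: 10; 5; 1; 7; 11]; [:: 6; 1; 2; 8; 11];
      [:: 7; 2; 3; 9; 11]; [:: 8; 3; 4; 10; 11]; [:: 9; 4; 5; 6; 11]; [:: 7; 8; 9; 10; 6]]%N.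

Lemma ico_nbrsP : all (fun i => all (fun j =>
  (((i, j) \in ico_edges) || ((j, i) \in ico_edges)) == (j \in nth [::] ico_nbrs i))
  (iota 0 12)) (iota 0 12).
Proof. by vm_compute. Qed.

Lemma icosahedron_of_list (T : finType) (e : rel T) (L : seq T) (u : T) :
    connected_graph e -> size L = 12%N -> uniq L ->
    (forall i, i < 12 -> nbhd e (nth u L i) =i [seq nth u L j | j <- nth [::] ico_nbrs i]) ->
  graph_iso e icosahedron.
Proof.
move=> conn_e sizeL UL nL.
have allL x : x \in L.
  move: x; apply: (conn_ind conn_e (x := nth u L 0)) => [|y z Ly yz]; first by rewrite mem_nth ?sizeL.
  have := nL (index y L); rewrite -sizeL index_mem nth_index // => /(_ Ly z).
  rewrite inE yz => /esym/mapP[j jn ->]; apply: mem_nth.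
  have : all (fun l => all (fun j => j < 12) l) ico_nbrs by [].
  rewrite sizeL; case: (ltnP (index y L) (size ico_nbrs)) => [lt|ge].
    by move=> /allP/(_ _ (mem_nth [::] lt))/allP; apply.
  by move: jn; rewrite nth_default.
have ltL x : index x L < 12 by rewrite -sizeL index_mem.
exists (fun x => inord (index x L)); split.
  exists (fun i : 'I_12 => nth u L i) => [x|i]; first by rewrite inordK ?nth_index.
  by apply: val_inj; rewrite /= index_uniq ?sizeL // inordK.
move=> x y; rewrite /icosahedron !inordK //.
have /allP/(_ (index x L)) := ico_nbrsP; rewrite mem_iota => /(_ (ltL x)).
move=> /allP/(_ (index y L)); rewrite mem_iota => /(_ (ltL y)) /eqP->.
have := nL _ (ltL x) y; rewrite nth_index // inE => ->.
apply/idP/mapP=> [jn|[j jn eqy]]; first by exists (index y L); rewrite ?nth_index.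
suff ltj : j < 12 by rewrite eqy index_uniq ?sizeL.
have : all (fun l => all (fun j => j < 12) l) ico_nbrs by [].
by move=> /allP/(_ _ (mem_nth [::] (ltL x : _ < size ico_nbrs)))/allP; apply.
Qed.

Section Icosahedron.
Variables (T : finType) (e : rel T).
Implicit Types (u v w x y z a b c d : T) (g h : {perm T}).
Notation N := (nbhd e).
Hypotheses (sym_e : symmetric e) (irr_e : irreflexive e) (conn_e : connected_graph e).
Variable k : nat.
Hypothesis reg_e : regular_of_valency e k.
Hypothesis tdt_e : two_distance_transitive e.

Definition is_pentagon x t := [/\ size t = 5%N, uniq t, t =i N x &
  forall i j, i < 5 -> j < 5 -> e (nth x t i) (nth x t j) = adj5 i j].

Section Lambda2.
Hypothesis k5 : k = 5%N.
Hypothesis lam2 : forall x y, e x y -> #|N x :&: N y| = 2%N.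

Lemma pentagon_at x a b c : e x a -> e x b -> e x c -> e a b -> e b c -> a != c ->
  exists d f, is_pentagon x [:: a; b; c; d; f].
Proof.
move=> xa xb xc ab bc ac.
have [|s [D DD ci]] := circulant5 sym_e irr_e conn_e reg_e tdt_e x k5 xa; first by rewrite lam2.
have [size_s Us sN sQ] := ci; rewrite k5 in size_s sQ.
have {}sQ i j : i < 5 -> j < 5 -> e (nth x s i) (nth x s j) = circ5 D i j := sQ i j.
have idx y : e x y -> exists2 i, i < 5 & y = nth x s i.
  rewrite -(inN e) -sN => sy; exists (index y s); last by rewrite nth_index.
  by rewrite -size_s index_mem.
have [[i lti da] [j ltj db] [l ltl dc]] := And3 (idx a xa) (idx b xb) (idx c xc).
have /allP/(_ _ DD)/allP/(_ i) := pentagon_extend; rewrite mem_iota => /(_ lti).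
move=> /allP/(_ j); rewrite mem_iota => /(_ ltj) /allP/(_ l); rewrite mem_iota => /(_ ltl).
move: ab bc; rewrite da db dc !sQ // => -> ->.
have -> : i != l by apply: contraNneq ac => il; rewrite da dc il.
rewrite implyTb => /hasP[m _ /hasP[n _ /andP[pe /allP adj]]].
exists (nth x s m), (nth x s n).
have -> : [:: nth x s i; nth x s j; nth x s l; nth x s m; nth x s n] =
   [seq nth x s r | r <- [:: i; j; l; m; n]] by [].
have pe_s : perm_eq [seq nth x s r | r <- [:: i; j; l; m; n]] s.
  by rewrite -[X in perm_eq _ X](mkseq_nth x s) size_s perm_map.
have lt5 p : p < 5 -> nth 0%N [:: i; j; l; m; n] p < 5.
  move=> ltp; have : nth 0%N [:: i; j; l; m; n] p \in iota 0 5.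
    by rewrite -(perm_mem pe) mem_nth.
  by rewrite mem_iota.
split=> //; first by rewrite (perm_uniq pe_s).
  by move=> y; rewrite (perm_mem pe_s) sN.
move=> p q ltp ltq; rewrite !(nth_map 0%N) // sQ ?lt5 //.
by apply/eqP; have := adj p; rewrite mem_iota => /(_ ltp) /allP/(_ q); rewrite mem_iota => /(_ ltq).
Qed.

Lemma lam2_uniq x y z1 z2 z : e x y -> e x z1 -> e y z1 -> e x z2 -> e y z2 ->
  e x z -> e y z -> z1 != z -> z2 != z -> z1 = z2.
Proof.
move=> xy xz1 yz1 xz2 yz2 xz yz z1z z2z; have := lam2 xy.
rewrite (cardsD1 z) !inE xz yz add1n => -[] /eqP/cards1P[t eqt].
have : z1 \in (N x :&: N y) :\ z by rewrite !inE z1z xz1.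
have : z2 \in (N x :&: N y) :\ z by rewrite !inE z2z xz2.
by rewrite eqt !inE => /eqP-> /eqP->.
Qed.

Lemma pentagon_edges x a b c d f : is_pentagon x [:: a; b; c; d; f] ->
  [/\ [/\ e x a, e x b, e x c, e x d & e x f],
      [/\ e a b, e b c, e c d, e d f & e f a],
      [/\ ~~ e b d & ~~ e b f] & uniq [:: a; b; c; d; f]].
Proof.
move=> [_ U tN adj]; rewrite U; split=> //.
- by split; rewrite -(inN e) -tN !inE eqxx ?orbT.
- by split;
  [have /= -> := adj 0%N 1%N isT isT |
   have /= -> := adj 1%N 2%N isT isT |
   have /= -> := adj 2%N 3%N isT isT |
   have /= -> := adj 3%N 4%N isT isT |
   have /= -> := adj 4%N 0%N isT isT].
- by split;
  [have /= -> := adj 1%N 3%N isT isT |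
   have /= -> := adj 1%N 4%N isT isT].
Qed.

(** An edge has exactly two common neighbours. In this and the next two lemmas one of them is known,
    and the two names to be identified both denote the other one. *)
Lemma pentagon_step1 u v0 v1 v2 v4 w0 w1 f0 f1 :
    is_pentagon v0 [:: v4; u; v1; w0; f0] -> is_pentagon v1 [:: v0; u; v2; w1; f1] ->
  f1 = w0.
Proof.
move=> /pentagon_edges[[a1 a2 a3 a4 a5] [b1 b2 b3 b4 b5] _ U0].
move=> /pentagon_edges[[c1 c2 c3 c4 c5] [d1 d2 d3 d4 d5] _ U1].
move: U0 U1; rewrite /= !inE !negb_or.
move=> /and5P[_ /and3P[_ uw0 _] _ _ _] /and5P[_ /and3P[_ _ uf1] _ _ _].
by apply: (lam2_uniq (x := v0) (y := v1) (z := u)); rewrite // 1?eq_sym // sym_e.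
Qed.

Lemma pentagon_step2 u v vm vp vpp w wm wp :
    is_pentagon v [:: vm; u; vp; w; wm] -> is_pentagon vp [:: v; u; vpp; wp; w] ->
  exists z, is_pentagon w [:: wm; v; vp; wp; z].
Proof.
move=> /pentagon_edges[[a1 a2 a3 a4 a5] [b1 b2 b3 b4 b5] _ U0].
move=> /pentagon_edges[[c1 c2 c3 c4 c5] [d1 d2 d3 d4 d5] _ U1].
move: U0 U1; rewrite /= !inE !negb_or.
move=> /and5P[_ _ /andP[_ vpwm] _ _] /and5P[/and4P[_ _ vwp vw] _ _ _ _].
have [||||||d [z Pw]] := @pentagon_at w wm v vp; rewrite // 1?sym_e // 1?eq_sym //.
suff <- : d = wp by exists z.
move: (Pw) => /pentagon_edges[[f1 f2 f3 f4 f5] [g1 g2 g3 g4 g5] _].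
rewrite /= !inE !negb_or => /and5P[_ /and3P[_ vd _] _ _ _].
by apply: (lam2_uniq (x := w) (y := vp) (z := v)); rewrite // 1?eq_sym // sym_e.
Qed.

Lemma pentagon_step3 v vp vpp w wm wp wpp z z' :
    is_pentagon w [:: wm; v; vp; wp; z] -> is_pentagon wp [:: w; vp; vpp; wpp; z'] ->
  z' = z.
Proof.
move=> /pentagon_edges[[a1 a2 a3 a4 a5] [b1 b2 b3 b4 b5] _ U0].
move=> /pentagon_edges[[c1 c2 c3 c4 c5] [d1 d2 d3 d4 d5] _ U1].
move: U0 U1; rewrite /= !inE !negb_or.
move=> /and5P[_ _ /andP[_ vpz] _ _] /and5P[_ /and3P[_ _ vpz'] _ _ _].
by apply: (lam2_uniq (x := w) (y := wp) (z := vp)); rewrite // 1?eq_sym // sym_e.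
Qed.

Lemma lambda2_icosahedron u : graph_iso e icosahedron.
Proof.
have [a Na] : exists a, a \in N u by apply/set0Pn; rewrite -card_gt0 reg_e k5.
rewrite inN in Na; have /card_gt1P[b [c [Ib Ic bc]]] : 1 < #|N u :&: N a| by rewrite lam2.
move: Ib Ic; rewrite !inE => /andP[ub ab] /andP[uc ac].
have [||||||v3 [v4 Pu]] := @pentagon_at u b a c; rewrite // 1?sym_e //.
move: b a c Na ub uc ab ac bc Pu => v0 v1 v2 uv1 uv0 uv2 v10 v12 v02 Pu.
have [[_ _ _ uv3 uv4] [v01 _ v23 v34 v40] _ Uu] := pentagon_edges Pu.
have [||||||w0 [f0 P0]] := @pentagon_at v0 v4 u v1; rewrite // 1?sym_e //.
  by move: Uu; rewrite /= !inE !negb_or => /and5P[_ /and3P[_ _ ?] _ _ _]; rewrite eq_sym.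
have [||||||w1 [f1 P1]] := @pentagon_at v1 v0 u v2; rewrite // 1?sym_e //.
have [||||||w2 [f2 P2]] := @pentagon_at v2 v1 u v3; rewrite // 1?sym_e //.
  by move: Uu; rewrite /= !inE !negb_or => /and5P[_ /and3P[_ ? _] _ _ _].
have [||||||w3 [f3 P3]] := @pentagon_at v3 v2 u v4; rewrite // 1?sym_e //.
  by move: Uu; rewrite /= !inE !negb_or => /and5P[_ _ /andP[_ ?] _ _].
have [||||||w4 [f4 P4]] := @pentagon_at v4 v3 u v0; rewrite // 1?sym_e //.
  by move: Uu; rewrite /= !inE !negb_or => /and5P[/and4P[_ _ ? _] _ _ _ _]; rewrite eq_sym.
have e0 := pentagon_step1 P4 P0; have e1 := pentagon_step1 P0 P1.
have e2 := pentagon_step1 P1 P2; have e3 := pentagon_step1 P2 P3.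
have e4 := pentagon_step1 P3 P4; subst f0 f1 f2 f3 f4.
have [z Q0] := pentagon_step2 P0 P1; have [z1 Q1] := pentagon_step2 P1 P2.
have [z2 Q2] := pentagon_step2 P2 P3; have [z3 Q3] := pentagon_step2 P3 P4.
have [z4 Q4] := pentagon_step2 P4 P0.
have e1 := pentagon_step3 Q0 Q1; subst z1; have e2 := pentagon_step3 Q1 Q2; subst z2.
have e3 := pentagon_step3 Q2 Q3; subst z3; have e4 := pentagon_step3 Q3 Q4; subst z4.
have [[_ _ _ v0w0 v0w4] [_ _ _ w04 _] [nuw0 nuw4] U0] := pentagon_edges P0.
have [[_ _ _ v1w1 _] _ [nuw1 _] U1] := pentagon_edges P1.
have [_ _ [nuw2 _] U2] := pentagon_edges P2.
have [_ _ [nuw3 _] U3] := pentagon_edges P3.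
have [_ _ _ U4] := pentagon_edges P4.
have [[w0w4 _ _ w0w1 w0z] _ _ V0] := pentagon_edges Q0.
have [[_ _ _ w1w2 w1z] _ _ V1] := pentagon_edges Q1.
have [[_ _ _ w2w3 w2z] _ _ V2] := pentagon_edges Q2.
have [[_ _ _ w3w4 w3z] _ _ V3] := pentagon_edges Q3.
have [[_ _ _ _ w4z] _ _ V4] := pentagon_edges Q4.
(* [w4] comes before [w0] because in [ico_edges] the vertex 1, here [v0], is joined to 6 and 7. *)
pose L := [:: u; v0; v1; v2; v3; v4; w4; w0; w1; w2; w3; z].
have UL : uniq L.
  have uz : u != z by apply: contraNneq nuw0 => ->; rewrite sym_e.
  have eneq x y : e x y -> x != y by apply: contraTneq => ->; rewrite irr_e.
  have sep x y : e u x -> ~~ e u y -> x != y by move=> ux; apply: contraNneq => <-.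
  move: Uu U0 U1 U2 U3 U4 V0 V1 V2 V3 V4.
  rewrite /= !inE !negb_or !andbT.
  repeat match goal with |- is_true (_ && _) -> _ => case/andP end.
  intros; repeat match goal with H : is_true (_ && _) |- _ => case/andP: H; intros end.
  repeat (apply/andP; split);
  first [ done | by rewrite eq_sym | by apply: eneq | by apply: eneq; rewrite sym_e | by apply: sep ].
have Nz : [:: w4; w0; w1; w2; w3] =i N z.
  have Uw : uniq [:: w4; w0; w1; w2; w3].
    exact: (mask_uniq UL (nseq 6 false ++ nseq 5 true)).
  have sub : {subset [:: w4; w0; w1; w2; w3] <= enum (N z)}.
    by move=> x; rewrite mem_enum !inE sym_e => /or4P[/eqP->|/eqP->|/eqP->|/orP[]/eqP->].
  have [|_ eqN] := uniq_min_size Uw sub; first by rewrite -cardE reg_e k5.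
  by move=> x; rewrite eqN mem_enum.
have pentN x t : is_pentagon x t -> N x =i t by case=> _ _ tN _ y; rewrite tN.
apply: (icosahedron_of_list (L := L) (u := u)) => //.
move=> [|[|[|[|[|[|[|[|[|[|[|[|i]]]]]]]]]]]] // _ x.
- by rewrite /= (pentN _ _ Pu) !inE; do 5 case: (x == _).
- by rewrite /= (pentN _ _ P0) !inE; do 5 case: (x == _).
- by rewrite /= (pentN _ _ P1) !inE; do 5 case: (x == _).
- by rewrite /= (pentN _ _ P2) !inE; do 5 case: (x == _).
- by rewrite /= (pentN _ _ P3) !inE; do 5 case: (x == _).
- by rewrite /= (pentN _ _ P4) !inE; do 5 case: (x == _).
- by rewrite /= (pentN _ _ Q4) !inE; do 5 case: (x == _).
- by rewrite /= (pentN _ _ Q0) !inE; do 5 case: (x == _).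
- by rewrite /= (pentN _ _ Q1) !inE; do 5 case: (x == _).
- by rewrite /= (pentN _ _ Q2) !inE; do 5 case: (x == _).
- by rewrite /= (pentN _ _ Q3) !inE; do 5 case: (x == _).
- by rewrite /= -[LHS]Nz !inE; do 5 case: (x == _).
Qed.

End Lambda2.
End Icosahedron.

(** * Two common neighbours at distance 2 *)

Section Rectagraph.
Variables (T : finType) (e : rel T).
Implicit Types (u v w x y z a b c d : T) (g h : {perm T}).
Notation N := (nbhd e).
Notation N2 := (nbhd2 e).

(** For vertices described by indices over two base frames: if the two descriptions identify the
    same indices, matching them is a well-defined bijection. *)
Lemma aut_of_cover (I : Type) (V1 V2 : I -> T) :
    (forall i j, V1 i = V1 j <-> V2 i = V2 j) -> (forall x, exists i, V1 i = x) ->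
    (forall i j, e (V1 i) (V1 j) -> e (V2 i) (V2 j)) ->
  exists2 g, g \in Aut e & forall i, g (V1 i) = V2 i.
Proof.
move=> eqV surjV homoV; have [f fK] := fin_all_exists surjV.
have inj_f : injective (V2 \o f).
  by move=> x y /= /eqV; rewrite !fK.
exists (perm inj_f) => [|i]; last by rewrite permE /=; apply/eqV; rewrite fK.
by apply: aut_of_homo => x y xy; rewrite !permE /=; apply: homoV; rewrite !fK.
Qed.

Hypotheses (sym_e : symmetric e) (irr_e : irreflexive e) (conn_e : connected_graph e).
Variable k : nat.
Hypothesis reg_e : regular_of_valency e k.
Hypothesis tdt_e : two_distance_transitive e.
Hypothesis triangle_free : forall u v x, e u v -> e v x -> ~~ e u x.
Hypothesis mu2 : forall u w, w \in N2 u -> #|N u :&: N w| = 2%N.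

(** The far corner of the quadrangle on [a], [v], [b]. For distinct neighbours of [v] it exists and
    is unique, so the default is not reached. *)
Definition opp v a b := odflt v [pick w | [&& w != v, e a w & e b w]].

Lemma oppP v a b : e v a -> e v b -> a != b ->
  [/\ opp v a b != v, e a (opp v a b), e b (opp v a b), ~~ e v (opp v a b) &
      (forall x, e a x -> e b x -> x = v \/ x = opp v a b) /\
      (forall x, e v x -> e x (opp v a b) -> x = a \/ x = b)].
Proof.
move=> va vb ab; rewrite -!(inN e) in va vb.
have [w Nw [eqab eqvw]] := mu2_opp sym_e triangle_free mu2 va vb ab.
have [wv nvw _] := inN2 _ _ _ Nw; rewrite !inN in va vb.
have allab x : e a x -> e b x -> x = v \/ x = w.
  move=> ax bx; have : x \in N a :&: N b by rewrite !inE ax.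
  by rewrite eqab !inE => /orP[]/eqP; [left | right].
have [aw bw] : e a w /\ e b w.
  by have : w \in N a :&: N b by [rewrite eqab !inE eqxx orbT]; rewrite !inE => /andP.
have -> : opp v a b = w.
  rewrite /opp; case: pickP => [x /and3P[xv ax bx] /=|/(_ w)]; last by rewrite wv aw bw.
  by have [eqx|//] := allab x ax bx; rewrite eqx eqxx in xv.
split=> //; split=> // x vx xw.
have : x \in N v :&: N w by rewrite !inE vx sym_e.
by rewrite eqvw !inE => /orP[]/eqP; [left | right].
Qed.

Lemma opp_uniq v a b x : e v a -> e v b -> a != b -> e a x -> e b x -> x != v ->
  opp v a b = x.
Proof.
move=> va vb ab ax bx xv; have [_ _ _ _ [all _]] := oppP va vb ab.
by case: (all x ax bx) => // eqx; rewrite eqx eqxx in xv.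
Qed.

Lemma oppC v a b : opp v a b = opp v b a.
Proof.
rewrite /opp; congr odflt; apply: eq_pick => w /=.
by rewrite [e a w && _]andbC.
Qed.

Lemma opp_aut g v a b : g \in Aut e -> e v a -> e v b -> a != b ->
  g (opp v a b) = opp (g v) (g a) (g b).
Proof.
move=> Gg va vb ab; have [wv aw bw _ _] := oppP va vb ab.
by apply/esym/opp_uniq; rewrite ?(inj_eq perm_inj) ?aut_edge.
Qed.

Lemma opp_back v a b : e v a -> e v b -> a != b -> opp a v (opp v a b) = b.
Proof.
move=> va vb ab; have [wv aw bw _ _] := oppP va vb ab.
by apply: opp_uniq; rewrite // 1?sym_e // eq_sym.
Qed.

Lemma opp_inj v a b c : e v a -> e v b -> e v c -> a != b -> a != c ->
  opp v a b = opp v a c -> b = c.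
Proof. by move=> va vb vc ab ac eqo; rewrite -(opp_back va vb ab) eqo opp_back. Qed.

Section Moves.
Implicit Types (F : seq T) (s : T * seq T).

Definition frame s := [/\ size s.2 = k, uniq s.2 & s.2 =i N s.1].
Definition lbl s i := nth s.1 s.2 i.
(** Parallel transport across the edge labelled [i], as in a cube: label [i] points back, and label
    [j] goes to the far corner of the quadrangle on [i] and [j]. *)
Definition move i s : T * seq T :=
  (lbl s i, mkseq (fun j => if j == i then s.1 else opp s.1 (lbl s i) (lbl s j)) k).

Lemma frame_edge s i : frame s -> i < k -> e s.1 (lbl s i).
Proof. by case=> sz _ sN lti; rewrite -(inN e) -sN mem_nth ?sz. Qed.

Lemma frame_neq s i j : frame s -> i < k -> j < k -> (lbl s i == lbl s j) = (i == j).
Proof. by case=> sz U _ lti ltj; rewrite /lbl nth_uniq ?sz. Qed.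

Lemma frame_idx s x : frame s -> e s.1 x -> exists2 i, i < k & x = lbl s i.
Proof.
case=> sz U sN; rewrite -(inN e) -sN => sx; exists (index x s.2).
  by rewrite -sz index_mem.
by rewrite /lbl nth_index.
Qed.

Lemma frame_of_inj v F : size F = k -> uniq F -> {subset F <= N v} -> frame (v, F).
Proof.
move=> sz U sub; split=> //= x; have sub' : {subset F <= enum (N v)}.
  by move=> y /sub; rewrite mem_enum.
have [|_ eqF] := uniq_min_size U sub'; first by rewrite -cardE reg_e sz.
by rewrite eqF mem_enum.
Qed.

Lemma frame_eq s t : frame s -> frame t -> s.1 = t.1 ->
  (forall i, i < k -> lbl s i = lbl t i) -> s = t.
Proof.
case: s t => v F [v' F'] [/= sz _ _] [/= sz' _ _] eqv; rewrite -eqv => eql; congr pair.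
by apply: (@eq_from_nth _ v); rewrite sz ?sz' // => i lti; rewrite (eql i lti) /lbl /= -eqv.
Qed.

Lemma lbl_move i j s : j < k ->
  lbl (move i s) j = if j == i then s.1 else opp s.1 (lbl s i) (lbl s j).
Proof. by move=> ltj; rewrite /lbl /= nth_mkseq. Qed.

Lemma frame_move i s : i < k -> frame s -> frame (move i s).
Proof.
move=> lti Fs; apply: frame_of_inj; first by rewrite size_mkseq.
  apply/(mkseq_uniqP _ k) => j l; rewrite !inE => ltj ltl.
  have nei m : m < k -> m != i -> opp s.1 (lbl s i) (lbl s m) != s.1.
    move=> ltm mi; have [] := @oppP s.1 (lbl s i) (lbl s m); rewrite ?frame_edge //.
    by rewrite frame_neq // eq_sym.
  have [->|ji] := eqVneq j i; have [->|li] := eqVneq l i => //.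
  - by move=> /eqP; rewrite eq_sym (negPf (nei l ltl li)).
  - by move=> /eqP; rewrite (negPf (nei j ltj ji)).
  move=> /opp_inj eqo; apply/eqP; rewrite -(frame_neq Fs) //; apply/eqP; apply: eqo;
    by rewrite ?frame_edge // frame_neq // eq_sym.
move=> _ /mapP[j + ->]; rewrite mem_iota => /= ltj; rewrite inN.
case: eqVneq => [_|ji]; first by rewrite sym_e frame_edge.
have [] := @oppP s.1 (lbl s i) (lbl s j); rewrite ?frame_edge //.
by rewrite frame_neq // eq_sym.
Qed.

Lemma moveK i s : i < k -> frame s -> move i (move i s) = s.
Proof.
move=> lti Fs; have Fm := frame_move lti Fs; have Fmm := frame_move lti Fm.
have eq1 : (move i (move i s)).1 = s.1 by rewrite /= lbl_move ?eqxx.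
apply: (frame_eq Fmm Fs eq1) => j ltj; rewrite lbl_move // lbl_move // eqxx.
case: (eqVneq j i) => [->//|ji]; rewrite lbl_move // (negPf ji).
have ne : lbl s i != lbl s j by rewrite frame_neq // eq_sym.
have [wv aw bw _ _] := oppP (frame_edge Fs lti) (frame_edge Fs ltj) ne.
by rewrite /= opp_back ?frame_edge.
Qed.

Definition cube_closed := forall v a b c, e v a -> e v b -> e v c ->
  a != b -> b != c -> a != c ->
  opp a (opp v a b) (opp v a c) = opp b (opp v a b) (opp v b c).

Hypothesis cube_e : cube_closed.

(** For a third label [l] the two sides name the last corner of the cube on [i], [j], [l], reached
    through two different faces; this is where [cube_closed] enters. *)
Lemma moveC i j s : i < k -> j < k -> frame s -> move i (move j s) = move j (move i s).
Proof.
move=> lti ltj Fs; have [->//|ij] := eqVneq i j; have ji : j != i by rewrite eq_sym.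
have [Fi Fj] := (frame_move lti Fs, frame_move ltj Fs).
have eq1 : (move i (move j s)).1 = (move j (move i s)).1.
  by rewrite /= !lbl_move // (negPf ij) (negPf ji) oppC.
apply: (frame_eq _ _ eq1); try exact: frame_move.
move=> l ltl; rewrite [LHS]lbl_move // [RHS]lbl_move //= !lbl_move //.
rewrite (negPf ij) (negPf ji).
have eij : lbl s i != lbl s j by rewrite frame_neq.
have eji : lbl s j != lbl s i by rewrite eq_sym.
have [->|li] := eqVneq l i; first by rewrite (negPf ij) oppC opp_back ?frame_edge.
have [_|lj] := eqVneq l j; first by rewrite oppC opp_back ?frame_edge.
rewrite cube_e ?frame_edge ?frame_neq // 1?eq_sym //.
by rewrite (oppC s.1 (lbl s j)).
Qed.

(** A predicate on labels is a vector of F_2^k. Since moves commute and are involutions, walking is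
    an action of F_2^k on frames, and its closed walks form the code of the overview. *)
Definition walk (b : pred nat) s := foldl (fun t i => if b i then move i t else t) s (iota 0 k).

Lemma frame_foldl (b : pred nat) l s : {subset l <= gtn k} -> frame s ->
  frame (foldl (fun t i => if b i then move i t else t) s l).
Proof.
elim: l s => [|i l IH] s //= sub Fs; apply: IH => [j jl|]; first by apply: sub; rewrite inE jl orbT.
by case: ifP => // _; apply: frame_move Fs; exact: sub (mem_head _ _).
Qed.

Lemma iota_lt : {subset iota 0 k <= gtn k}.
Proof. by move=> i; rewrite mem_iota. Qed.

Lemma frame_walk (b : pred nat) s : frame s -> frame (walk b s).
Proof. exact: frame_foldl iota_lt. Qed.

Lemma foldl_move (b : pred nat) i l s : i < k -> {subset l <= gtn k} -> frame s ->
  move i (foldl (fun t j => if b j then move j t else t) s l) =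
  foldl (fun t j => if b j then move j t else t) (move i s) l.
Proof.
move=> lti; elim: l s => [|j l IH] s //= sub Fs.
have ltj : j < k by apply: sub (mem_head _ _).
rewrite IH; [|by move=> m ml; apply: sub; rewrite inE ml orbT|by case: ifP => // _; apply: frame_move].
by case: ifP => // _; rewrite moveC.
Qed.

Lemma eq_foldl_move (b c : pred nat) l s : {in l, b =1 c} ->
  foldl (fun t i => if b i then move i t else t) s l =
  foldl (fun t i => if c i then move i t else t) s l.
Proof.
elim: l s => //= i l IH s bc; rewrite bc ?mem_head // IH // => j jl.
by rewrite bc // inE jl orbT.
Qed.

Lemma eq_walk (b c : pred nat) s : (forall i, i < k -> b i = c i) -> walk b s = walk c s.
Proof. by move=> bc; apply: eq_foldl_move => i; rewrite mem_iota => /bc. Qed.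

Lemma walk0 s : walk pred0 s = s.
Proof. by rewrite /walk; elim: (iota 0 k). Qed.

Lemma move_walk i (b : pred nat) s : i < k -> frame s ->
  move i (walk b s) = walk (fun j => b j (+) (j == i)) s.
Proof.
move=> lti Fs; rewrite /walk; have il : i \in iota 0 k by rewrite mem_iota.
have := iota_uniq 0 k; have := iota_lt; case/splitPr: il => l1 l2 sub.
have sub1 : {subset l1 <= gtn k} by move=> j j1; apply: sub; rewrite mem_cat j1.
have sub2 : {subset l2 <= gtn k} by move=> j j2; apply: sub; rewrite mem_cat inE j2 !orbT.
rewrite cat_uniq /= negb_or => /and3P[_ /andP[ni1 _] /andP[ni2 _]].
have notin (l : seq nat) : i \notin l -> {in l, b =1 (fun j => b j (+) (j == i))}.
  by by move=> nil j jl; case: eqVneq => [eqj|]; rewrite ?addbF //; rewrite -eqj jl in nil.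
rewrite !foldl_cat /= -(eq_foldl_move _ (notin l1 ni1)) -(eq_foldl_move _ (notin l2 ni2)) eqxx addbT.
have F1 := frame_foldl b sub1 Fs.
rewrite foldl_move //; last by case: ifP => // _; apply: frame_move.
by case: ifP => //= _; rewrite moveK.
Qed.

Lemma walk_walk (b c : pred nat) s : frame s -> walk b (walk c s) = walk (fun i => c i (+) b i) s.
Proof.
move=> Fs; rewrite {1}/walk.
have gen l : uniq l -> {subset l <= gtn k} ->
    foldl (fun t i => if b i then move i t else t) (walk c s) l =
    walk (fun i => c i (+) (b i && (i \in l))) s.
  elim/last_ind: l => [|l i IH] /=.
    by move=> _ _; apply: eq_walk => i _; rewrite andbF addbF.
  rewrite rcons_uniq => /andP[nil Ul] sub.
  have lti : i < k by apply: sub; rewrite mem_rcons mem_head.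
  rewrite foldl_rcons IH // => [|j jl]; last by apply: sub; rewrite mem_rcons inE jl orbT.
  case: ifP => bi; last first.
    by apply: eq_walk => j _; rewrite mem_rcons inE; case: eqVneq => //= ->; rewrite bi.
  rewrite move_walk //; apply: eq_walk => j _; rewrite mem_rcons inE.
  by case: eqVneq => [->|_] /=; rewrite ?bi ?(negPf nil) /= ?addbF ?addbT.
rewrite gen ?iota_uniq //; last exact: iota_lt.
by apply: eq_walk => i lti; rewrite mem_iota /= add0n lti andbT.
Qed.

Lemma walk_surj s x : frame s -> exists b : pred nat, (walk b s).1 = x.
Proof.
move=> Fs; move: x; apply: (conn_ind conn_e (x := s.1)) => [|x y [b <-] xy].
  by exists pred0; rewrite walk0.
have [i lti ->] := frame_idx (frame_walk b Fs) xy.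
by exists (fun j => b j (+) (j == i)); rewrite -move_walk.
Qed.

(** Words instead of vectors: a relabelling does not respect the increasing order in which [walk]
    applies its moves. *)
Definition steps l s := foldl (fun t i => move i t) s l.

Lemma walk_steps (b : pred nat) s : walk b s = steps (filter b (iota 0 k)) s.
Proof. by rewrite /walk; elim: (iota 0 k) s => //= i l IH s; rewrite IH; case: ifP. Qed.

Lemma steps_walk l s : {subset l <= gtn k} -> frame s ->
  steps l s = walk (fun i => odd (count_mem i l)) s.
Proof.
move=> sub Fs; elim/last_ind: l sub => [|l i IH] sub.
  by rewrite (@eq_walk _ pred0) ?walk0.
rewrite /steps foldl_rcons -/(steps l s) IH => [|j jl]; last by apply: sub; rewrite mem_rcons inE jl orbT.
rewrite move_walk //; last by apply: sub; rewrite mem_rcons mem_head.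
apply: eq_walk => j _; rewrite -cats1 count_cat oddD /= addn0 eq_sym.
by case: eqP.
Qed.

Lemma steps_relabel (p : nat -> nat) l s t : {subset l <= gtn k} ->
    (forall i, i < k -> p i < k) ->
    (forall i j, i < k -> j < k -> (p i == p j) = (i == j)) ->
    t.1 = s.1 -> (forall i, i < k -> lbl t i = lbl s (p i)) ->
  (steps l t).1 = (steps (map p l) s).1.
Proof.
move=> sub ltp pE; elim: l s t sub => [|i l IH] s t sub // eq1 eql.
have lti : i < k := sub i (mem_head _ _).
rewrite -[LHS]/(steps l (move i t)).1 -[RHS]/(steps (map p l) (move (p i) s)).1.
apply: IH => [j jl||j ltj]; first by apply: sub; rewrite inE jl orbT.
  by rewrite /= eql.
by rewrite !lbl_move ?ltp // pE // eq1 !eql.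
Qed.

Definition act_frame g s : T * seq T := (g s.1, map g s.2).

Lemma lbl_act g s i : i < k -> frame s -> lbl (act_frame g s) i = g (lbl s i).
Proof. by move=> lti [sz _ _]; rewrite /lbl (nth_map s.1) ?sz. Qed.

Lemma frame_act g s : g \in Aut e -> frame s -> frame (act_frame g s).
Proof.
move=> Gg [sz U sN]; split=> /=; first by rewrite size_map.
  by rewrite map_inj_uniq //; apply: perm_inj.
move=> x; rewrite -(permKV g x) mem_map; last exact: perm_inj.
by rewrite sN aut_nbhd.
Qed.

Lemma move_act g i s : g \in Aut e -> i < k -> frame s ->
  move i (act_frame g s) = act_frame g (move i s).
Proof.
move=> Gg lti Fs; have Fgs := frame_act Gg Fs; have Fm := frame_move lti Fs.
apply: frame_eq; [exact: frame_move | exact: frame_act | by rewrite /= lbl_act|].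
move=> j ltj; rewrite lbl_move // !lbl_act // lbl_move //.
case: eqVneq => // ji; rewrite opp_aut ?frame_edge // frame_neq //.
by rewrite eq_sym.
Qed.

Lemma steps_act g l s : g \in Aut e -> {subset l <= gtn k} -> frame s ->
  steps l (act_frame g s) = act_frame g (steps l s).
Proof.
move=> Gg; elim: l s => // i l IH s sub Fs; have lti : i < k := sub i (mem_head _ _).
rewrite -[LHS]/(steps l (move i (act_frame g s))) -[steps (i :: l) s]/(steps l (move i s)).
rewrite move_act // IH //; last exact: frame_move.
by move=> j jl; apply: sub; rewrite inE jl orbT.
Qed.

Lemma frame_relabel s t : frame s -> frame t -> t.1 = s.1 ->
  exists p : nat -> nat, [/\ forall i, i < k -> p i < k,
     forall i j, i < k -> j < k -> (p i == p j) = (i == j) &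
     forall i, i < k -> lbl t i = lbl s (p i)].
Proof.
move=> Fs Ft eq1; pose p i := index (lbl t i) s.2.
have tin i : i < k -> lbl t i \in s.2.
  by move=> lti; have [_ _ ->] := Fs; rewrite inN -eq1 frame_edge.
have pE i : i < k -> lbl t i = lbl s (p i) by move=> lti; rewrite /lbl nth_index ?tin.
have ltp i : i < k -> p i < k.
  by move=> lti; have [<- _ _] := Fs; rewrite index_mem tin.
exists p; split=> // i j lti ltj.
by rewrite -(frame_neq Fs) ?ltp // -!pE // frame_neq.
Qed.

(** An automorphism permutes the coordinates of walks; in particular it acts in this way on closed
    walks. *)
Lemma walk_transport g (b : pred nat) s t : g \in Aut e -> frame s -> frame t -> t.1 = g s.1 ->
  exists p : nat -> nat, [/\ forall i, i < k -> p i < k,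
     forall i j, i < k -> j < k -> (p i == p j) = (i == j),
     forall i, i < k -> g (lbl s i) = lbl t (p i) &
     g (walk b s).1 = (walk (fun j => j \in map p (filter b (iota 0 k))) t).1].
Proof.
move=> Gg Fs Ft eq1; have Fgs := frame_act Gg Fs.
have [p [ltp pE pl]] := frame_relabel Ft Fgs (esym eq1).
exists p; split=> // [i lti|]; first by rewrite -pl // lbl_act.
have subf : {subset [seq x <- iota 0 k | b x] <= gtn k}.
  by move=> j; rewrite mem_filter => /andP[_ /iota_lt].
have -> : g (walk b s).1 = (steps (filter b (iota 0 k)) (act_frame g s)).1.
  by rewrite steps_act // walk_steps.
rewrite (steps_relabel (s := t) (p := p)) //.
have subm : {subset [seq p i | i <- filter b (iota 0 k)] <= gtn k}.
  by move=> _ /mapP[j /subf ltj ->]; apply: ltp.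
rewrite steps_walk //; congr (_.1); apply: eq_walk => i lti.
rewrite count_uniq_mem ?oddb //.
rewrite map_inj_in_uniq ?filter_uniq ?iota_uniq // => x y /subf ltx /subf lty /eqP.
by rewrite pE // => /eqP.
Qed.

(** Weights 1, 2 and 3 would give a loop, a degenerate quadrangle or an edge to a far corner. For
    weight 4, the third vertex would be adjacent to both ends of a diagonal, hence be one of the two
    corners already used. *)
Lemma walk_closed_weight (b : pred nat) s : frame s -> (walk b s).1 = s.1 ->
  count b (iota 0 k) = 0%N \/ 4 < count b (iota 0 k).
Proof.
move=> Fs; rewrite walk_steps -size_filter.
have : uniq (filter b (iota 0 k)) by rewrite filter_uniq ?iota_uniq.
have : {subset filter b (iota 0 k) <= gtn k}.
  by move=> j; rewrite mem_filter => /andP[_ /iota_lt].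
case: (filter b (iota 0 k)) => [|i l]; [by left | move=> sub U closed; right].
have lti : i < k by apply: sub; rewrite mem_head.
case: l sub U closed => [|j l] sub U closed.
  by have := frame_edge Fs lti; rewrite [lbl s i]closed irr_e.
have ltj : j < k by apply: sub; rewrite !inE eqxx orbT.
have ij : i != j by move: U; rewrite /= inE negb_or -!andbA => /andP[].
have ji : j != i by rewrite eq_sym.
have Fi := frame_move lti Fs; have Fij := frame_move ltj Fi.
have ne : lbl s i != lbl s j by rewrite frame_neq.
have [wv iw jw nvw [_ all2]] := oppP (frame_edge Fs lti) (frame_edge Fs ltj) ne.
have eqw : (move j (move i s)).1 = opp s.1 (lbl s i) (lbl s j).
  by rewrite /= lbl_move // (negPf ji).
case: l sub U closed => [|m l] sub U closed.
  by move: wv; rewrite -eqw closed eqxx.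
have ltm : m < k by apply: sub; rewrite !inE eqxx !orbT.
case: l sub U closed => [|n l] sub U closed.
  have := frame_edge Fij ltm; rewrite eqw sym_e.
  by rewrite [lbl _ m]closed (negPf nvw).
have ltn : n < k by apply: sub; rewrite !inE eqxx !orbT.
case: l sub U closed => [|? ?] sub U closed //.
have Fm := frame_move ltm Fij.
have [mi mj] : m != i /\ m != j.
  by move: U; rewrite /= !inE !negb_or -!andbA => /and5P[_ im _ jm _]; rewrite ![m == _]eq_sym.
have xv : e s.1 (lbl (move j (move i s)) m).
  have := frame_edge Fm ltn; have -> : lbl (move m (move j (move i s))) n = s.1 := closed.
  by rewrite sym_e.
have xw : e (lbl (move j (move i s)) m) (opp s.1 (lbl s i) (lbl s j)).
  by rewrite -eqw sym_e frame_edge.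
have li : lbl (move j (move i s)) i = lbl s j.
  rewrite lbl_move // (negPf ij) /= !lbl_move // eqxx (negPf ji) oppC.
  by rewrite opp_back ?frame_edge.
have lj : lbl (move j (move i s)) j = lbl s i by rewrite lbl_move // eqxx.
case: (all2 _ xv xw) => /eqP.
  by rewrite -lj frame_neq // (negPf mj).
by rewrite -li frame_neq // (negPf mi).
Qed.

Hypothesis k7 : k = 7%N.

Lemma walk_closed_const (b : pred nat) s : frame s -> (walk b s).1 = s.1 ->
  forall i j, i < k -> j < k -> b i = b j.
Proof.
move=> Fs closed i j lti ltj.
have [Ni Nj] : lbl s i \in N s.1 /\ lbl s j \in N s.1 by rewrite !inN !frame_edge.
have [g Gg [gs gi]] := aut_nbr tdt_e Ni Nj.
have [p [ltp pE pl trp]] := walk_transport b Gg Fs Fs (esym gs).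
pose b' j := j \in map p (filter b (iota 0 k)).
have closed' : (walk b' s).1 = s.1 by rewrite -[LHS]trp closed gs.
have b'p m : m < k -> b' (p m) = b m.
  move=> ltm; rewrite /b'; apply/mapP/idP=> [[n]|bm]; last by exists m; rewrite // mem_filter bm mem_iota.
  rewrite mem_filter mem_iota add0n => /and3P[bn _ ltn] /eqP.
  by rewrite pE // => /eqP->.
have pi : p i = j by apply/eqP; rewrite -(frame_neq Fs) ?ltp // -pl // gi.
have cb' : count b' (iota 0 k) = count b (iota 0 k).
  have pe : perm_eq (map p (iota 0 k)) (iota 0 k).
    apply: uniq_perm; rewrite ?iota_uniq //.
      rewrite map_inj_in_uniq ?iota_uniq // => x y; rewrite !mem_iota => ltx lty /eqP.
      by rewrite pE // => /eqP.
    have sub : {subset map p (iota 0 k) <= iota 0 k}.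
      by move=> _ /mapP[x + ->]; rewrite !mem_iota; apply: ltp.
    have U : uniq (map p (iota 0 k)).
      rewrite map_inj_in_uniq ?iota_uniq // => x y; rewrite !mem_iota => ltx lty /eqP.
      by rewrite pE // => /eqP.
    by have [|_ eqi] := uniq_min_size U sub; rewrite ?size_map.
  rewrite -(seq.permP pe) count_map; apply: eq_in_count => m; rewrite mem_iota /=.
  exact: b'p.
pose c m := b m (+) b' m.
have Fb := frame_walk b Fs.
have closedc : (walk c (walk b s)).1 = (walk b s).1.
  rewrite walk_walk // closed -[RHS]closed'; congr (_.1); apply: eq_walk => m _.
  by rewrite /c addKb.
have cc := walk_closed_weight Fb closedc.
case: (walk_closed_weight Fs closed) => [b0|b5].
  have none m : m < k -> b m = false.
    move=> ltm; apply/negbTE/negP=> bm; have : has b (iota 0 k).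
      by apply/hasP; exists m; rewrite // mem_iota.
    by rewrite has_count b0.
  by rewrite !none.
(* Both supports have at least 5 of the 7 coordinates, so the sum is supported on the two
   complements, of size at most 2 each. A closed walk of weight at most 4 is zero, so [b] agrees
   with its image under a permutation taking [i] to [j]. *)
have c4 : count c (iota 0 k) <= 4.
  have := count_predC b (iota 0 k); have := count_predC b' (iota 0 k).
  have : count c (iota 0 k) <= count (predC b) (iota 0 k) + count (predC b') (iota 0 k).
    rewrite -count_predUI; apply: leq_trans (leq_addr _ _); apply: sub_count => m /=.
    by rewrite /c; case: (b m); case: (b' m).
  rewrite cb' size_iota k7 in b5 *; move: b5.
  move: (count b _) (count c _) (count (predC b) _) (count (predC b') _); clear; lia.
case: cc => [c0|]; last by rewrite ltnNge c4.
have : c j = false.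
  apply/negbTE/negP=> cj; have : has c (iota 0 k).
    by apply/hasP; exists j; rewrite // mem_iota.
  by rewrite has_count c0.
by rewrite /c -{2}pi b'p // addbC => /eqP; case: (b i); case: (b j).
Qed.

Lemma walkT_closed s t : frame s -> frame t ->
  (walk predT s).1 = s.1 -> (walk predT t).1 = t.1.
Proof.
move=> Fs Ft closed; have [g Gg gs] := aut_vt tdt_e s.1 t.1.
have [p [ltp pE pl]] := walk_transport predT Gg Fs Ft (esym gs).
rewrite closed gs => ->; congr (_.1); apply: eq_walk => m ltm; apply/esym.
rewrite filter_predT; have sub : {subset map p (iota 0 k) <= iota 0 k}.
  by move=> _ /mapP[x + ->]; rewrite !mem_iota; apply: ltp.
have U : uniq (map p (iota 0 k)).
  rewrite map_inj_in_uniq ?iota_uniq // => x y; rewrite !mem_iota => ltx lty /eqP.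
  by rewrite pE // => /eqP.
have [|_ ->] := uniq_min_size U sub; rewrite ?size_map //.
by rewrite mem_iota ltm.
Qed.

(** The code is trivial or the repetition code, so the graph is the 7-cube or the folded 7-cube. The
    right-hand side does not mention [s], so the identifications are the same over every base
    frame. *)
Lemma walk_eqP (b c : pred nat) s : frame s ->
  (walk b s).1 = (walk c s).1 <->
  (forall i, i < k -> b i = c i) \/
  (forall i, i < k -> b i = ~~ c i) /\ (forall t, frame t -> (walk predT t).1 = t.1).
Proof.
move=> Fs; have Fb := frame_walk b Fs.
have eqd : walk (fun i => b i (+) c i) (walk b s) = walk c s.
  by rewrite walk_walk //; apply: eq_walk => i _; rewrite addKb.
split=> [eqbc|[eqbc|[eqbc allT]]]; last first.
- rewrite -eqd [in RHS](@eq_walk _ predT) ?allT // => i lti.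
  by rewrite eqbc //; case: (c i).
- by congr (_.1); apply: eq_walk.
have closed : (walk (fun i => b i (+) c i) (walk b s)).1 = (walk b s).1 by rewrite eqd.
have const := walk_closed_const Fb closed; have k0 : 0 < k by rewrite k7.
case d0: (b 0%N (+) c 0%N); last first.
  left=> i lti; have := const i 0%N lti k0; rewrite d0.
  by case: (b i); case: (c i).
have dT i : i < k -> b i (+) c i = true by move=> lti; rewrite (const i 0%N).
right; split=> [i lti|t Ft].
  by have := dT i lti; case: (b i); case: (c i).
by apply: (walkT_closed Fb Ft); rewrite -[RHS]closed; congr (_.1); apply/esym/eq_walk.
Qed.

Lemma cube_extend s t : frame s -> frame t ->
  exists2 g, g \in Aut e & g s.1 = t.1 /\ forall i, i < k -> g (lbl s i) = lbl t i.
Proof.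
move=> Fs Ft.
have [|||g Gg gV] := @aut_of_cover (pred nat) (fun p => (walk p s).1) (fun p => (walk p t).1).
- by move=> p q /=; split; [move/(walk_eqP p q Fs)/(walk_eqP p q Ft) | move/(walk_eqP p q Ft)/(walk_eqP p q Fs)].
- by move=> x; apply: walk_surj.
- move=> p q /= pq; have [i lti eqi] := frame_idx (frame_walk p Fs) pq.
  have : (walk q s).1 = (walk (fun j => p j (+) (j == i)) s).1 by rewrite eqi -move_walk.
  move/(walk_eqP q _ Fs)/(walk_eqP q _ Ft) => ->; rewrite -move_walk //=.
  exact: frame_edge (frame_walk p Ft) lti.
exists g => //; split; first by have := gV pred0; rewrite /= !walk0.
move=> i lti; pose q j := pred0 j (+) (j == i).
have := gV q : g (walk q s).1 = (walk q t).1.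
by rewrite -!move_walk // !walk0.
Qed.

End Moves.
End Rectagraph.

(** * The coset table with 48 rows *)

Section Table48.
Local Open Scope nat_scope.

(* A coset enumeration: coset [c] of 48 and label [i] of 7 are coded by the state
   [7 * c + i], a coset being the frame reached by the word [word48 c] in
   [fun i => hop (turn i _)]; [k48] is the action of [hop] on the states. *)
Definition k48 : seq nat :=
  [::
   7; 14; 21; 28; 35; 42; 49; 0; 56; 63; 70; 77; 84; 91; 1; 98; 105; 112; 119; 126; 62;
   2; 133; 140; 82; 147; 154; 104; 3; 161; 88; 124; 168; 175; 139; 4; 182; 130; 152; 189;
   66; 167; 5; 196; 158; 173; 72; 108; 188; 6; 92; 179; 194; 114; 143; 202; 8; 203; 210;
   217; 224; 231; 20; 9; 238; 245; 40; 252; 259; 209; 10; 266; 46; 229; 273; 280; 244;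
   11; 287; 235; 257; 294; 24; 272; 12; 301; 263; 278; 30; 213; 293; 13; 50; 284; 299;
   219; 248; 307; 15; 254; 308; 222; 243; 281; 27; 16; 291; 228; 47; 315; 265; 253; 17;
   269; 53; 241; 304; 206; 290; 18; 298; 285; 320; 212; 31; 268; 19; 232; 262; 302; 37;
   311; 297; 22; 317; 247; 220; 289; 207; 34; 23; 295; 240; 54; 277; 264; 316; 25; 216;
   204; 275; 310; 38; 271; 26; 282; 261; 233; 44; 250; 215; 29; 279; 230; 218; 300; 258;
   41; 32; 314; 255; 306; 249; 45; 267; 33; 208; 260; 283; 51; 226; 313; 36; 303; 242;
   223; 211; 321; 48; 39; 246; 318; 237; 225; 52; 270; 43; 234; 288; 221; 309; 276; 55;
   57; 149; 322; 117; 138; 176; 69; 58; 186; 123; 89; 329; 160; 148; 59; 164; 95; 136;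
   199; 101; 185; 60; 193; 180; 334; 107; 73; 163; 61; 127; 157; 197; 79; 325; 192; 64;
   331; 142; 115; 184; 102; 76; 65; 190; 135; 96; 172; 159; 330; 67; 111; 99; 170; 324;
   80; 166; 68; 177; 156; 128; 86; 145; 110; 71; 174; 125; 113; 195; 153; 83; 74; 328;
   150; 201; 144; 87; 162; 75; 103; 155; 178; 93; 121; 327; 78; 198; 137; 118; 106; 335;
   90; 81; 141; 332; 132; 120; 94; 165; 85; 129; 183; 116; 323; 171; 97; 100; 200; 151;
   131; 333; 181; 169; 109; 146; 134; 191; 326; 122; 187; 205; 305; 256; 236; 319; 286;
   274; 214; 251; 239; 296; 312; 227; 292]%N.

Definition words48 : seq (seq nat) :=
  [::
   [::]; [:: 0]; [:: 1]; [:: 2]; [:: 3]; [:: 4]; [:: 5]; [:: 6]; [:: 0; 1]; [:: 0; 2];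
   [:: 0; 3]; [:: 0; 4]; [:: 0; 5]; [:: 0; 6]; [:: 1; 1]; [:: 1; 2]; [:: 1; 3];
   [:: 1; 4]; [:: 1; 5]; [:: 2; 1]; [:: 2; 2]; [:: 2; 4]; [:: 2; 5]; [:: 3; 1];
   [:: 3; 4]; [:: 3; 5]; [:: 4; 1]; [:: 4; 4]; [:: 5; 1]; [:: 0; 1; 1]; [:: 0; 1; 2];
   [:: 0; 1; 3]; [:: 0; 1; 4]; [:: 0; 1; 5]; [:: 0; 2; 1]; [:: 0; 2; 2]; [:: 0; 2; 4];
   [:: 0; 2; 5]; [:: 0; 3; 1]; [:: 0; 3; 4]; [:: 0; 3; 5]; [:: 0; 4; 1]; [:: 0; 4; 4];
   [:: 0; 5; 1]; [:: 1; 1; 2]; [:: 1; 2; 4]; [:: 0; 1; 1; 2]; [:: 0; 1; 2; 4]]%N.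

Definition cmds48 : seq (nat * nat) :=
  [::
   (0, 1); (0, 2); (0, 3); (0, 4); (0, 5); (0, 6); (1, 1); (1, 2); (1, 3); (1, 4);
   (1, 5); (2, 1); (2, 2); (2, 3); (2, 4); (3, 1); (3, 2); (3, 3); (4, 1); (4, 2);
   (5, 1); (8, 1); (8, 2); (8, 3); (8, 4); (8, 5); (9, 1); (9, 2); (9, 3); (9, 4);
   (10, 1); (10, 2); (10, 3); (11, 1); (11, 2); (12, 1); (15, 4); (16, 2); (20, 2);
   (20, 3); (20, 4); (20, 5); (20, 6); (24, 1); (24, 2); (24, 3); (24, 5); (24, 6);
   (27, 2); (27, 5); (30, 2); (30, 3); (30, 6); (31, 3); (34, 2); (37, 2); (38, 1);
   (40, 1); (40, 3); (40, 4); (40, 5); (40, 6); (41, 2); (41, 4); (44, 6); (45, 3);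
   (46, 4); (46, 5); (46, 6); (47, 1); (48, 2); (50, 1); (50, 3); (51, 3); (52, 1);
   (53, 5); (55, 6); (57, 1); (57, 3); (57, 4); (58, 2); (59, 1); (59, 5); (59, 6);
   (61, 4); (61, 6); (67, 4); (68, 3); (69, 2); (69, 3); (69, 5); (73, 3); (76, 6);
   (79, 2); (79, 6); (80, 1); (83, 2); (83, 4); (86, 6); (89, 1); (89, 4); (93, 3);
   (97, 6); (98, 1); (98, 5); (99, 1); (99, 4); (101, 6); (102, 5); (103, 4); (107, 2);
   (111, 5); (112, 1); (112, 6); (117, 6); (126, 2); (126, 6); (131, 1); (133, 1);
   (137, 5); (146, 5)]%N.

(** Inversion in Z/7, with 0 sent to 0. *)
Definition inv7 x := nth 0%N [:: 0; 1; 4; 5; 2; 3; 6]%N x.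

Definition kappa s := nth 0%N k48 s.
Definition shift s x := s %/ 7 * 7 + (s %% 7 + x) %% 7.

Definition word48 c := nth [::] words48 c.
(** The state from which the word of [c] makes its last hop: the edge to the parent of [c] in a
    spanning tree of the cosets. *)
Definition tree48 c := let w := word48 c in index (take (size w).-1 w) words48 * 7 + last 0%N w.

Lemma tree48_check : all (fun c => let w := word48 c in
    [&& w == rcons (word48 (tree48 c %/ 7)) (tree48 c %% 7), kappa (tree48 c) == c * 7 &
        kappa (c * 7) == tree48 c])
  (iota 1 47).
Proof. by vm_compute. Qed.

(* Each pair [(p, x)] applies the relation [hop_turn_hop] to the state [p], which
   determines the image under [hop] of one further state [t]. *)
Fixpoint derive known cmds :=
  if cmds is (p, x) :: cmds' then
    let p1 := shift (kappa p) (inv7 x) in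
    let q := shift p x in
    let t := shift (kappa q) (7 - inv7 x) in
    derive (if [&& 0 < x < 7, p \in known, p1 \in known, q \in known,
                kappa p1 == shift (kappa t) x & kappa (kappa t) == t]
            then [:: t, kappa t & known] else known) cmds'
  else known.

Definition known48 :=
  derive (map tree48 (iota 1 47) ++ map (fun c => kappa (tree48 c)) (iota 1 47)) cmds48.

Lemma known48_check : all (fun s =>
  (s \in known48) && (kappa (kappa s) == s) && (kappa s %/ 7 < 48)) (iota 0 (48 * 7)).
Proof. by vm_compute. Qed.

Lemma known48E :
  known48 = derive (map tree48 (iota 1 47) ++ map (fun c => kappa (tree48 c)) (iota 1 47)) cmds48.
Proof. by []. Qed.

Opaque known48.

Definition nb1 c i := kappa (c * 7 + i) %/ 7.
(** After a turn by [i] and a hop, the far corner of the quadrangle on [i] and [j] carries the label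
    1 / (j - i); a second hop reaches it. *)
Definition nb2 c i j := kappa (shift (kappa (c * 7 + i)) (inv7 ((j + (7 - i)) %% 7))) %/ 7.

Definition pairs7 := [seq (i, j) | i <- iota 0 7, j <- iota 0 7].
Definition sphere1 c := map (nb1 c) (iota 0 7).
Definition sphere2 c := [seq nb2 c p.1 p.2 | p <- pairs7 & p.1 < p.2].

(* Nested conditionals rather than disjunctions, which [vm_compute] evaluates eagerly. *)
Lemma dist48 : let s1 := map sphere1 (iota 0 48) in let s2 := map sphere2 (iota 0 48) in
  all (fun c => all (fun d =>
    if c == d then true else if d \in nth [::] s1 c then true else
    if d \in nth [::] s2 c then true else
    if has (fun y => y \in nth [::] s2 c) (nth [::] s1 d) then true else
    has (fun m => if c \in nth [::] s2 m then d \in nth [::] s2 m else false) (iota 0 48))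
  (iota 0 48)) (iota 0 48).
Proof. by vm_compute. Qed.

Lemma tree48P c : c \in iota 1 47 -> [/\ word48 c = rcons (word48 (tree48 c %/ 7)) (tree48 c %% 7),
  kappa (tree48 c) = c * 7 & kappa (c * 7) = tree48 c].
Proof. by move=> cI; have /allP/(_ c cI)/and3P[/eqP ? /eqP ? /eqP ?] := tree48_check. Qed.

Lemma known48P s : s %/ 7 < 48 -> s \in known48 /\ kappa s %/ 7 < 48.
Proof.
move=> lts; have sI : s \in iota 0 (48 * 7) by rewrite mem_iota leq0n add0n -ltn_divLR.
have /andP[/andP[sk _] ks] := allP known48_check s sI.
exact: (conj sk ks).
Qed.

End Table48.

(** * The graph described by the coset table *)

Section Covering48.
Variables (T : finType) (e : rel T).
Implicit Types (u v w x y z a b c d : T) (g h : {perm T}) (s t : T * seq T).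
Notation N := (nbhd e).
Notation N2 := (nbhd2 e).
Notation opp := (opp e).
Notation frame := (frame e 7).
Hypotheses (sym_e : symmetric e) (irr_e : irreflexive e) (conn_e : connected_graph e).
Hypothesis triangle_free : forall u v x, e u v -> e v x -> ~~ e u x.
Hypothesis mu2 : forall u w, w \in N2 u -> #|N u :&: N w| = 2%N.

Let oppP := oppP sym_e triangle_free mu2.
Let opp_back := opp_back sym_e triangle_free mu2.

Definition relabel (p : nat -> nat) s : T * seq T := (s.1, mkseq (fun i => lbl s (p i)) 7).

Lemma lbl_relabel p s i : i < 7 -> lbl (relabel p s) i = lbl s (p i).
Proof. by move=> lti; rewrite /lbl /= nth_mkseq. Qed.

Definition turn j s := relabel (fun i => (i + j) %% 7) s.

Lemma lbl_turn j s i : i < 7 -> lbl (turn j s) i = lbl s ((i + j) %% 7).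
Proof. exact: lbl_relabel. Qed.

(** The crossing x -> c / x of the edge labelled 0, normalised to c = 1. *)
Definition hop s : T * seq T :=
  (lbl s 0, mkseq (fun i => if i == 0%N then s.1 else opp s.1 (lbl s 0) (lbl s (inv7 i))) 7).

Lemma lbl_hop0 s : lbl (hop s) 0 = s.1. Proof. by []. Qed.

Lemma lbl_hop s i : 0 < i < 7 -> lbl (hop s) i = opp s.1 (lbl s 0) (lbl s (inv7 i)).
Proof.
case/andP=> i0 lti; rewrite /lbl -[(hop s).2]/(mkseq _ 7) nth_mkseq //.
by case: i i0 {lti}.
Qed.

(** A class of frames closed under turning and hopping in which two labels determine the frame at a
    given vertex; it will consist of the affine relabellings of one orbit of frames. *)
Variable LL : T * seq T -> Prop.
Hypothesis LL_frame : forall s, LL s -> frame s.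
Hypothesis LL_turn : forall j s, LL s -> LL (turn j s).
Hypothesis LL_hop : forall s, LL s -> LL (hop s).
Hypothesis LL_rigid : forall s t i j, LL s -> LL t -> s.1 = t.1 -> i < 7 -> j < 7 -> i != j ->
  lbl s i = lbl t i -> lbl s j = lbl t j -> s = t.

Lemma LL_edge s i : LL s -> i < 7 -> e s.1 (lbl s i).
Proof. by move/LL_frame/frame_edge; apply. Qed.

Lemma LL_neq s i j : LL s -> i < 7 -> j < 7 -> (lbl s i == lbl s j) = (i == j).
Proof. by move/LL_frame/frame_neq; apply. Qed.

Lemma turn_turn i j s : turn j (turn i s) = turn ((i + j) %% 7) s.
Proof.
congr pair; apply/eq_in_map => l; rewrite mem_iota => /= ltl.
rewrite lbl_turn ?ltn_mod //; congr lbl.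
by rewrite modnDml modnDmr addnAC addnA.
Qed.

Lemma turn0 s : LL s -> turn 0 s = s.
Proof.
move=> Ls; apply: (frame_eq (LL_frame (LL_turn 0 Ls)) (LL_frame Ls)) => // i lti.
by rewrite lbl_turn // addn0 modn_small.
Qed.

Lemma inv7_spec i : 0 < i < 7 -> [/\ 0 < inv7 i < 7, inv7 (inv7 i) = i, 0 < 7 - inv7 i < 7 &
  inv7 (7 - inv7 i) = (7 - i)%N].
Proof. by move: i => [|[|[|[|[|[|[|i]]]]]]]. Qed.

Lemma opp_lbl s i j : LL s -> i < 7 -> j < 7 -> i != j ->
  opp (lbl s i) s.1 (opp s.1 (lbl s i) (lbl s j)) = lbl s j.
Proof. by move=> Ls lti ltj ij; rewrite opp_back ?LL_edge ?LL_neq. Qed.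

Lemma hopK s : LL s -> hop (hop s) = s.
Proof.
move=> Ls; have Lh := LL_hop Ls; have Lhh := LL_hop Lh.
apply: (frame_eq (LL_frame Lhh) (LL_frame Ls)) => // -[|i] // lti.
have [lt_inv invK _ _] := inv7_spec (lti : 0 < i.+1 < 7).
by rewrite [LHS]lbl_hop // lbl_hop0 (lbl_hop s lt_inv) invK; apply: opp_lbl.
Qed.

(** Both sides lead to the corner opposite to [s.1] in the quadrangle on the labels 0 and [x],
    through either of its two middle corners. The results agree at the labels 0 and 7 - x, and
    rigidity makes them equal. *)
Lemma hop_turn_hop (x : nat) s : LL s -> 0 < x < 7 ->
  hop (turn (inv7 x) (hop s)) = turn x (hop (turn (7 - inv7 x) (hop (turn x s)))).
Proof.
move=> Ls x7; have /andP[x0 ltx] := x7.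
have [y7 yK y7' yN] := inv7_spec x7; set y := inv7 x in y7 yK y7' yN *.
have ltN : 7 - x < 7 by rewrite -subn_gt0 subKn // ltnW.
have N7 : 0 < 7 - x < 7 by rewrite subn_gt0 ltx.
have [_ NK _ _] := inv7_spec y7'; rewrite yN in NK.
have eqx : ((7 - x + x) %% 7 = 0)%N by rewrite subnK ?modnn // ltnW.
have lty : y <= 7 by case/andP: y7 => _ /ltnW.
have eqy : ((y + (7 - y)) %% 7 = 0)%N by rewrite subnKC ?modnn.
have eqy' : ((7 - y + y) %% 7 = 0)%N by rewrite subnK ?modnn.
have [_ y'lt] := andP y7'; have [_ ylt] := andP y7.
have [Lt Lh] := (LL_turn x Ls, LL_hop Ls).
have Lht := LL_hop Lt; have Ly := LL_turn y Lh; have Lty := LL_turn (7 - y) Lht.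
set w := opp s.1 (lbl s 0) (lbl s x).
have w1 : lbl (turn y (hop s)) 0 = w by rewrite lbl_turn // modn_small // lbl_hop // yK.
have w2 : lbl (turn (7 - y) (hop (turn x s))) 0 = w.
  rewrite lbl_turn // modn_small // lbl_hop // yN !lbl_turn // eqx add0n modn_small //.
  by rewrite /= oppC.
pose Y := turn (7 - y) (hop (turn x s)); pose Z := turn y (hop s).
have Y1 : Y.1 = lbl s x by rewrite /= lbl_turn // add0n modn_small.
have Yy : lbl Y y = s.1 by rewrite lbl_turn // eqy.
have ZN : lbl Z (7 - y) = s.1 by rewrite lbl_turn // eqy'.
rewrite -/Y -/Z in w1 w2 *.
apply: (@LL_rigid _ _ 0 (7 - x)); try do [exact: LL_hop | exact/LL_turn/LL_hop].
- by apply: etrans (_ : w = _); [exact: w1 | exact: esym w2].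
- by [].
- exact: ltN.
- by rewrite eq_sym -lt0n; case/andP: N7.
- rewrite lbl_hop0 [RHS]lbl_turn // add0n modn_small // (lbl_hop Y x7) -/y Y1 w2 Yy.
  by rewrite oppC /w (oppC e s.1) opp_lbl // -lt0n.
- rewrite (lbl_hop Z N7) NK w1 ZN lbl_turn // eqx lbl_hop0 Y1 oppC.
  by rewrite [LHS]opp_lbl // eq_sym -lt0n.
Qed.

Definition frame48 s (c : nat) := foldl (fun t i => hop (turn i t)) s (word48 c).
Definition state48 s m := turn (m %% 7) (frame48 s (m %/ 7)).

Lemma LL_frame48 s (c : nat) : LL s -> LL (frame48 s c).
Proof.
rewrite /frame48; elim: (word48 c) s => //= i l IH s Ls.
by apply: IH; apply/LL_hop/LL_turn.
Qed.

Lemma shift_div (m x : nat) : shift m x %/ 7 = m %/ 7.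
Proof. by rewrite /shift divnMDl // [X in _ + X]divn_small ?addn0 ?ltn_mod. Qed.

Lemma shift_mod (m x : nat) : shift m x %% 7 = ((m %% 7 + x) %% 7)%N.
Proof. by rewrite /shift modnMDl modn_mod. Qed.

Lemma state48_shift s m (x : nat) : state48 s (shift m x) = turn x (state48 s m).
Proof. by rewrite /state48 shift_div shift_mod turn_turn. Qed.

Definition edge48 s m := hop (state48 s m) = state48 s (kappa m).

(** The relation contains four hops. When three of them are known, turning back by [x] gives the
    fourth, and [hopK] its reverse. *)
Lemma edge48_derive s known cmds : LL s ->
    (forall m, m \in known -> edge48 s m /\ edge48 s (kappa m)) ->
  forall m, m \in derive known cmds -> edge48 s m.
Proof.
move=> Ls; elim: cmds known => [|[p x] cmds IH] known edges /=.
  by move=> m /edges[].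
apply: IH; case: ifP => // /and5P[x7 kp kp1 kq /andP[/eqP eqk /eqP kkt]].
have [y7 yK y7' yN] := inv7_spec x7.
have Lst m : LL (state48 s m) by apply/LL_turn/LL_frame48.
set y := inv7 x in kp1 eqk y7 yK y7' yN *.
set t := shift (kappa (shift p x)) (7 - y) in eqk kkt *.
have E : edge48 s t.
  have := hop_turn_hop (Lst p) x7; rewrite -/y.
  have [-> _] := edges _ kp; rewrite -!state48_shift.
  have [-> _] := edges _ kp1; have [-> _] := edges _ kq.
  rewrite -state48_shift -/t eqk state48_shift => eqt.
  have turn_inj s1 s2 : LL s1 -> LL s2 -> turn x s1 = turn x s2 -> s1 = s2.
    move=> La Lb /(congr1 (turn (7 - x))); rewrite !turn_turn subnKC ?modnn ?turn0 //.
    by case/andP: x7 => _ /ltnW.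
  by apply/esym; apply: turn_inj eqt => //; apply: LL_hop.
have E' : edge48 s (kappa t) by rewrite /edge48 kkt -E hopK.
move=> m; rewrite !inE => /or3P[/eqP->|/eqP->|/edges//]; first by split.
by split; rewrite ?kkt.
Qed.

Lemma tree48_edge s (c : nat) : LL s -> c \in iota 1 47 ->
  edge48 s (tree48 c) /\ edge48 s (kappa (tree48 c)).
Proof.
move=> Ls /tree48P[wordc kt kc].
have eqc : state48 s (c * 7)%N = hop (state48 s (tree48 c)).
  rewrite {1}/state48 modnMl mulnK // turn0; last exact: LL_frame48.
  by rewrite /frame48 wordc foldl_rcons.
have L1 : LL (state48 s (tree48 c)) by apply/LL_turn/LL_frame48.
by rewrite /edge48 kt kc eqc hopK.
Qed.

Lemma edge48P s m : LL s -> m %/ 7 < 48 -> edge48 s m.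
Proof.
move=> Ls /known48P[+ _]; rewrite known48E; apply: (edge48_derive Ls) => n.
rewrite mem_cat => /orP[] /mapP[c cI ->]; have [E1 E2] := tree48_edge Ls cI; split=> //.
by have [_ -> ->] := tree48P cI.
Qed.

Definition vtx48 s (c : nat) := (frame48 s c).1.

Lemma code_div (c i : nat) : i < 7 -> ((c * 7 + i) %/ 7 = c)%N.
Proof. by move=> lti; rewrite divnMDl // divn_small // addn0. Qed.

Lemma state48_code s (c i : nat) : i < 7 -> state48 s (c * 7 + i)%N = turn i (frame48 s c).
Proof. by move=> lti; rewrite /state48 modnMDl modn_small // code_div. Qed.

Lemma lbl_turn0 s (i : nat) : i < 7 -> lbl (turn i s) 0 = lbl s i.
Proof. by move=> lti; rewrite lbl_turn // add0n modn_small. Qed.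

Lemma lbl_frame48 s (c i : nat) : LL s -> c < 48 -> i < 7 ->
  lbl (frame48 s c) i = vtx48 s (nb1 c i).
Proof.
move=> Ls ltc lti; rewrite -lbl_turn0 // -state48_code // -[LHS]/((hop _).1).
by rewrite edge48P ?code_div.
Qed.

Lemma opp_frame48 s (c i j : nat) : LL s -> c < 48 -> i < 7 -> j < 7 -> i != j ->
  opp (vtx48 s c) (lbl (frame48 s c) i) (lbl (frame48 s c) j) = vtx48 s (nb2 c i j).
Proof.
move=> Ls ltc lti ltj ij; rewrite /nb2; set x := (j + (7 - i)) %% 7.
have x7 : 0 < x < 7.
  by rewrite /x; move: i j lti ltj ij {x} => [|[|[|[|[|[|[|i]]]]]]] // [|[|[|[|[|[|[|j]]]]]]].
have xi : ((x + i) %% 7 = j)%N.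
  by rewrite modnDml -addnA subnK ?(ltnW lti) // modnDr modn_small.
have [/andP[_ lty] yK _ _] := inv7_spec x7; have ltx : x < 7 by case/andP: x7.
have ltp : kappa (c * 7 + i) %/ 7 < 48.
  by have [|_ ->] := @known48P (c * 7 + i); rewrite ?code_div.
have lts : shift (kappa (c * 7 + i)) (inv7 x) %/ 7 < 48 by rewrite shift_div.
transitivity (lbl (hop (turn i (frame48 s c))) (inv7 x)).
  rewrite lbl_hop ?yK ?lbl_turn0 // ?lbl_turn ?xi //.
  by case: (inv7_spec x7).
rewrite -state48_code // edge48P ?code_div // -lbl_turn0 // -state48_shift.
by rewrite -[LHS]/((hop _).1) edge48P.
Qed.

Lemma nb1_lt (c i : nat) : c < 48 -> i < 7 -> nb1 c i < 48.
Proof. by move=> ltc lti; have [|_ lt48] := @known48P (c * 7 + i); rewrite ?code_div. Qed.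

Lemma sphere1P (c d : nat) : d \in sphere1 c -> exists2 i, i < 7 & d = nb1 c i.
Proof. by case/mapP=> i; rewrite mem_iota => lti ->; exists i. Qed.

Lemma sphere2P (c d : nat) : d \in sphere2 c ->
  exists i j, [/\ i < 7, j < 7, i < j & d = nb2 c i j].
Proof.
case/mapP=> p; rewrite mem_filter => /andP[ltp /allpairsP[[i j] [+ + defp]]] ->.
by rewrite !mem_iota => lti ltj; exists i, j; rewrite defp in ltp *; split.
Qed.

Lemma vtx48_sphere1 s (c d : nat) : LL s -> c < 48 -> d \in sphere1 c -> e (vtx48 s c) (vtx48 s d).
Proof.
move=> Ls ltc /sphere1P[i lti ->]; rewrite -lbl_frame48 //.
exact: LL_edge (LL_frame48 c Ls) lti.
Qed.

Lemma vtx48_sphere2 s (c d : nat) : LL s -> c < 48 -> d \in sphere2 c ->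
  [/\ vtx48 s d != vtx48 s c, ~~ e (vtx48 s c) (vtx48 s d) &
   exists i j, [/\ i < j < 7, d = nb2 c i j & forall l, l < 7 ->
     e (lbl (frame48 s c) l) (vtx48 s d) = (l == i) || (l == j)]].
Proof.
move=> Ls ltc /sphere2P[i [j [lti ltj ij ->]]]; have Lc := LL_frame48 c Ls.
have nij : i != j by rewrite neq_ltn ij.
have ne : lbl (frame48 s c) i != lbl (frame48 s c) j by rewrite LL_neq.
rewrite -opp_frame48 //.
have [wv iw jw nvw [_ all2]] := oppP (LL_edge Lc lti) (LL_edge Lc ltj) ne.
split=> //; exists i, j; rewrite ij ltj; split=> // l ltl.
apply/idP/orP=> [lw|[/eqP->|/eqP->] //].
by case: (all2 _ (LL_edge Lc ltl) lw) => /eqP; rewrite LL_neq // => ->; [left | right].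
Qed.

(** By [dist48], distinct codes are adjacent, or at distance 2, or one is at distance 2 from a
    neighbour of the other, or both lie at distance 2 from some [m]. The first three rule out a
    common vertex directly. In the last, the vertex determines which two neighbours of [m] it is
    joined to, and these determine the code. *)
Lemma vtx48_inj s (c d : nat) : LL s -> c < 48 -> d < 48 -> vtx48 s c = vtx48 s d -> c = d.
Proof.
move=> Ls ltc ltd eqV; have := dist48; cbv zeta; move=> /allP/(_ c); rewrite mem_iota => /(_ ltc).
move=> /allP/(_ d); rewrite mem_iota => /(_ ltd).
rewrite !(nth_map 0%N) ?size_iota // !nth_iota // !add0n.
case: eqP => // _; case: ifP => [cd|_].
  by have := vtx48_sphere1 Ls ltc cd; rewrite eqV irr_e.
case: ifP => [cd|_]; first by have [] := vtx48_sphere2 Ls ltc cd; rewrite eqV eqxx.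
case: ifP => [/hasP[y dy cy] _|_].
  by have [_] := vtx48_sphere2 Ls ltc cy; rewrite eqV (vtx48_sphere1 Ls ltd dy).
case/hasP=> m; rewrite mem_iota => ltm; rewrite (nth_map 0%N) ?size_iota // nth_iota // add0n.
case: ifP => // cm dm.
have [_ _ [i [j [/andP[ij ltj] defc cl]]]] := vtx48_sphere2 Ls ltm cm.
have [_ _ [i' [j' [/andP[ij' ltj'] defd dl]]]] := vtx48_sphere2 Ls ltm dm.
have sets l : l < 7 -> (l == i) || (l == j) = (l == i') || (l == j').
  by move=> ltl; rewrite -cl // -dl // eqV.
have lti := ltn_trans ij ltj; have lti' := ltn_trans ij' ltj'.
have := sets i lti; have := sets j ltj; have := sets i' lti'; have := sets j' ltj'.
have arith (i1 j1 i2 j2 : nat) : i1 < j1 -> i2 < j2 ->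
    (j2 == i1) || (j2 == j1) = (j2 == i2) || (j2 == j2) ->
    (i2 == i1) || (i2 == j1) = (i2 == i2) || (i2 == j2) -> i1 = i2 /\ j1 = j2.
  by clear; rewrite !eqxx orbT /= => lt1 lt2 /orP[]/eqP e1 /orP[]/eqP e2; lia.
by move=> h1 h2 _ _; have [ei ej] := arith _ _ _ _ ij ij' h1 h2; rewrite defc defd ei ej.
Qed.

Lemma vtx48_surj s x : LL s -> exists2 c, c < 48 & vtx48 s c = x.
Proof.
move=> Ls; move: x; apply: (conn_ind conn_e (x := vtx48 s 0)) => [|_ y [c ltc <-] cy].
  by exists 0%N.
have [i lti ->] := frame_idx (LL_frame (LL_frame48 c Ls)) cy.
by exists (nb1 c i); rewrite ?nb1_lt // lbl_frame48.
Qed.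

Lemma hop_extend s t : LL s -> LL t ->
  exists2 g, g \in Aut e & g s.1 = t.1 /\ forall i, i < 7 -> g (lbl s i) = lbl t i.
Proof.
move=> Ls Lt.
have [|x|m n|g Gg gV] := @aut_of_cover T e 'I_48 (fun m => vtx48 s m) (fun m => vtx48 t m).
- by move=> m n; split=> /vtx48_inj eqc; congr vtx48; apply: eqc.
- by have [c ltc <-] := vtx48_surj x Ls; exists (Ordinal ltc).
- move=> mn; have [i lti eqn] := frame_idx (LL_frame (LL_frame48 m Ls)) mn.
  rewrite lbl_frame48 // in eqn; rewrite (vtx48_inj Ls _ _ eqn) ?nb1_lt // -lbl_frame48 //.
  exact: LL_edge (LL_frame48 m Lt) lti.
have F0 r : frame48 r 0 = r by [].
exists g => //; split; first exact: (gV (@Ordinal 48 0 isT)).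
move=> i lti; have lt1 : nb1 0 i < 48 by apply: nb1_lt.
have := gV (Ordinal lt1); rewrite /= -[in lbl s i](F0 s) -[in lbl t i](F0 t).
by rewrite !lbl_frame48.
Qed.

End Covering48.

(** * Valency 7 with two common neighbours at distance 2 *)

Section Affine7.
Local Open Scope nat_scope.

Definition aff7 a b i := (a * i + b) %% 7.
Definition sub7 i j := (i + (7 - j)) %% 7.

Definition arcs_preserved (D p : seq nat) := all (fun i => all (fun j =>
  (sub7 j i \in D) == (sub7 (nth 0 p j) (nth 0 p i) \in D)) (iota 0 7)) (iota 0 7).

Definition affine_list (p : seq nat) :=
  has (fun a => has (fun b => p == mkseq (aff7 a b) 7) (iota 0 7)) [:: 1; 2; 4].

(** The four circulant tournaments with 1 in the connection set: one choice from each of {2, 5} and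
    {3, 4}. Only the Paley tournament has an automorphism that fixes 0 and moves 1; its multipliers
    1, 2, 4 are the squares mod 7. *)
Lemma tournament7_check : all (fun p => all (fun D =>
    if arcs_preserved D p then
      if D == [:: 1; 2; 4] then affine_list p else (nth 0 p 0 != 0) || (nth 0 p 1 == 1)
    else true)
  [:: [:: 1; 2; 3]; [:: 1; 2; 4]; [:: 1; 5; 3]; [:: 1; 5; 4]]) (permutations (iota 0 7)).
Proof. by vm_compute. Qed.

(* Necessary conditions on the permutation [p] with [pi 0 = 0] for which
   crossing the edge labelled 0 turns the label [i] into [pi i]. The affine map
   with coefficients [con_alpha x], [con_beta x] compares the two frames reached
   at the far corner of the quadrangle on the labels 0 and [x], and [con_good x y]
   says that the claw on the labels 0, [x], [y] closes up to a cube. *)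
Section Connection.
Variable p : seq nat.
Let pi i := nth 0 p i.

Definition con_mul :=
  has (fun a => all (fun x => pi (aff7 2 0 x) == aff7 a 0 (pi x)) (iota 0 7)) [:: 1; 2; 4].
Definition con_inv :=
  has (fun a => all (fun x => aff7 a 0 (pi (pi x)) == x) (iota 0 7)) [:: 1; 2; 4].
Definition con_beta x := pi (sub7 0 (pi (sub7 0 x))).
Definition con_zeta x := pi (sub7 0 (pi x)).
Definition con_alpha x := ((7 - con_beta x) * con_zeta x ^ 5) %% 7.
Definition con_good x y := aff7 (con_alpha x) (con_beta x) (pi (sub7 (pi y) (pi x))) ==
  pi (sub7 (pi (sub7 y x)) (pi (sub7 0 x))).
Definition con_sym := all (fun x => all (fun y => (x == y) ||
    ((con_good x y == con_good y x) && (con_good x y == con_good (sub7 y x) (sub7 0 x))))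
  (iota 1 6)) (iota 1 6).
Definition con_flat :=
  all (fun x => all (fun y => (x == y) || con_good x y) (iota 1 6)) (iota 1 6).
Definition con_mobius :=
  has (fun c => all (fun x => pi x == aff7 c 0 (inv7 x)) (iota 0 7)) (iota 1 6).
End Connection.

Lemma connection_check : all (fun q => let p := 0 :: q in
    if con_mul p then if con_inv p then if con_sym p then if con_flat p then true else con_mobius p
    else true else true else true) (permutations (iota 1 6)).
Proof. by vm_compute. Qed.

Lemma aff7_eq2 : all (fun a => all (fun b => all (fun a' => all (fun b' =>
    all (fun i => all (fun j => if i == j then true else
      if aff7 a b i == aff7 a' b' i then if aff7 a b j == aff7 a' b' j then (a == a') && (b == b')
      else true else true) (iota 0 7)) (iota 0 7))
  (iota 0 7)) (iota 1 6)) (iota 0 7)) (iota 1 6).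
Proof. by vm_compute. Qed.

(** [z ^ 5] is the inverse of [z] mod 7, so this solves a z + b = 0 for the coefficient a, as in
    [con_alpha]. *)
Lemma alpha_check : all (fun a => all (fun b => all (fun z =>
    if aff7 a b z == 0 then a == ((7 - b) * z ^ 5) %% 7 else true)
  (iota 1 6)) (iota 0 7)) [:: 1; 2; 4].
Proof. by vm_compute. Qed.

Lemma aff7_inj_check : all (fun a => all (fun b => all (fun i => all (fun j =>
    if aff7 a b i == aff7 a b j then i == j else true)
  (iota 0 7)) (iota 0 7)) (iota 0 7)) (iota 1 6).
Proof. by vm_compute. Qed.

Lemma inv7_aff_check : all (fun a => all (fun i =>
    inv7 (aff7 a 0 (inv7 i)) == aff7 (inv7 a) 0 i)
  (iota 0 7)) (iota 1 6).
Proof. by vm_compute. Qed.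

Lemma aff7_comp a b a' b' i :
  aff7 a b (aff7 a' b' i) = aff7 ((a * a') %% 7) (aff7 a b b') i.
Proof.
rewrite /aff7 modnDmr -[LHS]modnDml modnMmr modnDml mulnDr.
by rewrite -[RHS]modnDml modnMml modnDml mulnA addnA.
Qed.

Lemma mul7_range a b : 0 < a < 7 -> 0 < b < 7 -> 0 < (a * b) %% 7 < 7.
Proof. by move: a b => [|[|[|[|[|[|[|a]]]]]]] // [|[|[|[|[|[|[|b]]]]]]]. Qed.

Lemma sub7_range i j : i < 7 -> j < 7 -> i != j -> 0 < sub7 i j < 7.
Proof. by move: i j => [|[|[|[|[|[|[|i]]]]]]] // [|[|[|[|[|[|[|j]]]]]]]. Qed.

Lemma sub7K i j : i < 7 -> j < 7 -> (sub7 i j + j) %% 7 = i.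
Proof. by move: i j => [|[|[|[|[|[|[|i]]]]]]] // [|[|[|[|[|[|[|j]]]]]]]. Qed.

End Affine7.

(** * The connection permutation and its two kinds *)

Section Valency7.
Variables (T : finType) (e : rel T).
Implicit Types (u v w x y z : T) (g h : {perm T}) (s t r : T * seq T) (i j l m n : nat).
Notation N := (nbhd e).
Notation N2 := (nbhd2 e).
Notation opp := (opp e).
Notation frame := (frame e 7).
Hypotheses (sym_e : symmetric e) (irr_e : irreflexive e) (conn_e : connected_graph e).
Hypothesis reg_e : regular_of_valency e 7.
Hypothesis tdt_e : two_distance_transitive e.
Hypothesis triangle_free : forall u v x, e u v -> e v x -> ~~ e u x.
Hypothesis mu2 : forall u w, w \in N2 u -> #|N u :&: N w| = 2%N.
Hypothesis not_loc2 : forall u, ~ loc2 e u.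

Let oppP := oppP sym_e triangle_free mu2.
Let opp_back := opp_back sym_e triangle_free mu2.

Lemma no_swap g u x : g \in Aut e -> g u = u -> e u x -> g (g x) = x -> g x = x.
Proof.
move=> Gg gu ux ggx; apply/eqP; apply: contraT => gx; case: (not_loc2 (u := u)).
apply: (swap_loc2 (mu2_homog sym_e tdt_e triangle_free mu2 (u := u)) Gg gu _ _ erefl ggx).
  by rewrite inN.
by rewrite eq_sym.
Qed.

Lemma relabel_relabel (p q : nat -> nat) s : (forall i, i < 7 -> p i < 7) ->
  relabel p (relabel q s) = relabel (fun i => q (p i)) s.
Proof.
move=> ltp; congr pair; apply/eq_in_map => i; rewrite mem_iota => /= lti.
by rewrite lbl_relabel ?ltp.
Qed.

Lemma eq_relabel (p q : nat -> nat) s : (forall i, i < 7 -> p i = q i) -> relabel p s = relabel q s.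
Proof. by move=> pq; congr pair; apply/eq_in_map => i; rewrite mem_iota => /= lti; rewrite pq. Qed.

Lemma aff7_lt a b i : aff7 a b i < 7. Proof. exact: ltn_pmod. Qed.

Lemma sub7_lt i j : sub7 i j < 7. Proof. exact: ltn_pmod. Qed.

Lemma frame_relabel7 (p : nat -> nat) s : (forall i, i < 7 -> p i < 7) ->
    (forall i j, i < 7 -> j < 7 -> p i = p j -> i = j) -> frame s -> frame (relabel p s).
Proof.
move=> ltp inj_p Fs; apply: frame_of_inj; first exact: reg_e.
- by rewrite size_mkseq.
- apply/(mkseq_uniqP _ 7) => i j; rewrite !inE => lti ltj /eqP.
  by rewrite (frame_neq Fs) ?ltp // => /eqP/inj_p; apply.
- by move=> _ /mapP[i + ->]; rewrite mem_iota inN => /= lti; apply: frame_edge Fs (ltp i lti).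
Qed.

(* No automorphism fixing [s0.1] swaps two neighbours, so its orbit on ordered
   pairs of neighbours containing [(lbl s0 0, lbl s0 1)] is a tournament. The
   7-cycle makes it circulant and 2-homogeneity makes it the Paley tournament,
   whose group is 7:3. *)
Section Paley.
Variables (s0 : T * seq T).
Hypothesis frame_s0 : frame s0.
Notation u0 := s0.1.

Definition arc x y := [exists g in Aut e, [&& g u0 == u0, g (lbl s0 0) == x & g (lbl s0 1) == y]].

Lemma arcP x y : reflect (exists2 g, g \in Aut e & [/\ g u0 = u0, g (lbl s0 0) = x & g (lbl s0 1) = y])
  (arc x y).
Proof.
apply: (iffP exists_inP) => -[g Gg].
  by move=> /and3P[/eqP ? /eqP ? /eqP ?]; exists g.
by move=> [gu gx gy]; exists g => //; rewrite gu gx gy !eqxx.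
Qed.

Lemma arc_aut g x y : g \in Aut e -> g u0 = u0 -> arc (g x) (g y) = arc x y.
Proof.
move=> Gg gu; apply/arcP/arcP => -[h Gh [hu hx hy]].
  by exists (h * g^-1); rewrite ?groupM ?groupV // !permM hu hx hy !permK -{1}gu permK.
by exists (h * g); rewrite ?groupM // !permM hu hx hy gu.
Qed.

Lemma arc_total x y : e u0 x -> e u0 y -> x != y -> arc y x = ~~ arc x y.
Proof.
move=> ux uy xy; have [l0 l1] : e u0 (lbl s0 0) /\ e u0 (lbl s0 1).
  by split; apply: frame_edge frame_s0 _.
have l01 : lbl s0 0 != lbl s0 1 by rewrite (frame_neq frame_s0).
have [g Gg [gu gxy]] : exists2 g, g \in Aut e & g u0 = u0 /\
    (g (lbl s0 0) = x /\ g (lbl s0 1) = y \/ g (lbl s0 0) = y /\ g (lbl s0 1) = x).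
  by apply: (mu2_homog sym_e tdt_e triangle_free mu2); rewrite ?inN.
have excl h : h \in Aut e -> h u0 = u0 -> h x = y -> h y = x -> False.
  move=> Gh hu hx hy; have := no_swap Gh hu ux; rewrite hx hy => /(_ erefl) eqxy.
  by rewrite eqxy eqxx in xy.
case: gxy => -[gx gy].
  have -> : arc x y by apply/arcP; exists g.
  apply/arcP => -[h Gh [hu hx hy]]; apply: (excl (g^-1 * h)); rewrite ?groupM ?groupV //.
  - by rewrite permM -{1}gu permK.
  - by rewrite permM -gx permK.
  - by rewrite permM -gy permK.
have -> : arc y x by apply/arcP; exists g.
apply/esym/negP => /arcP[h Gh [hu hx hy]]; apply: (excl (h^-1 * g)); rewrite ?groupM ?groupV //.
- by rewrite permM -{1}hu permK.
- by rewrite permM -hx permK.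
- by rewrite permM -hy permK.
Qed.

Lemma stab_label g : g \in Aut e -> g u0 = u0 -> exists p, [/\ perm_eq p (iota 0 7),
  forall i, i < 7 -> nth 0%N p i < 7 & forall i, i < 7 -> g (lbl s0 i) = lbl s0 (nth 0%N p i)].
Proof.
move=> Gg gu; have Fg := frame_act Gg frame_s0.
have [p [ltp pE pl]] := frame_relabel frame_s0 Fg gu.
exists (mkseq p 7); split=> [|i lti|i lti]; last 2 first.
- by rewrite nth_mkseq ?ltp.
- by rewrite nth_mkseq // -pl // (lbl_act _ _ frame_s0).
have U : uniq (mkseq p 7).
  by apply/(mkseq_uniqP _ 7) => i j; rewrite !inE => lti ltj /eqP; rewrite pE // => /eqP.
apply: uniq_perm => //; rewrite ?iota_uniq //.
have sub : {subset mkseq p 7 <= iota 0 7}.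
  by move=> _ /mapP[i + ->]; rewrite !mem_iota; apply: ltp.
by have [|_ eqi] := uniq_min_size U sub; rewrite ?size_mkseq.
Qed.

Hypothesis shift_s0 : exists2 g, g \in Aut e & g u0 = u0 /\
  forall i, i < 7 -> g (lbl s0 i) = lbl s0 (i.+1 %% 7).

Lemma arc_sub7 i j : i < 7 -> j < 7 -> arc (lbl s0 i) (lbl s0 j) = arc (lbl s0 0) (lbl s0 (sub7 j i)).
Proof.
have [g Gg [gu gs]] := shift_s0; move=> lti ltj.
exact: (label_shift (isT : 0 < 7) gs (fun x y => arc_aut x y Gg gu)).
Qed.

Lemma arc_connection : exists2 D, D \in [:: [:: 1; 2; 3]; [:: 1; 2; 4]; [:: 1; 5; 3]; [:: 1; 5; 4]]%N &
  forall i j, i < 7 -> j < 7 -> arc (lbl s0 i) (lbl s0 j) = (sub7 j i \in D).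
Proof.
pose Q i := arc (lbl s0 0) (lbl s0 i).
have neq i j : i < 7 -> j < 7 -> i != j -> lbl s0 i != lbl s0 j.
  by move=> *; rewrite (frame_neq frame_s0).
have QN i : 0 < i < 7 -> Q (sub7 0 i) = ~~ Q i.
  move=> /andP[i0 lti]; rewrite /Q -arc_sub7 // arc_total ?(frame_edge frame_s0) //.
  by rewrite neq // eq_sym -lt0n.
have Q0 : Q 0%N = false.
  apply/arcP=> -[g Gg [gu g0 g1]]; have := neq 0%N 1%N isT isT isT.
  by rewrite -(inj_eq (@perm_inj _ g)) g0 g1 eqxx.
have Q1 : Q 1%N by apply/arcP; exists 1; rewrite ?group1 ?perm1.
have QQ i j : i < 7 -> j < 7 -> arc (lbl s0 i) (lbl s0 j) = Q (sub7 j i) by apply: arc_sub7.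
have [Q6 Q5 Q4] := And3 (QN 1%N isT) (QN 2%N isT) (QN 3%N isT); rewrite /= in Q6 Q5 Q4.
have fin (D : seq nat) : (forall i, i < 7 -> Q i = (i \in D)) ->
    forall i j, i < 7 -> j < 7 -> arc (lbl s0 i) (lbl s0 j) = (sub7 j i \in D).
  by move=> QD i j lti ltj; rewrite QQ // QD // sub7_lt.
have e6 : sub7 0 1 = 6 by []. have e5 : sub7 0 2 = 5 by []. have e4 : sub7 0 3 = 4 by [].
rewrite e6 in Q6; rewrite e5 in Q5; rewrite e4 in Q4.
case Q2: (Q 2) Q5 => Q5; case Q3: (Q 3) Q4 => Q4.
- exists [:: 1; 2; 3]%N => //; apply: fin.
  by move=> [|[|[|[|[|[|[|i]]]]]]] // _; rewrite ?Q0 ?Q1 ?Q2 ?Q3 ?Q4 ?Q5 ?Q6 ?Q1.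
- exists [:: 1; 2; 4]%N => //; apply: fin.
  by move=> [|[|[|[|[|[|[|i]]]]]]] // _; rewrite ?Q0 ?Q1 ?Q2 ?Q3 ?Q4 ?Q5 ?Q6 ?Q1.
- exists [:: 1; 5; 3]%N => //; apply: fin.
  by move=> [|[|[|[|[|[|[|i]]]]]]] // _; rewrite ?Q0 ?Q1 ?Q2 ?Q3 ?Q4 ?Q5 ?Q6 ?Q1.
- exists [:: 1; 5; 4]%N => //; apply: fin.
  by move=> [|[|[|[|[|[|[|i]]]]]]] // _; rewrite ?Q0 ?Q1 ?Q2 ?Q3 ?Q4 ?Q5 ?Q6 ?Q1.
Qed.

Lemma stab_arcs_preserved D g p :
    (forall i j, i < 7 -> j < 7 -> arc (lbl s0 i) (lbl s0 j) = (sub7 j i \in D)) ->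
    g \in Aut e -> g u0 = u0 -> (forall i, i < 7 -> nth 0%N p i < 7) ->
    (forall i, i < 7 -> g (lbl s0 i) = lbl s0 (nth 0%N p i)) -> arcs_preserved D p.
Proof.
move=> arcD Gg gu ltp gp.
apply/allP => i; rewrite mem_iota => lti; apply/allP => j; rewrite mem_iota => ltj.
by rewrite -!arcD ?ltp // -!gp // arc_aut.
Qed.

(** Some q other than 1 also lies in [D], so an automorphism takes the pair of labels (0, 1) to (0,
    q). By [tournament7_check] only {1, 2, 4} allows this. *)
Lemma arc_paley i j : i < 7 -> j < 7 ->
  arc (lbl s0 i) (lbl s0 j) = (sub7 j i \in [:: 1; 2; 4]%N).
Proof.
have [D DD arcD] := arc_connection; suff <- : D = [:: 1; 2; 4]%N by apply: arcD.
have [q q1 [ltq qD]] : exists2 q, q != 1%N & q < 7 /\ q \in D.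
  by move: DD; rewrite !inE => /or4P[] /eqP->; [exists 2%N | exists 2%N | exists 5%N | exists 5%N].
have : arc (lbl s0 0) (lbl s0 q) by rewrite arcD // /sub7 subn0 modnDr modn_small.
case/arcP=> h Gh [hu h0 h1]; have [p [pp ltp hp]] := stab_label Gh hu.
have pI : p \in permutations (iota 0 7) by rewrite mem_permutations.
have /allP/(_ p pI)/allP/(_ D DD) := tournament7_check.
rewrite (stab_arcs_preserved arcD Gh hu ltp hp); case: eqP => // _.
have -> : nth 0%N p 0 = 0%N.
  by apply/eqP; rewrite -(frame_neq frame_s0) ?ltp // -hp // h0.
rewrite eqxx /= => /eqP p1; case/negP: q1.
by rewrite -(frame_neq frame_s0) // -h1 hp // p1.
Qed.

Lemma stab_affine g : g \in Aut e -> g u0 = u0 ->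
  exists a b, [/\ a \in [:: 1; 2; 4]%N, b < 7 & forall i, i < 7 -> g (lbl s0 i) = lbl s0 (aff7 a b i)].
Proof.
move=> Gg gu; have [p [pp ltp gp]] := stab_label Gg gu.
have pI : p \in permutations (iota 0 7) by rewrite mem_permutations.
have /allP/(_ p pI)/allP/(_ [:: 1; 2; 4]%N isT) := tournament7_check.
rewrite (stab_arcs_preserved arc_paley Gg gu ltp gp) eqxx.
case/hasP=> a aI /hasP[b]; rewrite mem_iota => ltb /eqP defp; exists a, b; split=> // i lti.
by rewrite gp // defp nth_mkseq.
Qed.

Lemma aff7_ext a b a' b' i j : 0 < a < 7 -> 0 < a' < 7 -> b < 7 -> b' < 7 -> i < 7 -> j < 7 ->
  i != j -> aff7 a b i = aff7 a' b' i -> aff7 a b j = aff7 a' b' j -> a = a' /\ b = b'.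
Proof.
move=> lta lta' ltb ltb' lti ltj ij ei ej; have /allP/(_ a) := aff7_eq2; rewrite mem_iota => /(_ lta).
move=> /allP/(_ b); rewrite mem_iota => /(_ ltb) /allP/(_ a'); rewrite mem_iota => /(_ lta').
move=> /allP/(_ b'); rewrite mem_iota => /(_ ltb') /allP/(_ i); rewrite mem_iota => /(_ lti).
move=> /allP/(_ j); rewrite mem_iota => /(_ ltj); rewrite (negPf ij) ei ej !eqxx.
by case/andP=> /eqP-> /eqP->.
Qed.

(** The orbit of [s0]. At each vertex it is one coset of 7:3: its members differ by the maps x -> a
    x + b with [a] a square. *)
Definition FF s := exists2 g, g \in Aut e & s = act_frame g s0.

Lemma FF_frame s : FF s -> frame s.
Proof. by case=> g Gg ->; apply: frame_act. Qed.

Lemma FF_s0 : FF s0.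
Proof.
exists 1; rewrite ?group1 // /act_frame perm1; case: (s0) => u s /=; congr pair.
by rewrite -[LHS]map_id; apply: eq_map => x; rewrite perm1.
Qed.

Lemma act_frameM g h s : act_frame (g * h) s = act_frame h (act_frame g s).
Proof. by rewrite /act_frame /= permM -map_comp; congr pair; apply: eq_map => x; rewrite permM. Qed.

Lemma FF_act g s : g \in Aut e -> FF s -> FF (act_frame g s).
Proof. by move=> Gg [h Gh ->]; exists (h * g); rewrite ?groupM ?act_frameM. Qed.

Lemma relabel_act g (p : nat -> nat) s : frame s -> (forall i, i < 7 -> p i < 7) ->
  relabel p (act_frame g s) = act_frame g (relabel p s).
Proof.
move=> Fs ltp; congr pair; rewrite -[(relabel p s).2]/(mkseq (fun i => lbl s (p i)) 7) /mkseq -map_comp.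
by apply/eq_in_map => i; rewrite mem_iota => lti; apply: lbl_act Fs; apply: ltp.
Qed.

Lemma small124 a : a \in [:: 1; 2; 4]%N -> 0 < a < 7.
Proof. by rewrite !inE => /or3P[] /eqP->. Qed.

Lemma act_affine g a b : g \in Aut e -> g u0 = u0 ->
  (forall i, i < 7 -> g (lbl s0 i) = lbl s0 (aff7 a b i)) -> act_frame g s0 = relabel (aff7 a b) s0.
Proof.
move=> Gg gu gp; have [sz _ _] := frame_s0; congr pair => //=.
apply: (@eq_from_nth _ u0); first by rewrite size_map sz size_mkseq.
move=> i; rewrite size_map sz => lti; rewrite (nth_map u0) ?sz // nth_mkseq //.
exact: gp.
Qed.

(** As [a] is a square, (b, a + b) is an arc, so some automorphism takes the labels 0, 1 to it;
    being affine, it is x -> a x + b. *)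
Lemma FF_affine a b s : a \in [:: 1; 2; 4]%N -> b < 7 -> FF s -> FF (relabel (aff7 a b) s).
Proof.
move=> aI ltb [g Gg ->]; rewrite relabel_act //; last by move=> i _; apply: aff7_lt.
apply: FF_act => //.
have : arc (lbl s0 b) (lbl s0 (aff7 1 b a)).
  have lta := small124 aI; rewrite arc_paley ?aff7_lt //.
  suff -> : sub7 (aff7 1 b a) b = a by [].
  rewrite /sub7 /aff7 mul1n modnDml -addnA subnKC ?(ltnW ltb) // modnDr modn_small //.
  by case/andP: lta.
case/arcP=> h Gh [hu h0 h1]; have [a' [b' [aI' ltb' hp]]] := stab_affine Gh hu.
have lbl_inj i j : i < 7 -> j < 7 -> lbl s0 i = lbl s0 j -> i = j.
  by move=> lti ltj /eqP; rewrite (frame_neq frame_s0) // => /eqP.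
have [eqa eqb] : a' = a /\ b' = b.
  apply: (@aff7_ext _ _ _ _ 0 1); rewrite ?small124 //.
    by apply: lbl_inj; rewrite ?aff7_lt // -hp // h0 /aff7 muln0 add0n modn_small.
  by apply: lbl_inj; rewrite ?aff7_lt // -hp // h1 /aff7 muln1 mul1n addnC.
by rewrite -eqa -eqb -(act_affine Gh hu hp); exists h.
Qed.

Lemma FF_same s t : FF s -> FF t -> s.1 = t.1 ->
  exists a b, [/\ a \in [:: 1; 2; 4]%N, b < 7 & t = relabel (aff7 a b) s].
Proof.
move=> [g Gg ->] [h Gh ->] /= eqgh.
have Gf : h * g^-1 \in Aut e by rewrite groupM ?groupV.
have fu : (h * g^-1) u0 = u0 by rewrite permM -eqgh permK.
have [a [b [aI ltb fp]]] := stab_affine Gf fu; exists a, b; split=> //.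
rewrite relabel_act //; last by move=> i _; apply: aff7_lt.
by rewrite -(act_affine Gf fu fp) -act_frameM mulgKV.
Qed.

Lemma FF_at x : exists2 s, FF s & s.1 = x.
Proof.
have [g Gg gx] := aut_vt tdt_e u0 x; exists (act_frame g s0) => //.
by exists g.
Qed.

Lemma FF_turn i s : FF s -> FF (turn i s).
Proof.
move=> Fs; have -> : turn i s = relabel (aff7 1 (i %% 7)) s.
  by apply: eq_relabel => j _; rewrite /aff7 mul1n modnDmr.
by apply: FF_affine; rewrite ?ltn_mod.
Qed.

(** An automorphism reversing the edge labelled 0 gives a frame of the orbit across that edge, and
    [p] compares it with the transported frame. Automorphisms carry this comparison along, so one
    [p] serves the whole orbit. *)
Lemma FF_connection : exists p, [/\ perm_eq p (iota 0 7), nth 0%N p 0 = 0%N,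
  forall i, i < 7 -> nth 0%N p i < 7 &
  forall s, FF s -> exists t, [/\ FF t, t.1 = lbl s 0, lbl t 0 = s.1 &
    forall i, 0 < i < 7 -> lbl t (nth 0%N p i) = opp s.1 (lbl s 0) (lbl s i)]].
Proof.
have ul : e u0 (lbl s0 0) by apply: frame_edge frame_s0 _.
have [|g Gg [gu gl]] := aut_arc tdt_e ul (x := lbl s0 0) (y := u0); first by rewrite sym_e.
pose t0 := act_frame g s0; have Ft0 : frame t0 by apply: frame_act.
have lt0 i : i < 7 -> lbl t0 i = g (lbl s0 i) by move=> lti; rewrite (lbl_act _ _ frame_s0).
pose o i := if i == 0%N then u0 else opp u0 (lbl s0 0) (lbl s0 i).
have [p0 [ltp pE op]] : exists p : nat -> nat, [/\ forall i, i < 7 -> p i < 7,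
     forall i j, i < 7 -> j < 7 -> (p i == p j) = (i == j) & forall i, i < 7 -> o i = lbl t0 (p i)].
  have Fm := frame_move sym_e reg_e triangle_free mu2 (isT : 0 < 7) frame_s0.
  have [p [ltp pE pl]] := frame_relabel Ft0 Fm (esym gu).
  by exists p; split=> // i lti; rewrite -pl // lbl_move.
have p00 : p0 0%N = 0%N.
  by apply/eqP; rewrite -(frame_neq Ft0) ?ltp // -op // lt0 // gl.
exists (mkseq p0 7); split=> [||i lti|s [h Gh ->]]; last 2 first.
- by rewrite nth_mkseq ?ltp.
- exists (act_frame h t0); split.
  + by apply: FF_act => //; exists g.
  + by rewrite (lbl_act _ _ frame_s0) //= gu.
  + by rewrite (lbl_act _ _ Ft0) // lt0 // gl.
  move=> i /andP[i0 lti]; rewrite nth_mkseq // (lbl_act _ _ Ft0) ?ltp // -op // /o.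
  rewrite -[i == _]negbK -lt0n i0 /= !(lbl_act _ _ frame_s0) //.
  rewrite (opp_aut sym_e triangle_free mu2) ?(frame_edge frame_s0) ?(frame_neq frame_s0) //.
  by rewrite eq_sym -lt0n.
- have U : uniq (mkseq p0 7).
    by apply/(mkseq_uniqP _ 7) => i j; rewrite !inE => lti ltj /eqP; rewrite pE // => /eqP.
  have sub : {subset mkseq p0 7 <= iota 0 7}.
    by move=> _ /mapP[i + ->]; rewrite !mem_iota; apply: ltp.
  apply: uniq_perm => //; rewrite ?iota_uniq //.
  by have [|_ eqi] := uniq_min_size U sub; rewrite ?size_mkseq.
by rewrite nth_mkseq.
Qed.

Lemma lbl_inj s i j : frame s -> i < 7 -> j < 7 -> lbl s i = lbl s j -> i = j.
Proof. by move=> Fs lti ltj /eqP; rewrite (frame_neq Fs) // => /eqP. Qed.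

Section Connection.
Variable p : seq nat.
Notation pi i := (nth 0%N p i).
Hypothesis perm_p : perm_eq p (iota 0 7).
Hypothesis pi0 : pi 0 = 0%N.
Hypothesis lt_pi : forall i, i < 7 -> pi i < 7.
Hypothesis FF_cross : forall s, FF s -> exists t, [/\ FF t, t.1 = lbl s 0, lbl t 0 = s.1 &
  forall i, 0 < i < 7 -> lbl t (pi i) = opp s.1 (lbl s 0) (lbl s i)].

Lemma pi_inj i j : i < 7 -> j < 7 -> pi i = pi j -> i = j.
Proof.
move=> lti ltj /eqP; rewrite nth_uniq ?(perm_size perm_p) //; first by move/eqP.
by rewrite (perm_uniq perm_p) iota_uniq.
Qed.

Lemma pi_range i : 0 < i < 7 -> 0 < pi i < 7.
Proof.
move=> /andP[i0 lti]; rewrite lt_pi // andbT lt0n -[X in _ != X]pi0.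
by apply: contraTneq i0 => /pi_inj ->.
Qed.

(** Multiplication by the square 2 stays in the orbit. Crossing before and after it gives two frames
    at the same vertex with the same label 0, which differ by a multiplier. *)
Lemma con_mulP : con_mul p.
Proof.
have [t [Ft t1 t0 tl]] := FF_cross FF_s0.
have Fs' : FF (relabel (aff7 2 0) s0) by apply: FF_affine FF_s0.
have [t' [Ft' t1' t0' tl']] := FF_cross Fs'.
have l'0 : lbl (relabel (aff7 2 0) s0) 0 = lbl s0 0 by rewrite lbl_relabel.
have [|a [b [aI ltb deft']]] := FF_same Ft Ft'; first by rewrite t1 t1' l'0.
have b0 : b = 0%N.
  apply: (lbl_inj (FF_frame Ft)) => //; rewrite t0 -[RHS]t0' deft' lbl_relabel //.
  by rewrite /aff7 muln0 add0n modn_small.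
apply/hasP; exists a => //; apply/allP=> x; rewrite mem_iota => ltx; apply/eqP.
have [->|x0] := posnP x; first by rewrite pi0 /aff7 !muln0.
have x7 : 0 < x < 7 by rewrite x0.
have r7 : 0 < aff7 2 0 x < 7 by rewrite /aff7 addn0 mul7_range.
have [_ lta] := andP r7.
apply: (lbl_inj (FF_frame Ft)); rewrite ?lt_pi ?aff7_lt //.
have el : lbl t' (pi x) = lbl t (aff7 a 0 (pi x)) by rewrite deft' b0 lbl_relabel ?lt_pi.
by rewrite tl // -el tl' // l'0 lbl_relabel.
Qed.

(** Crossing the same edge twice returns to the vertex with label 0 in place, hence to the frame up
    to a multiplier. *)
Lemma con_invP : con_inv p.
Proof.
have [t [Ft t1 t0 tl]] := FF_cross FF_s0; have [r [Fr r1 r0 rl]] := FF_cross Ft.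
have [|a [b [aI ltb defr]]] := FF_same FF_s0 Fr; first by rewrite r1 t0.
have Fs := frame_s0.
have b0 : b = 0%N.
  apply: (lbl_inj Fs) => //; rewrite -t1 -r0 defr lbl_relabel //.
  by rewrite /aff7 muln0 add0n modn_small.
apply/hasP; exists a => //; apply/allP=> x; rewrite mem_iota => ltx; apply/eqP.
have [->|x0] := posnP x; first by rewrite !pi0 /aff7 !muln0.
have x7 : 0 < x < 7 by rewrite x0.
apply: (lbl_inj Fs); rewrite ?aff7_lt //.
have el : lbl r (pi (pi x)) = lbl s0 (aff7 a 0 (pi (pi x))).
  by rewrite defr b0 lbl_relabel ?lt_pi // lt_pi.
rewrite -el rl ?pi_range // t0 t1 tl //.
by rewrite opp_back ?(frame_edge Fs) ?(frame_neq Fs) // eq_sym -lt0n.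
Qed.

Definition good v x y z := opp x (opp v x y) (opp v x z) == opp y (opp v y x) (opp v y z).

Lemma goodC v x y z : good v x y z = good v y x z.
Proof. exact: eq_sym. Qed.

(** The common corner is also adjacent to the far corners of the two faces at [z], and it differs
    from [z], so it closes the third face as well. *)
Lemma good_rot v x y z : e v x -> e v y -> e v z -> x != y -> y != z -> x != z ->
  good v x y z -> good v x z y.
Proof.
move=> vx vy vz xy yz xz /eqP eqd; rewrite /good (oppC e x) eqd; apply/eqP/esym.
have inj := opp_inj sym_e triangle_free mu2.
have yx : y != x by rewrite eq_sym. have zx : z != x by rewrite eq_sym.
have zy : z != y by rewrite eq_sym.
have [_ x1 _ _ _] := oppP vx vy xy; have [_ x2 z2 _ _] := oppP vx vz xz.
have [_ y1 x1' nv1 [_ all1]] := oppP vy vx yx; have [_ y2 z3 _ _] := oppP vy vz yz.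
have n1 : opp v x y != opp v x z by apply: contraNneq yz => /inj ->.
have n2 : opp v y x != opp v y z by apply: contraNneq xz => /inj ->.
have n3 : opp v x z != opp v y z.
  by apply: contraNneq xy; rewrite (oppC e v x) (oppC e v y) => /inj ->.
have [_ _ dxz _ _] := oppP x1 x2 n1; have [_ dyx dyz _ _] := oppP y1 y2 n2.
rewrite eqd in dxz.
apply: (opp_uniq sym_e triangle_free mu2); rewrite // ?(oppC e v z) //.
apply: contraTneq dyx => ->; rewrite sym_e; apply/negP => zd.
by case: (all1 z vz zd) => eqz; [rewrite eqz eqxx in zy | rewrite eqz eqxx in zx].
Qed.

Lemma good_rotE v x y z : e v x -> e v y -> e v z -> x != y -> y != z -> x != z ->
  good v x y z = good v x z y.
Proof.
by move=> vx vy vz xy yz xz; apply/idP/idP; apply: good_rot; rewrite // eq_sym.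
Qed.

(** Both candidates for the last corner of the cube are neighbours of the vertex w opposite to
    [s.1]. Each has a computable label in one of two frames at w, and they coincide when the
    comparison of the frames matches the labels. *)
Lemma con_goodE s i j : FF s -> 0 < i < 7 -> 0 < j < 7 -> i != j ->
  good s.1 (lbl s i) (lbl s 0) (lbl s j) = con_good p i j.
Proof.
move=> Fs i7 j7 ij; have [i0 lti] := andP i7; have [j0 ltj] := andP j7.
have Es l : l < 7 -> e s.1 (lbl s l) by apply: frame_edge (FF_frame Fs).
have Ns l m : l < 7 -> m < 7 -> (lbl s l == lbl s m) = (l == m) by apply: frame_neq (FF_frame Fs).
have n0i : lbl s 0 != lbl s i by rewrite Ns // eq_sym -lt0n.
have ni0 : lbl s i != lbl s 0 by rewrite eq_sym.
have lt_turn t l m : l < 7 -> m < 7 -> lbl (turn m t) (sub7 l m) = lbl t l.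
  by move=> ltl ltm; rewrite lbl_turn ?sub7_lt // sub7K.
have turn0E t m : m < 7 -> lbl (turn m t) 0 = lbl t m.
  by move=> ltm; rewrite lbl_turn // add0n modn_small.
(* [A], [A2] cross through [lbl s 0] to w, and [B], [B2] through [lbl s i]. The turns are needed
   because crossing is described along label 0 only. *)
have [A [FA A1 A0 Al]] := FF_cross Fs.
have [A2 [FA2 A21 A20 A2l]] := FF_cross (FF_turn (pi i) FA).
have [B [FB B1 B0 Bl]] := FF_cross (FF_turn i Fs).
have [B2 [FB2 B21 B20 B2l]] := FF_cross (FF_turn (pi (sub7 0 i)) FB).
have s0i : 0 < sub7 0 i < 7 by apply: sub7_range; rewrite // eq_sym -lt0n.
have [s0i0 lts0i] := andP s0i.
have lpi := lt_pi lti.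
have p0i : 0 < sub7 0 (pi i) < 7.
  by apply: sub7_range; rewrite // eq_sym -lt0n; case/andP: (pi_range i7).
have pji : 0 < sub7 (pi j) (pi i) < 7.
  apply: sub7_range; rewrite ?lt_pi //; apply: contra ij => /eqP/pi_inj eqij.
  by rewrite eqij.
have sji : 0 < sub7 j i < 7 by apply: sub7_range; rewrite // eq_sym.
have [_ ltsji] := andP sji.
have psi : 0 < sub7 0 (pi (sub7 0 i)) < 7.
  by apply: sub7_range; rewrite ?lt_pi // eq_sym -lt0n; case/andP: (pi_range s0i).
have psj : 0 < sub7 (pi (sub7 j i)) (pi (sub7 0 i)) < 7.
  apply: sub7_range; rewrite ?lt_pi //; apply/eqP=> /pi_inj eqji.
  have /eqP := congr1 (fun m => (m + i) %% 7) (eqji ltsji lts0i).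
  by rewrite !sub7K // => /eqP j00; rewrite j00 in j0.
rewrite turn0E // in A20 A21 A2l; rewrite turn0E // in B1 Bl.
set w := opp s.1 (lbl s 0) (lbl s i).
have wE : w = opp s.1 (lbl s i) (lbl s 0) by apply: oppC.
have lAw : lbl A (pi i) = w by apply: Al.
have lBw : lbl B (pi (sub7 0 i)) = w by rewrite Bl // lt_turn // -wE.
have {}A21 : A2.1 = w by rewrite A21.
have {}B21 : B2.1 = w by rewrite B21 turn0E ?lt_pi.
have {}A20 : lbl A2 0 = lbl s 0 by rewrite A20 /= A1.
have {}B20 : lbl B2 0 = lbl s i by rewrite B20 /= B1.
have {}A2l m : 0 < m < 7 -> lbl A2 (pi m) = opp (lbl s 0) w (lbl (turn (pi i) A) m).
  by move=> m7; rewrite A2l // /= A1 lAw.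
have {}B2l m : 0 < m < 7 -> lbl B2 (pi m) = opp (lbl s i) w (lbl (turn (pi (sub7 0 i)) B) m).
  by move=> m7; rewrite B2l // turn0E ?lt_pi // lBw /= B1.
have Azeta : lbl A2 (con_zeta p i) = lbl s i.
  by rewrite A2l // lt_turn // A0 (oppC e _ w) opp_back ?Es.
have Bbeta : lbl B2 (con_beta p i) = lbl s 0.
  by rewrite B2l // lt_turn ?lt_pi // B0 /= (oppC e _ w) wE opp_back ?Es.
have Ad : lbl A2 (pi (sub7 (pi j) (pi i))) = opp (lbl s 0) w (opp s.1 (lbl s 0) (lbl s j)).
  by rewrite A2l // lt_turn ?lt_pi // Al.
have Bd : lbl B2 (pi (sub7 (pi (sub7 j i)) (pi (sub7 0 i)))) =
    opp (lbl s i) w (opp s.1 (lbl s i) (lbl s j)).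
  by rewrite B2l // lt_turn ?lt_pi // Bl // lt_turn.
(* The map is found from two vertices named in both frames: [lbl s 0] gives the constant term, and
   [lbl s i], labelled 0 in [B2], gives the coefficient. *)
have [|a [b [aI ltb defA]]] := FF_same FB2 FA2; first by rewrite A21 B21.
have lA2 m : m < 7 -> lbl A2 m = lbl B2 (aff7 a b m) by move=> ltm; rewrite defA lbl_relabel.
have Binj := lbl_inj (FF_frame FB2).
have zeta7 : 0 < con_zeta p i < 7 by apply: pi_range.
have [_ ltz] := andP zeta7; have ltbeta : con_beta p i < 7 by apply: lt_pi; rewrite sub7_lt.
have eqb : b = con_beta p i.
  apply: Binj => //; rewrite Bbeta -A20 lA2 //.
  by rewrite /aff7 muln0 add0n modn_small.
have eqa : a = con_alpha p i.
  have az : aff7 a b (con_zeta p i) = 0%N.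
    by apply: Binj; rewrite ?aff7_lt // -lA2 // Azeta B20.
  have /allP/(_ a aI)/allP/(_ b) := alpha_check; rewrite mem_iota => /(_ ltb).
  move=> /allP/(_ (con_zeta p i)); rewrite mem_iota => /(_ zeta7).
  by rewrite az eqxx eqb => /eqP.
have ltA : pi (sub7 (pi j) (pi i)) < 7 by rewrite lt_pi ?sub7_lt.
have ltB : pi (sub7 (pi (sub7 j i)) (pi (sub7 0 i))) < 7 by rewrite lt_pi ?sub7_lt.
rewrite /good -wE -/w -Ad -Bd lA2 // (frame_neq (FF_frame FB2)) ?aff7_lt //.
by rewrite eq_sym /con_good eqa eqb.
Qed.

(** [good] is symmetric in the three neighbours of the claw. The second equality comes from turning
    the frame by [i], which gives [lbl s0 i] the label 0. *)
Lemma con_symP : con_sym p.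
Proof.
apply/allP=> i; rewrite mem_iota => i7; apply/allP=> j; rewrite mem_iota => j7.
have [//|ij] := eqVneq i j; rewrite orFb.
have [i0 lti] := andP i7; have [j0 ltj] := andP j7.
have Es l : l < 7 -> e u0 (lbl s0 l) by apply: frame_edge frame_s0.
have Ns l m : l < 7 -> m < 7 -> (lbl s0 l == lbl s0 m) = (l == m) by apply: frame_neq frame_s0.
have Fs := FF_s0; have nji : j != i by rewrite eq_sym.
have [ni nj] : 0%N != i /\ 0%N != j by rewrite !(eq_sym 0%N) -!lt0n.
have [ni' nj'] : i != 0%N /\ j != 0%N by rewrite -!lt0n.
have lt_turn l : l < 7 -> lbl (turn i s0) (sub7 l i) = lbl s0 l.
  by move=> ltl; rewrite lbl_turn ?sub7_lt // sub7K.
have turn0E : lbl (turn i s0) 0 = lbl s0 i by rewrite lbl_turn // add0n modn_small.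
have ne : sub7 j i != sub7 0 i.
  apply/eqP=> /(congr1 (fun m => (m + i) %% 7)); rewrite !sub7K // => j00.
  by rewrite j00 in j0.
rewrite -(con_goodE Fs i7 j7 ij) -(con_goodE Fs j7 i7 nji).
rewrite -(con_goodE (FF_turn i Fs) (sub7_range ltj lti nji) (sub7_range (isT : 0 < 7) lti ni) ne).
rewrite !lt_turn // turn0E.
have swap : good u0 (lbl s0 i) (lbl s0 0) (lbl s0 j) = good u0 (lbl s0 j) (lbl s0 0) (lbl s0 i).
  by rewrite goodC good_rotE ?Es ?Ns // goodC.
by rewrite swap eqxx [X in _ == X]good_rotE ?Es ?Ns //= eqxx.
Qed.

Lemma con_cases : con_flat p \/ con_mobius p.
Proof.
have [q defp] : exists q, p = 0%N :: q.
  case: (p) (perm_size perm_p) pi0 => [|n q] //= _ <-; by exists q.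
have qI : q \in permutations (iota 1 6).
  by rewrite mem_permutations -(perm_cons 0%N) -defp.
have /allP/(_ q qI) := connection_check; rewrite -defp /= con_mulP con_invP con_symP.
by case: ifP; [left | right].
Qed.

Lemma con_flat_cube : con_flat p -> cube_closed e.
Proof.
move=> flat v x y z vx vy vz xy yz xz; have [s Fs sv] := FF_at v.
have {}flat i j : 0 < i < 7 -> 0 < j < 7 -> i != j -> con_good p i j.
  move=> i7 j7 ij; have /allP/(_ i) := flat; rewrite mem_iota => /(_ i7).
  by move=> /allP/(_ j); rewrite mem_iota => /(_ j7); rewrite (negPf ij).
rewrite -sv in vx vy vz *.
have [l ltl defx] := frame_idx (FF_frame Fs) vx.
have Ft := FF_turn l Fs; have t0 : lbl (turn l s) 0 = x by rewrite lbl_turn // add0n modn_small.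
have [i lti defy] := frame_idx (FF_frame Ft) vy; have [j ltj defz] := frame_idx (FF_frame Ft) vz.
have i0 : 0 < i by rewrite lt0n; apply: contraNneq xy => i0; rewrite defy i0 t0.
have j0 : 0 < j by rewrite lt0n; apply: contraNneq xz => j0; rewrite defz j0 t0.
have ij : i != j by apply: contraNneq yz => ij; rewrite defy defz ij.
have := flat i j; rewrite i0 j0 lti ltj => /(_ isT isT ij).
rewrite -(con_goodE Ft) ?i0 ?j0 // -defy -defz t0 => /eqP <-.
by rewrite (oppC e _ y x).
Qed.

Section Moebius.
Variable c : nat.
Hypothesis c7 : 0 < c < 7.
Hypothesis pi_moebius : forall i, i < 7 -> pi i = aff7 c 0 (inv7 i).

(** All six multipliers are allowed, not only the squares of [FF]: this absorbs the constant [c] and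
    admits x -> -x. *)
Definition LL s := exists t a b, [/\ FF t, 0 < a < 7, b < 7 & s = relabel (aff7 a b) t].

Lemma aff7_inj a b i j : 0 < a < 7 -> b < 7 -> i < 7 -> j < 7 -> aff7 a b i = aff7 a b j -> i = j.
Proof.
move=> a7 ltb lti ltj eqij; have /allP/(_ a) := aff7_inj_check; rewrite mem_iota => /(_ a7).
move=> /allP/(_ b); rewrite mem_iota => /(_ ltb) /allP/(_ i); rewrite mem_iota => /(_ lti).
by move=> /allP/(_ j); rewrite mem_iota => /(_ ltj); rewrite eqij eqxx => /eqP.
Qed.

Lemma LL_frame s : LL s -> frame s.
Proof.
move=> [t [a [b [Ft a7 ltb ->]]]]; apply: frame_relabel7 (FF_frame Ft) => [i _|i j lti ltj].
  exact: aff7_lt.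
exact: aff7_inj.
Qed.

Lemma LL_turn j s : LL s -> LL (turn j s).
Proof.
move=> [t [a [b [Ft a7 ltb ->]]]]; exists t, a, (aff7 a b j); split=> //; first exact: aff7_lt.
rewrite /turn relabel_relabel; last by move=> i _; apply: ltn_pmod.
apply: eq_relabel => i _; rewrite /aff7 modnDmr -[LHS]modnDml modnMmr modnDml mulnDr.
by rewrite addnA.
Qed.

Lemma LL_rigid s t i j : LL s -> LL t -> s.1 = t.1 -> i < 7 -> j < 7 -> i != j ->
  lbl s i = lbl t i -> lbl s j = lbl t j -> s = t.
Proof.
move=> [s' [a [b [Fs a7 ltb ->]]]] [t' [a' [b' [Ft a7' ltb' ->]]]] /= eqv lti ltj ij.
have [a0 [b0 [a0I ltb0 ->]]] := FF_same Fs Ft eqv.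
rewrite [relabel _ (relabel _ _)]relabel_relabel; last by move=> l _; apply: aff7_lt.
have eqc : relabel (fun l => aff7 a0 b0 (aff7 a' b' l)) s' =
           relabel (aff7 ((a0 * a') %% 7) (aff7 a0 b0 b')) s'.
  by apply: eq_relabel => l _; apply: aff7_comp.
rewrite eqc !lbl_relabel // => /(lbl_inj (FF_frame Fs) (aff7_lt _ _ _) (aff7_lt _ _ _)) ei.
move=> /(lbl_inj (FF_frame Fs) (aff7_lt _ _ _) (aff7_lt _ _ _)) ej.
have [-> ->] // := aff7_ext a7 (mul7_range (small124 a0I) a7') ltb (aff7_lt _ _ _) lti ltj ij ei ej.
Qed.

(** After a turn only a multiplier [a] remains, and inversion changes it into 1 / a; so the hop is
    the crossed frame relabelled by c / a. *)
Lemma LL_hop s : LL s -> LL (hop e s).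
Proof.
move=> [t [a [b [Ft a7 ltb ->]]]]; have F1 := FF_turn b Ft.
have -> : relabel (aff7 a b) t = relabel (aff7 a 0) (turn b t).
  rewrite /turn relabel_relabel; last by move=> i _; apply: aff7_lt.
  by apply: eq_relabel => i _; rewrite /aff7 addn0 modnDml.
move: (turn b t) F1 => {}t {}Ft; have [r [Fr r1 r0 rl]] := FF_cross Ft.
have inva7 : 0 < inv7 a < 7 by case: (inv7_spec a7).
have aff0 d : aff7 d 0 0 = 0%N by rewrite /aff7 muln0.
exists r, ((c * inv7 a) %% 7), 0%N; split=> //; first exact: mul7_range.
congr pair; first by rewrite lbl_relabel // aff0.
apply/eq_in_map => i; rewrite mem_iota add0n => /andP[_ lti].
have -> : aff7 ((c * inv7 a) %% 7) 0 i = aff7 c 0 (aff7 (inv7 a) 0 i).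
  by rewrite aff7_comp aff0.
case: eqVneq => [->|i0]; first by rewrite !aff0.
have i7 : 0 < i < 7 by rewrite lt0n i0.
have [/andP[ii ltii] _ _ _] := inv7_spec i7.
have lta : 0 < aff7 a 0 (inv7 i) < 7 by rewrite /aff7 addn0 mul7_range // ii.
have [_ lta'] := andP lta.
rewrite !lbl_relabel // aff0 -rl // pi_moebius //.
have /allP/(_ a) := inv7_aff_check; rewrite mem_iota => /(_ a7).
by move=> /allP/(_ i); rewrite mem_iota => /(_ lti) /eqP->.
Qed.

End Moebius.
End Connection.
End Paley.

Lemma mu2_valency7_false : T -> False.
Proof.
move=> u; have [g Gg [s [gu size_s Us sN gs]]] := labels reg_e tdt_e u (isT : prime 7).
pose s0 := (u, s); have frame_s0 : frame s0 by split.
have shift_s0 : exists2 g, g \in Aut e & g s0.1 = s0.1 /\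
    forall i, i < 7 -> g (lbl s0 i) = lbl s0 (i.+1 %% 7) by exists g.
have [p [pp p0 ltp pF]] := FF_connection frame_s0.
have Us0 i : i < 7 -> e u (lbl s0 i) by apply: frame_edge frame_s0.
have no_swap_lbl h i j : i < 7 -> j < 7 -> i != j -> h \in Aut e -> h u = u ->
    h (lbl s0 i) = lbl s0 j -> h (lbl s0 j) = lbl s0 i -> False.
  move=> lti ltj ij Gh hu hi hj; have := no_swap Gh hu (Us0 i lti); rewrite hi hj => /(_ erefl)/eqP.
  by rewrite (frame_neq frame_s0) // eq_sym (negPf ij).
have [flat|/hasP[c]] := con_cases frame_s0 shift_s0 pp p0 ltp pF.
  have cube_e := con_flat_cube frame_s0 shift_s0 pp p0 ltp pF flat.
  (* In the cube case any frame may be the target; exchanging the labels 0 and 1 is enough. *)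
  pose sw i := if i == 0%N then 1%N else if i == 1%N then 0%N else i.
  have Fsw : frame (relabel sw s0).
    apply: frame_relabel7 frame_s0; last by move=> [|[|i]] [|[|j]].
    by move=> [|[|i]].
  have [h Gh [hu hl]] := cube_extend sym_e irr_e conn_e reg_e tdt_e triangle_free mu2 cube_e erefl
    frame_s0 Fsw.
  by apply: (no_swap_lbl h 0%N 1%N); rewrite // hl // lbl_relabel.
rewrite mem_iota => c7 /allP pi_c.
have {}pi_c i : i < 7 -> nth 0%N p i = aff7 c 0 (inv7 i).
  by move=> lti; apply/eqP/pi_c; rewrite mem_iota.
have aff1 i : i < 7 -> aff7 1 0 i = i by move=> lti; rewrite /aff7 mul1n addn0 modn_small.
have LL1 : LL s0 s0.
  exists s0, 1%N, 0%N; split=> //; first exact: FF_s0.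
  rewrite (eq_relabel _ aff1); congr pair; rewrite -[LHS](mkseq_nth u) size_s.
  by [].
(* 6 is -1 mod 7, so this relabelling exchanges the labels 1 and 6. *)
have LL6 : LL s0 (relabel (aff7 6 0) s0).
  by exists s0, 6%N, 0%N; split=> //; apply: FF_s0.
have [h Gh [hu hl]] := hop_extend sym_e irr_e conn_e triangle_free mu2
  (LL_frame frame_s0) (@LL_turn s0) (LL_hop frame_s0 shift_s0 pF c7 pi_c) (LL_rigid frame_s0 shift_s0)
  LL1 LL6.
by apply: (no_swap_lbl h 1%N 6%N); rewrite // hl // lbl_relabel.
Qed.

End Valency7.

(** * Assembling the cases *)

Section TwoDistance.
Variables (T : finType) (e : rel T) (k : nat).
Implicit Types (u v w x y z a b c d : T).
Notation N := (nbhd e).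
Notation N2 := (nbhd2 e).
Hypotheses (sym_e : symmetric e) (irr_e : irreflexive e) (conn_e : connected_graph e).
Hypothesis reg_e : regular_of_valency e k.
Hypothesis tdt_e : two_distance_transitive e.
Hypothesis lp_e : locally_primitive e.

(** All quantifiers range over finite types, so the case distinction is made by a boolean test. *)
Lemma loc2_dec u : loc2 e u \/ ~ loc2 e u.
Proof.
pose P a b c d := [exists g in Aut e, [&& g u == u, g a == c & g b == d]].
case: (boolP [forall a in N u, forall b in N u, forall c in N u, forall d in N u,
    (a != b) ==> (c != d) ==> P a b c d]) => [all | /negP nall]; [left | right].
  move=> a b c d Na Nb Nc Nd ab cd.
  have /exists_inP[g Gg /and3P[/eqP ? /eqP ? /eqP ?]] : P a b c d.
    move/forall_inP/(_ a Na)/forall_inP/(_ b Nb)/forall_inP/(_ c Nc)/forall_inP/(_ d Nd): all.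
    by rewrite ab cd.
  by exists g.
move=> l2; apply: nall; apply/forall_inP=> a Na; apply/forall_inP=> b Nb; apply/forall_inP=> c Nc.
apply/forall_inP=> d Nd; apply/implyP=> ab; apply/implyP=> cd.
have [g Gg [gu ga gb]] := l2 a b c d Na Nb Nc Nd ab cd.
by apply/exists_inP; exists g; rewrite // gu ga gb !eqxx.
Qed.

Lemma dist2_ex : exists u w, w \in N2 u.
Proof.
have : [exists u, N2 u != set0].
  apply: contraT => /existsPn N20; case: (not_complete tdt_e) => x.
  suff all y : (x == y) || e x y by move=> y /negPf xy; have := all y; rewrite xy.
  move: y; apply: (conn_ind conn_e (x := x)) => [|y z]; first by rewrite eqxx.
  case/orP=> [/eqP->->|xy yz]; first by rewrite orbT.
  apply: contraT; rewrite negb_or => /andP[xz nxz].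
  suff : z \in N2 x by rewrite (eqP (negbNE (N20 x))) inE.
  by apply/inN2; split; rewrite 1?eq_sym //; exists y; rewrite xy.
by case/existsP=> u /set0Pn[w Nw]; exists u, w.
Qed.

Lemma triangles_icosahedron u v : k \in [:: 3; 5; 7] -> e u v -> 0 < #|N u :&: N v| ->
  graph_iso e icosahedron.
Proof.
rewrite !inE => /or3P[] /eqP kE uv lam.
- by rewrite (no_triangle3 sym_e irr_e conn_e reg_e tdt_e kE uv) in lam.
- have [s [D DD circ]] := circulant5 sym_e irr_e conn_e reg_e tdt_e u kE uv lam.
  apply: (lambda2_icosahedron sym_e irr_e conn_e reg_e tdt_e kE _ u) => x y xy.
  have k_pr : prime k by rewrite kE.
  rewrite (circulant_count tdt_e k_pr circ xy) kE.
  by move: DD; rewrite !inE => /orP[] /eqP->.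
have [s [D _ [[lam2 _] | [lam4 _]]]] := circulant7 sym_e irr_e conn_e reg_e tdt_e u kE uv lam.
  by case: (lambda7_neq2 sym_e irr_e conn_e reg_e tdt_e kE uv).
by case: (lambda7_neq4 sym_e irr_e conn_e reg_e tdt_e kE uv).
Qed.

Lemma triangle_free_two_arc : k \in [:: 3; 5; 7] -> (forall u, ~ loc2 e u) ->
  (forall u v x, e u v -> e v x -> ~~ e u x) -> two_arc_transitive e.
Proof.
move=> k357 not_loc2 tri; have [u [w Nw]] := dist2_ex.
have card_N2 := card_N2_mu sym_e irr_e reg_e tdt_e tri Nw.
have mu_le : #|N u :&: N w| <= k by rewrite -(reg_e u) subset_leq_card ?subsetIl.
have mu_all m x y : #|N u :&: N w| = m -> y \in N2 x -> #|N x :&: N y| = m.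
  by move=> <- /(card_common_dist2 tdt_e Nw).
have k2 : 2 < k by move: k357; rewrite !inE => /or3P[] /eqP->.
have neqk := muk_loc2 sym_e irr_e reg_e tdt_e tri Nw.
have neqk1 := muk1_loc2 sym_e irr_e reg_e tdt_e tri k2 Nw.
case: (eqVneq #|N u :&: N w| 1%N) => [|mu1]; first exact: mu1_two_arc.
exfalso; case: (eqVneq #|N u :&: N w| k) => [/neqk|muk]; first exact: not_loc2.
case: (eqVneq #|N u :&: N w| k.-1) => [/neqk1|muk1]; first exact: not_loc2.
(* mu divides 6, 20 or 42 and is none of 1, k - 1, k. Nothing is left for k = 3, only 2 for k = 5,
   and 2 or 3 for k = 7. *)
move: k357; rewrite !inE => /or3P[] /eqP kE; move: card_N2 mu_le mu1 muk muk1; rewrite kE.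
- by case: #|_ :&: _| => [|[|[|[|m]]]]; rewrite ?muln0.
- case muE: #|_ :&: _| => [|[|[|[|[|[|m]]]]]] //; rewrite ?muln0 //; last by lia.
  move=> card_N2 _ _ _ _; apply: (not_loc2 u).
  apply: (mu2_k5_loc2 sym_e tdt_e tri _ Nw); first by move=> x y; apply: mu_all muE.
  by have -> : #|N2 u| = 10 by lia.
case muE: #|_ :&: _| => [|[|[|[|[|[|[|[|m]]]]]]]] //; rewrite ?muln0 //; try lia.
  have reg7 : regular_of_valency e 7 by rewrite -kE.
  move=> *; apply: (mu2_valency7_false sym_e irr_e conn_e reg7 tdt_e tri _ not_loc2 u).
  by move=> x y; apply: mu_all muE.
move=> *; apply: (mu3_false sym_e irr_e reg_e tdt_e tri lp_e kE _ not_loc2).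
by move=> x y; apply: mu_all muE.
Qed.

End TwoDistance.

Theorem theorem1p4 (T : finType) (e : rel T) (k : nat) :
  simple_graph e -> connected_graph e -> regular_of_valency e k -> k <= 8 ->
  two_distance_transitive e -> locally_primitive e ->
  two_arc_transitive e \/ graph_iso e icosahedron.
Proof.
move=> [sym_e irr_e] conn_e reg_e k8 tdt_e lp_e.
have [u [w Nw]] := dist2_ex conn_e tdt_e.
have [l2|nl2] := loc2_dec e u; first by left; apply: loc2_two_arc l2.
have not_loc2 x : ~ loc2 e x.
  by have [g Gg gx] := aut_vt tdt_e x u; move=> /(loc2_aut Gg); rewrite gx.
have k357 : k \in [:: 3; 5; 7].
  have small : ~ (k <= 2) by move=> k2; apply: nl2; apply: (loc2_small reg_e tdt_e k2).
  have even : ~ (k \in [:: 4; 6; 8]) by move=> kE; apply: nl2; apply: (loc2_468 reg_e tdt_e lp_e kE).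
  by move: (k) k8 small even => [|[|[|[|[|[|[|[|[|m]]]]]]]]] //; lia.
have [[x [y xy lam]]|no_tri] : (exists x, exists2 y, e x y & 0 < #|nbhd e x :&: nbhd e y|) \/
    forall x y, e x y -> #|nbhd e x :&: nbhd e y| = 0%N.
  case: (boolP [exists x, exists y, e x y && (0 < #|nbhd e x :&: nbhd e y|)]).
    by case/existsP=> x /existsP[y /andP[xy lam]]; left; exists x, y.
  move/existsPn=> none; right=> x y xy; have /existsPn/(_ y) := none x.
  by rewrite xy lt0n negbK => /eqP.
  by right; apply: (triangles_icosahedron sym_e irr_e conn_e reg_e tdt_e k357 xy lam).
left; apply: (triangle_free_two_arc sym_e irr_e conn_e reg_e tdt_e lp_e k357 not_loc2) => x y z xy yz.
apply/negP=> xz; have := no_tri x y xy; move/eqP; rewrite cards_eq0 => /eqP/setP/(_ z).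
by rewrite !inE xz yz.
Qed.
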